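(* Let $\mathbb{A}$ be the field of real algebraic numbers. The universal fragment of $T[\mathbb{A}]$ is decidable.
   Context: Let $F$ be a subfield of $\mathbb{R}$. For $a\in F$ let $f_a$ be a unary function symbol interpreted as $f_a(x)=ax$. $T_{\mathrm{add}}[F]$ is the set of all first-order sentences true in $(\mathbb{R},0,1,+,-,<,(f_a)_{a\in F})$, and $T_{\mathrm{mult}}[F]$ is the set of all first-order sentences true in $(\mathbb{R},0,1,\times,\div,<,(f_a)_{a\in F})$, where $x\div 0$ is interpreted as $0$. $T[F]=T_{\mathrm{add}}[F]\cup T_{\mathrm{mult}}[F]$, a theory in the union of the two languages. The universal fragment of $T[F]$ is the set of universal sentences in the language of $T[F]$ provable in $T[F]$. *)

(* Defs.v *)
From Stdlib Require Import Reals List ZArith Arith.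
Import ListNotations.
Open Scope R_scope.

Fixpoint Zpoly_eval (p : list Z) (x : R) : R :=
  match p with
  | [] => 0
  | c :: q => IZR c + x * Zpoly_eval q x
  end.

Definition Zpoly_nonzero (p : list Z) : Prop := exists c, In c p /\ c <> 0%Z.

Definition is_real_algebraic (a : R) : Prop :=
  exists p, Zpoly_nonzero p /\ Zpoly_eval p a = 0.

Definition Alg : Type := { a : R | is_real_algebraic a }.

Inductive term : Type :=
| TVar (i : nat)
| TZero
| TOne
| TAdd (t u : term)
| TSub (t u : term)
| TMul (t u : term)
| TDiv (t u : term)
| TScal (a : Alg) (t : term).

Inductive formula : Type :=
| FFalse
| FEq (t u : term)
| FLt (t u : term)
| FNot (p : formula)
| FAnd (p q : formula)
| FOr (p q : formula)
| FImp (p q : formula)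
| FAll (p : formula)
| FEx (p : formula).

Fixpoint term_add (t : term) : Prop :=
  match t with
  | TVar _ | TZero | TOne => True
  | TAdd t u | TSub t u => term_add t /\ term_add u
  | TMul _ _ | TDiv _ _ => False
  | TScal _ t => term_add t
  end.

Fixpoint term_mult (t : term) : Prop :=
  match t with
  | TVar _ | TZero | TOne => True
  | TMul t u | TDiv t u => term_mult t /\ term_mult u
  | TAdd _ _ | TSub _ _ => False
  | TScal _ t => term_mult t
  end.

Fixpoint form_in (L : term -> Prop) (p : formula) : Prop :=
  match p with
  | FFalse => True
  | FEq t u | FLt t u => L t /\ L u
  | FNot p | FAll p | FEx p => form_in L p
  | FAnd p q | FOr p q | FImp p q => form_in L p /\ form_in L q
  end.

Fixpoint term_closed (k : nat) (t : term) : Prop :=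
  match t with
  | TVar i => (i < k)%nat
  | TZero | TOne => True
  | TAdd t u | TSub t u | TMul t u | TDiv t u => term_closed k t /\ term_closed k u
  | TScal _ t => term_closed k t
  end.

Fixpoint form_closed (k : nat) (p : formula) : Prop :=
  match p with
  | FFalse => True
  | FEq t u | FLt t u => term_closed k t /\ term_closed k u
  | FNot p => form_closed k p
  | FAll p | FEx p => form_closed (S k) p
  | FAnd p q | FOr p q | FImp p q => form_closed k p /\ form_closed k q
  end.

Definition sentence (p : formula) : Prop := form_closed 0 p.

Fixpoint qfree (p : formula) : Prop :=
  match p with
  | FFalse | FEq _ _ | FLt _ _ => True
  | FNot p => qfree p
  | FAnd p q | FOr p q | FImp p q => qfree p /\ qfree q
  | FAll _ | FEx _ => False
  end.

Inductive universal : formula -> Prop :=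
| univ_qf p : qfree p -> universal p
| univ_all p : universal p -> universal (FAll p).

Record structure : Type := {
  carrier : Type;
  s_zero : carrier;
  s_one : carrier;
  s_add : carrier -> carrier -> carrier;
  s_sub : carrier -> carrier -> carrier;
  s_mul : carrier -> carrier -> carrier;
  s_div : carrier -> carrier -> carrier;
  s_lt : carrier -> carrier -> Prop;
  s_scal : Alg -> carrier -> carrier
}.

Fixpoint teval (M : structure) (e : nat -> carrier M) (t : term) : carrier M :=
  match t with
  | TVar i => e i
  | TZero => s_zero M
  | TOne => s_one M
  | TAdd t u => s_add M (teval M e t) (teval M e u)
  | TSub t u => s_sub M (teval M e t) (teval M e u)
  | TMul t u => s_mul M (teval M e t) (teval M e u)
  | TDiv t u => s_div M (teval M e t) (teval M e u)
  | TScal a t => s_scal M a (teval M e t)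
  end.

Definition scons {X : Type} (x : X) (e : nat -> X) : nat -> X :=
  fun i => match i with O => x | S j => e j end.

Fixpoint sat (M : structure) (e : nat -> carrier M) (p : formula) : Prop :=
  match p with
  | FFalse => False
  | FEq t u => teval M e t = teval M e u
  | FLt t u => s_lt M (teval M e t) (teval M e u)
  | FNot p => ~ sat M e p
  | FAnd p q => sat M e p /\ sat M e q
  | FOr p q => sat M e p \/ sat M e q
  | FImp p q => sat M e p -> sat M e q
  | FAll p => forall x, sat M (scons x e) p
  | FEx p => exists x, sat M (scons x e) p
  end.

Definition true_in (M : structure) (p : formula) : Prop := forall e, sat M e p.

Definition Rdiv0 (x y : R) : R :=
  if Req_EM_T y 0 then 0 else x / y.

Definition Rstd : structure := {|
  carrier := R;
  s_zero := 0; s_one := 1;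
  s_add := Rplus; s_sub := Rminus; s_mul := Rmult; s_div := Rdiv0;
  s_lt := Rlt;
  s_scal := fun a x => proj1_sig a * x
|}.

Definition T_add (p : formula) : Prop :=
  sentence p /\ form_in term_add p /\ true_in Rstd p.
Definition T_mult (p : formula) : Prop :=
  sentence p /\ form_in term_mult p /\ true_in Rstd p.
Definition T_A (p : formula) : Prop := T_add p \/ T_mult p.

(* Provability in T[A], via the completeness theorem: truth in every model. *)
Definition model_of_T_A (M : structure) : Prop :=
  forall p, T_A p -> true_in M p.
Definition provable_T_A (p : formula) : Prop :=
  forall M, model_of_T_A M -> true_in M p.

Inductive recf : Type :=
| RZero
| RSucc
| RProj (i : nat)
| RComp (f : recf) (gs : list recf)
| RPrec (f g : recf)
| RMin (f : recf).

Inductive reval : recf -> list nat -> nat -> Prop :=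
| ev_zero v : reval RZero v 0
| ev_succ x v : reval RSucc (x :: v) (S x)
| ev_proj i v : (i < length v)%nat -> reval (RProj i) v (nth i v 0%nat)
| ev_comp f gs v ys y :
    Forall2 (fun g y => reval g v y) gs ys -> reval f ys y -> reval (RComp f gs) v y
| ev_prec0 f g v y : reval f v y -> reval (RPrec f g) (0%nat :: v) y
| ev_precS f g n v z y :
    reval (RPrec f g) (n :: v) z -> reval g (n :: z :: v) y ->
    reval (RPrec f g) (S n :: v) y
| ev_min f v n :
    reval f (n :: v) 0%nat ->
    (forall m, (m < n)%nat -> exists k, reval f (m :: v) (S k)) ->
    reval (RMin f) v n.

Definition decidable_set (S : nat -> Prop) : Prop :=
  exists f : recf, forall n,
    (S n -> reval f [n] 0%nat) /\ (~ S n -> reval f [n] 1%nat).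

Definition npair (x y : nat) : nat := ((x + y) * (x + y + 1)) / 2 + y.

Definition code_Z (z : Z) : nat :=
  match z with
  | Z0 => 0
  | Zpos p => 2 * Pos.to_nat p
  | Zneg p => 2 * Pos.to_nat p - 1
  end.

Fixpoint code_Zlist (l : list Z) : nat :=
  match l with
  | [] => 0
  | z :: l' => S (npair (code_Z z) (code_Zlist l'))
  end.

(* n codes the algebraic number a as the k-th (from 0, increasing order)
   real root of the nonzero integer polynomial p. *)
Definition code_alg (n : nat) (a : Alg) : Prop :=
  exists p k, n = npair (code_Zlist p) k /\ Zpoly_nonzero p /\
    Zpoly_eval p (proj1_sig a) = 0 /\
    exists l : list R, NoDup l /\ length l = k /\
      (forall x, In x l <-> (x < proj1_sig a /\ Zpoly_eval p x = 0)).

Fixpoint code_term (t : term) (n : nat) : Prop :=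
  match t with
  | TVar i => n = npair 0 i
  | TZero => n = npair 1 0
  | TOne => n = npair 2 0
  | TAdd t u => exists m k, n = npair 3 (npair m k) /\ code_term t m /\ code_term u k
  | TSub t u => exists m k, n = npair 4 (npair m k) /\ code_term t m /\ code_term u k
  | TMul t u => exists m k, n = npair 5 (npair m k) /\ code_term t m /\ code_term u k
  | TDiv t u => exists m k, n = npair 6 (npair m k) /\ code_term t m /\ code_term u k
  | TScal a t => exists m k, n = npair 7 (npair m k) /\ code_alg m a /\ code_term t k
  end.

Fixpoint code_form (p : formula) (n : nat) : Prop :=
  match p with
  | FFalse => n = npair 0 0
  | FEq t u => exists m k, n = npair 1 (npair m k) /\ code_term t m /\ code_term u k
  | FLt t u => exists m k, n = npair 2 (npair m k) /\ code_term t m /\ code_term u k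
  | FNot p => exists m, n = npair 3 m /\ code_form p m
  | FAnd p q => exists m k, n = npair 4 (npair m k) /\ code_form p m /\ code_form q k
  | FOr p q => exists m k, n = npair 5 (npair m k) /\ code_form p m /\ code_form q k
  | FImp p q => exists m k, n = npair 6 (npair m k) /\ code_form p m /\ code_form q k
  | FAll p => exists m, n = npair 7 m /\ code_form p m
  | FEx p => exists m, n = npair 8 m /\ code_form p m
  end.

Definition universal_fragment_T_A (n : nat) : Prop :=
  exists p, code_form p n /\ sentence p /\ universal p /\ provable_T_A p.

(* Main.v *)
(** A formula fails in a model of T[A] exactly when, for every finite set of real
    algebraic numbers, the values of its subterms in the additive and in the
    multiplicative language can be realized separately by real numbers v and w
    whose ratios lie in the same cuts of that set. This is equivalent to an
    approximate condition: for some real r_ij and every eps > 0 there are such v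
    and w with |v_i - r_ij v_j| <= eps |v_j|, with |w_i - r_ij w_j| <= eps |w_j|,
    and with v_i - r_ij v_j of the sign of w_i - r_ij w_j. In the limit one gets
    v and w in a real closed field, and an automorphism of its order that commutes
    with the real algebraic numbers and takes v to w, built by back-and-forth,
    glues the two structures. Conversely the ratios of a refuting model give cuts
    r_ij. Their signs agree where r_ij is algebraic; where it is not, r_ij can be
    moved, for otherwise a semialgebraic condition over the rationals would
    isolate points that include no algebraic one. The existence of the r_ij is a
    first-order statement about the real field, and the theory of real closed
    fields is complete and recursively axiomatized, hence decidable: Herbrand's
    theorem yields certificates for a prenex statement and for its negation. *)

From HB Require Import structures.
From mathcomp Require Import all_boot all_order all_algebra polyrcf realalg.
From mathcomp Require qe_rcf qe_rcf_th ordered_qelim.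
From mathcomp Require Import boolp zify ring lra.
From Stdlib Require PeanoNat ZArith Reals.
From mathcomp Require Import Rstruct classical_sets reals.
Require Import Defs.
Set Implicit Arguments.
Unset Strict Implicit.
Unset Printing Implicit Defensive.
Import Order.TTheory GRing.Theory Num.Theory.
Local Open Scope ring_scope.

(** * Quantifier elimination over the rationals *)

(** Quantifier elimination serves here only to carry statements from one real closed field to
    another. Its formulas are never executed, so they may be obtained classically. The decision
    procedure is a blind search: it tests finitely many Herbrand instances against all truth
    assignments to their atoms, which requires only that the instances be computable. One
    compactness argument, on truth assignments to atoms [a < b] between coded terms, is used twice:
    to build a real closed field when no refutation exists, and to take the limit of the approximate
    solutions. In both cases the field consists of classes of term codes; in the second its
    countability is what back-and-forth demands, and it contains the limit of [1 / (k + 1)], an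
    infinitesimal that supplies images for elements infinitely far from all given orbits. The
    approximate condition is introduced because exact agreement of cuts quantifies over all real
    algebraic numbers, whereas real ratios with a tolerance leave finitely many real variables and
    hence a first-order statement. *)

Section RatTransfer.
Import qe_rcf.
Variable K : rcfType.

Fixpoint tmap (t : term rat) : term K :=
  match t with
  | Var i => Var _ i
  | Const x => Const (ratr x)
  | NatConst n => NatConst _ n
  | Add u v => Add (tmap u) (tmap v)
  | Opp u => Opp (tmap u)
  | NatMul u n => NatMul (tmap u) n
  | Mul u v => Mul (tmap u) (tmap v)
  | Exp u n => Exp (tmap u) n
  end.

Fixpoint fmap (f : formula rat) : formula K :=
  match f with
  | Bool b => Bool b
  | Equal t u => Equal (tmap t) (tmap u)
  | Lt t u => Lt (tmap t) (tmap u)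
  | Le t u => Le (tmap t) (tmap u)
  | And f g => And (fmap f) (fmap g)
  | Or f g => Or (fmap f) (fmap g)
  | Implies f g => Implies (fmap f) (fmap g)
  | Not f => Not (fmap f)
  end.

Notation pmap := (map tmap).
Notation cont X g k k' := (forall x : X, fmap (k x) = k' (g x)).

(** The elimination procedure is in continuation-passing style: it tests coefficients by building a
    formula and passing each result on. Hence these lemmas assume that the continuations [k] and
    [k'] correspond under the translation of constants. *)
Lemma fmap_Size p k k' : cont nat id k k' -> fmap (Size p k) = Size (pmap p) k'.
Proof.
elim: p k k' => [|c p IH] k k' Hk /=; first exact: Hk.
rewrite /bind_def; apply: IH => -[|n] //=.
by rewrite /If /= !Hk.
Qed.

Lemma fmap_Isnull p k k' : cont bool id k k' -> fmap (Isnull p k) = Isnull (pmap p) k'.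
Proof. by move=> Hk; apply: fmap_Size => n; apply: Hk. Qed.

Lemma fmap_LtSize p q k k' :
  cont bool id k k' -> fmap (LtSize p q k) = LtSize (pmap p) (pmap q) k'.
Proof. by move=> Hk; apply: fmap_Size => n; apply: fmap_Size => m; apply: Hk. Qed.

Lemma fmap_LeadCoef p k k' :
  cont (term rat) tmap k k' -> fmap (LeadCoef p k) = LeadCoef (pmap p) k'.
Proof.
elim: p k k' => [|c p IH] k k' Hk /=; first by rewrite Hk /= rmorph0.
by rewrite /bind_def; apply: IH => x; rewrite /If /= !Hk.
Qed.

Lemma pmap_AmulXn a n : pmap (AmulXn a n) = AmulXn (tmap a) n.
Proof. by elim: n => //= n ->; rewrite rmorph0. Qed.

Lemma pmap_AddPoly p q : pmap (AddPoly p q) = AddPoly (pmap p) (pmap q).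
Proof. by elim: p q => [|a p IH] [|b q] //=; rewrite IH. Qed.

Lemma pmap_ScalPoly c p : pmap (ScalPoly c p) = ScalPoly (tmap c) (pmap p).
Proof. by rewrite /ScalPoly -!map_comp; apply: eq_map. Qed.

Lemma pmap_MulPoly p q : pmap (MulPoly p q) = MulPoly (pmap p) (pmap q).
Proof. by elim: p => [|a p IH] //=; rewrite pmap_AddPoly pmap_ScalPoly /= IH. Qed.

Lemma pmap_ExpPoly p n : pmap (ExpPoly p n) = ExpPoly (pmap p) n.
Proof. by rewrite /ExpPoly; elim: n => [|[|n] IH] //=; rewrite pmap_MulPoly IH. Qed.

Lemma pmap_OppPoly p : pmap (OppPoly p) = OppPoly (pmap p).
Proof. by rewrite /OppPoly pmap_ScalPoly /= rmorphN1. Qed.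

Lemma pmap_NatMulPoly n p : pmap (NatMulPoly n p) = NatMulPoly n (pmap p).
Proof. exact: pmap_ScalPoly. Qed.

Lemma pmap_Deriv p : pmap (Deriv p) = Deriv (pmap p).
Proof. by elim: p => [|a p IH] //=; rewrite pmap_AddPoly /= IH. Qed.

Definition pmap3 (d : nat * polyF rat * polyF rat) : nat * polyF K * polyF K :=
  (d.1.1, pmap d.1.2, pmap d.2).

Lemma fmap_Rediv_rec_loop q sq cq c qq r n k k' :
  cont (nat * polyF rat * polyF rat)%type pmap3 k k' ->
  fmap (Rediv_rec_loop q sq cq c qq r n k)
  = Rediv_rec_loop (pmap q) sq (tmap cq) c (pmap qq) (pmap r) n k'.
Proof.
move=> Hk; elim: n c qq r => [|n IH] c qq r /=; rewrite /bind_def;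
  apply: fmap_Size => m /=; case: ifP => _; rewrite ?Hk //;
  apply: fmap_LeadCoef => l; [rewrite Hk /pmap3 /=|rewrite IH];
  by rewrite !(pmap_AddPoly, pmap_MulPoly, pmap_OppPoly, pmap_AmulXn).
Qed.

Lemma fmap_Rediv p q k k' :
  cont (nat * polyF rat * polyF rat)%type pmap3 k k' ->
  fmap (Rediv p q k) = Rediv (pmap p) (pmap q) k'.
Proof.
move=> Hk; rewrite /Rediv /bind_def; apply: fmap_Isnull => -[] /=.
  by rewrite Hk /pmap3 /= rmorph0.
apply: fmap_Size => sq; apply: fmap_Size => sp; apply: fmap_LeadCoef => lq.
by rewrite (fmap_Rediv_rec_loop _ _ _ _ _ _ _ Hk) /= rmorph0.
Qed.

Lemma fmap_Rmod p q k k' :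
  cont (polyF rat) pmap k k' -> fmap (Rmod p q k) = Rmod (pmap p) (pmap q) k'.
Proof. by move=> Hk; apply: fmap_Rediv => d; apply: Hk. Qed.

Lemma fmap_Rscal p q k k' :
  cont nat id k k' -> fmap (Rscal p q k) = Rscal (pmap p) (pmap q) k'.
Proof. by move=> Hk; apply: fmap_Rediv => d; apply: Hk. Qed.

Lemma fmap_Rgcd_loop n p q k k' :
  cont (polyF rat) pmap k k' ->
  fmap (Rgcd_loop n p q k) = Rgcd_loop n (pmap p) (pmap q) k'.
Proof.
move=> Hk; elim: n p q => [|n IH] p q /=; rewrite /bind_def;
  apply: fmap_Rmod => r; apply: fmap_Isnull => -[]; rewrite ?Hk //; exact: IH.
Qed.

Lemma fmap_Rgcd p q k k' :
  cont (polyF rat) pmap k k' -> fmap (Rgcd p q k) = Rgcd (pmap p) (pmap q) k'.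
Proof.
move=> Hk; rewrite /Rgcd /bind_def; apply: fmap_LtSize => -[];
  apply: fmap_Isnull => -[]; rewrite ?Hk //; apply: fmap_Size => n;
  exact: fmap_Rgcd_loop.
Qed.

Lemma fmap_BigRgcd ps k k' :
  cont (polyF rat) pmap k k' -> fmap (BigRgcd ps k) = BigRgcd (map pmap ps) k'.
Proof.
elim: ps k k' => [|p ps IH] k k' Hk /=; first by rewrite Hk /= rmorph0.
by rewrite /bind_def; apply: IH => r; apply: fmap_Rgcd.
Qed.

Lemma fmap_Changes s k k' :
  cont nat id k k' -> fmap (Changes s k) = Changes (pmap s) k'.
Proof.
elim: s k k' => [|a s IH] k k' Hk /=; first exact: Hk.
rewrite /bind_def; apply: IH => v; rewrite /If /= !Hk.
by case: s.
Qed.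

Lemma fmap_SeqPInfty ps k k' :
  cont (polyF rat) pmap k k' -> fmap (SeqPInfty ps k) = SeqPInfty (map pmap ps) k'.
Proof.
elim: ps k k' => [|p ps IH] k k' Hk /=; first exact: Hk.
by rewrite /bind_def; apply: fmap_LeadCoef => l; apply: IH => r; rewrite Hk.
Qed.

Lemma fmap_SeqMInfty ps k k' :
  cont (polyF rat) pmap k k' -> fmap (SeqMInfty ps k) = SeqMInfty (map pmap ps) k'.
Proof.
elim: ps k k' => [|p ps IH] k k' Hk /=; first exact: Hk.
rewrite /bind_def; apply: fmap_LeadCoef => l; apply: fmap_Size => m.
by apply: IH => r; rewrite Hk /= rmorphN1.
Qed.

Lemma fmap_ChangesPoly ps k k' :
  cont int id k k' -> fmap (ChangesPoly ps k) = ChangesPoly (map pmap ps) k'.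
Proof.
move=> Hk; rewrite /ChangesPoly /bind_def; apply: fmap_SeqMInfty => m.
apply: fmap_SeqPInfty => p; apply: fmap_Changes => a.
by apply: fmap_Changes => b; apply: Hk.
Qed.

Lemma fmap_NextMod p q k k' :
  cont (polyF rat) pmap k k' -> fmap (NextMod p q k) = NextMod (pmap p) (pmap q) k'.
Proof.
move=> Hk; rewrite /NextMod /bind_def; apply: fmap_LeadCoef => l.
apply: fmap_Rscal => s; apply: fmap_Rmod => r.
by rewrite Hk pmap_ScalPoly.
Qed.

Lemma fmap_ModsAux p q n k k' :
  cont (seq (polyF rat)) (map pmap) k k' ->
  fmap (ModsAux p q n k) = ModsAux (pmap p) (pmap q) n k'.
Proof.
elim: n p q k k' => [|n IH] p q k k' Hk /=; first exact: Hk.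
rewrite /bind_def; apply: fmap_Isnull => -[]; first exact: Hk.
by apply: fmap_NextMod => r; apply: IH => s; apply: Hk.
Qed.

Lemma fmap_Mods p q k k' :
  cont (seq (polyF rat)) (map pmap) k k' -> fmap (Mods p q k) = Mods (pmap p) (pmap q) k'.
Proof.
by move=> Hk; rewrite /Mods /bind_def; do 2!apply: fmap_Size => ?; apply: fmap_ModsAux.
Qed.

Lemma nth_pmap i (s : seq (polyF rat)) : nth [::] (map pmap s) i = pmap (nth [::] s i).
Proof. by elim: s i => [|p s IH] [|i] /=. Qed.

Lemma pmap_PolyComb sq sc : pmap (PolyComb sq sc) = PolyComb (map pmap sq) sc.
Proof.
rewrite /PolyComb size_map /reducebig; elim: (iota _ _) => //= i s IH.
by rewrite pmap_MulPoly IH pmap_ExpPoly nth_pmap.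
Qed.

Lemma pmap_Pcq sq i : pmap (Pcq sq i) = Pcq (map pmap sq) i.
Proof.
rewrite /Pcq size_map -nth_pmap -map_comp; congr nth.
by apply: eq_map => x /=; rewrite pmap_PolyComb.
Qed.

Lemma fmap_TaqR p q k k' :
  cont int id k k' -> fmap (TaqR p q k) = TaqR (pmap p) (pmap q) k'.
Proof.
move=> Hk; rewrite /TaqR /bind_def -pmap_Deriv -pmap_MulPoly; apply: fmap_Mods => r.
exact: fmap_ChangesPoly.
Qed.

Lemma fmap_TaqsR p sq i k k' :
  cont (term rat) tmap k k' -> fmap (TaqsR p sq i k) = TaqsR (pmap p) (map pmap sq) i k'.
Proof.
move=> Hk; rewrite /TaqsR /bind_def -pmap_Pcq; apply: fmap_TaqR => n.
by rewrite Hk /= ratr_int.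
Qed.

(** The coefficients come from the inverse of an integer matrix, and inversion commutes with the
    embedding of the rationals. *)
Lemma ratr_coefs n i : ratr (qe_rcf_th.coefs rat n i) = qe_rcf_th.coefs K n i.
Proof.
rewrite /qe_rcf_th.coefs.
have sz (T : Type) (f : 'I_(3 ^ n) -> T) : size (map f (enum 'I_(3 ^ n))) = (3 ^ n)%N.
  by rewrite size_map size_enum_ord.
have [lti|lei] := ltnP i (3 ^ n); last by rewrite !nth_default ?sz // rmorph0.
rewrite !(nth_map (Ordinal lti)) ?(size_enum_ord, =^~ enumT) //.
set j := nth _ _ _; rewrite !castmxE.
have -> : map_mx intr (qe_rcf_th.ctmat n) =
  map_mx (@ratr K) (map_mx intr (qe_rcf_th.ctmat n)).
  by rewrite -map_mx_comp; apply/matrixP => ? ?; rewrite !mxE /= ratr_int.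
by rewrite -map_invmx [RHS]mxE.
Qed.

Lemma fmap_CcountWeak p sq k k' :
  cont (term rat) tmap k k' ->
  fmap (CcountWeak p sq k) = CcountWeak (pmap p) (map pmap sq) k'.
Proof.
move=> Hk; rewrite /CcountWeak size_map -[0%qfT in RHS]/(tmap 0%qfT).
move: (0%qfT : term rat); elim: (3 ^ size sq)%N => [|n IH] x /=; first exact: Hk.
rewrite /bind_def; apply: fmap_TaqsR => t; rewrite IH /=.
set aux := (X in X _ n k'); congr (aux (Add (Mul _ (Const _)) _) n k').
case: (size sq) => [|[|m]]; rewrite ?rmorph_nat ?ratr_coefs //.
by case: n {IH} => [|[|[|n]]] /=; rewrite ?nth_nil ?rmorph0 ?fmorphV ?rmorph_nat.
Qed.

(** [CcountGt0] tests whether some common root of [sp] makes all of [sq] positive. One rational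
    formula therefore does this in every real closed field. *)
Lemma fmap_CcountGt0 sp sq :
  fmap (CcountGt0 sp sq) = CcountGt0 (map pmap sp) (map pmap sq).
Proof.
rewrite /CcountGt0 /bind_def; apply: fmap_BigRgcd => p; apply: fmap_Isnull => -[] /=;
  last by apply: fmap_CcountWeak.
have -> : BoundingPoly (map pmap sq) = pmap (BoundingPoly sq).
  rewrite /BoundingPoly pmap_Deriv; congr Deriv.
  by rewrite /reducebig; elim: sq => //= q sq IH; rewrite pmap_MulPoly IH.
apply: fmap_CcountWeak => c /=; congr Or; last congr Or.
- rewrite /reducebig; elim: sq => //= q sq IH; rewrite IH; congr And.
  exact: fmap_LeadCoef.
- rewrite /reducebig; elim: sq => //= q sq IH; rewrite IH; congr And.
  by apply: fmap_Size => n; apply: fmap_LeadCoef.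
Qed.

End RatTransfer.

(** * Semialgebraic predicates *)

Notation rterm := (qe_rcf.term rat).
HB.instance Definition _ := gen_eqMixin (qe_rcf.term rat).
Definition clause := (seq rterm * seq rterm)%type.

Fixpoint teval_rat (K : rcfType) (e : nat -> K) (t : rterm) : K :=
  match t with
  | qe_rcf.Var i => e i
  | qe_rcf.Const x => ratr x
  | qe_rcf.NatConst n => n%:R
  | qe_rcf.Add u v => teval_rat e u + teval_rat e v
  | qe_rcf.Opp u => - teval_rat e u
  | qe_rcf.NatMul u n => teval_rat e u *+ n
  | qe_rcf.Mul u v => teval_rat e u * teval_rat e v
  | qe_rcf.Exp u n => teval_rat e u ^+ n
  end.

Definition clause_holds (K : rcfType) (e : nat -> K) (c : clause) : bool :=
  all (fun t => teval_rat e t == 0) c.1 && all (fun t => 0 < teval_rat e t) c.2.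

(* A family of predicates, uniform in the real closed field, is semialgebraic
   when one finite union of systems of polynomial equations and strict
   inequalities over the rationals defines it in every real closed field. *)
Definition sdef (phi : forall K : rcfType, (nat -> K) -> Prop) : Prop :=
  exists d : seq clause, forall (K : rcfType) (e : nat -> K),
    phi K e <-> has (clause_holds e) d.

Lemma sdef_iff phi psi :
  (forall K e, phi K e <-> psi K e) -> sdef phi -> sdef psi.
Proof. by move=> H [d Hd]; exists d => K e; rewrite -H. Qed.

Lemma sdef_eq0 (t : rterm) : sdef (fun K e => teval_rat e t = 0).
Proof.
exists [:: ([:: t], [::])] => K e; rewrite /clause_holds /= !(andbT, orbF).
by split=> [->|/eqP].
Qed.

Lemma sdef_gt0 (t : rterm) : sdef (fun K e => 0 < teval_rat e t).
Proof.
by exists [:: ([::], [:: t])] => K e; rewrite /clause_holds /= !(andbT, orbF).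
Qed.

Lemma sdef_or phi psi :
  sdef phi -> sdef psi -> sdef (fun K e => phi K e \/ psi K e).
Proof.
move=> [d Hd] [d' Hd']; exists (d ++ d') => K e.
by rewrite Hd Hd' has_cat; split=> /orP.
Qed.

Lemma sdef_and phi psi :
  sdef phi -> sdef psi -> sdef (fun K e => phi K e /\ psi K e).
Proof.
move=> [d Hd] [d' Hd'].
exists [seq (c.1 ++ c'.1, c.2 ++ c'.2) | c <- d, c' <- d'] => K e; rewrite Hd Hd'.
have E c c' : clause_holds e (c.1 ++ c'.1, c.2 ++ c'.2)
    = clause_holds e c && clause_holds e c'.
  by rewrite /clause_holds /= !all_cat; do 4!case: all.
split=> [[/hasP[c cd Hc] /hasP[c' cd' Hc']]|/hasP[_ /allpairsP[[c c'] [/= cd cd' ->]]]].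
  apply/hasP; exists (c.1 ++ c'.1, c.2 ++ c'.2); last by rewrite E Hc.
  by apply/allpairsP; exists (c, c').
by rewrite E => /andP[Hc Hc']; split; apply/hasP; [exists c|exists c'].
Qed.

(** Case analysis on [P] is classical: the clauses need only exist, and nothing ever computes
    them. *)
Lemma sdef_const (P : Prop) : sdef (fun _ _ => P).
Proof.
case: (pselect P) => HP; first by exists [:: ([::], [::])].
by exists [::].
Qed.

Lemma sdef_neq0 (t : rterm) : sdef (fun K e => teval_rat e t <> 0).
Proof.
apply: (sdef_iff _ (sdef_or (sdef_gt0 t) (sdef_gt0 (qe_rcf.Opp t)))) => K e /=.
rewrite oppr_gt0; split=> [[/lt0r_neq0/eqP//|/ltr0_neq0/eqP//]|/eqP].
by rewrite neq_lt => /orP[]; [right|left].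
Qed.

Lemma sdef_le0 (t : rterm) : sdef (fun K e => ~ 0 < teval_rat e t).
Proof.
apply: (sdef_iff _ (sdef_or (sdef_eq0 t) (sdef_gt0 (qe_rcf.Opp t)))) => K e /=.
rewrite oppr_gt0; split=> [[->|H]|/negP]; first by rewrite ltxx.
  by rewrite lt_gtF.
by rewrite -leNgt le_eqVlt => /orP[/eqP|]; [left|right].
Qed.

Lemma sdef_not phi : sdef phi -> sdef (fun K e => ~ phi K e).
Proof.
move=> [d Hd]; apply: (sdef_iff (phi := fun K e => ~ has (clause_holds e) d)).
  by move=> K e; rewrite Hd.
elim: {Hd} d => [|[s1 s2] d IH].
  by apply: (sdef_iff _ (sdef_const True)).
suff Hc : sdef (fun K e => ~ clause_holds e (s1, s2)).
  apply: (sdef_iff _ (sdef_and Hc IH)) => K e /=.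
  by split=> [[/negP H1 /negP H2]|/negP]; first (apply/negP; rewrite negb_or H1);
    rewrite ?negb_or => // /andP[/negP H1 /negP H2].
have H1 : sdef (fun K e => ~ all (fun t => teval_rat e t == 0) s1).
  elim: s1 => [|t s1 H1]; first by apply: (sdef_iff _ (sdef_const False)) => K e /=; split.
  apply: (sdef_iff _ (sdef_or (sdef_neq0 t) H1)) => K e /=.
  split=> [[H /andP[/eqP//]|H /andP[_ //]]|].
  move/negP; rewrite negb_and => /orP[/eqP|/negP]; by [left|right].
have H2 : sdef (fun K e => ~ all (fun t => 0 < teval_rat e t) s2).
  elim: s2 => [|t s2 H2]; first by apply: (sdef_iff _ (sdef_const False)) => K e /=; split.
  apply: (sdef_iff _ (sdef_or (sdef_le0 t) H2)) => K e /=.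
  split=> [[H /andP[//]|H /andP[_ //]]|].
  move/negP; rewrite negb_and => /orP[/negP|/negP]; by [left|right].
apply: (sdef_iff _ (sdef_or H1 H2)) => K e; rewrite /clause_holds /=.
split=> [[H /andP[//]|H /andP[_ //]]|].
move/negP; rewrite negb_and => /orP[/negP|/negP]; by [left|right].
Qed.

Lemma sdef_imp phi psi :
  sdef phi -> sdef psi -> sdef (fun K e => phi K e -> psi K e).
Proof.
move=> H1 H2; apply: (sdef_iff _ (sdef_or (sdef_not H1) H2)) => K e.
by split=> [[]//|H]; case: (pselect (phi K e)) => [/H|]; [right|left].
Qed.

Lemma sdef_equiv phi psi :
  sdef phi -> sdef psi -> sdef (fun K e => phi K e <-> psi K e).
Proof. by move=> H1 H2; apply: sdef_and; apply: sdef_imp. Qed.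

Fixpoint feval_rat (K : rcfType) (e : nat -> K) (f : qe_rcf.formula rat) : Prop :=
  match f with
  | qe_rcf.Bool b => b
  | qe_rcf.Equal t u => teval_rat e t = teval_rat e u
  | qe_rcf.Lt t u => teval_rat e t < teval_rat e u
  | qe_rcf.Le t u => teval_rat e t <= teval_rat e u
  | qe_rcf.And f g => feval_rat e f /\ feval_rat e g
  | qe_rcf.Or f g => feval_rat e f \/ feval_rat e g
  | qe_rcf.Implies f g => feval_rat e f -> feval_rat e g
  | qe_rcf.Not f => ~ feval_rat e f
  end.

Lemma sdef_eq (t u : rterm) : sdef (fun K e => teval_rat e t = teval_rat e u).
Proof.
apply: (sdef_iff _ (sdef_eq0 (qe_rcf.Add t (qe_rcf.Opp u)))) => K e /=.
by split=> [/eqP|->]; [rewrite subr_eq0 => /eqP|rewrite subrr].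
Qed.

Lemma sdef_lt (t u : rterm) : sdef (fun K e => teval_rat e t < teval_rat e u).
Proof.
apply: (sdef_iff _ (sdef_gt0 (qe_rcf.Add u (qe_rcf.Opp t)))) => K e /=.
by rewrite subr_gt0.
Qed.

Lemma sdef_feval f : sdef (fun K e => feval_rat e f).
Proof.
elim: f => [b|t u|t u|t u|f H1 g H2|f H1 g H2|f H1 g H2|f H1] /=.
- exact: sdef_const.
- exact: sdef_eq.
- exact: sdef_lt.
- apply: (sdef_iff _ (sdef_not (sdef_lt u t))) => K e /=.
  by rewrite leNgt; split=> /negP.
- exact: sdef_and.
- exact: sdef_or.
- exact: sdef_imp.
- exact: sdef_not.
Qed.

Fixpoint tfree (t : rterm) : nat :=
  match t with
  | qe_rcf.Var i => i.+1
  | qe_rcf.Const _ | qe_rcf.NatConst _ => 0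
  | qe_rcf.Add u v | qe_rcf.Mul u v => maxn (tfree u) (tfree v)
  | qe_rcf.Opp u | qe_rcf.NatMul u _ | qe_rcf.Exp u _ => tfree u
  end.

Lemma teval_ext (K : rcfType) (e e' : nat -> K) (t : rterm) :
  (forall i, (i < tfree t)%N -> e i = e' i) -> teval_rat e t = teval_rat e' t.
Proof.
elim: t => //= [i|u Hu v Hv|u Hu|u Hu n|u Hu v Hv|u Hu n] H; try by rewrite Hu.
- exact: H.
- by rewrite Hu ?Hv // => i Hi; apply: H; rewrite leq_max Hi ?orbT.
- by rewrite Hu ?Hv // => i Hi; apply: H; rewrite leq_max Hi ?orbT.
Qed.

Fixpoint ffree (f : qe_rcf.formula rat) : nat :=
  match f with
  | qe_rcf.Bool _ => 0
  | qe_rcf.Equal t u | qe_rcf.Lt t u | qe_rcf.Le t u => maxn (tfree t) (tfree u)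
  | qe_rcf.And f g | qe_rcf.Or f g | qe_rcf.Implies f g => maxn (ffree f) (ffree g)
  | qe_rcf.Not f => ffree f
  end.

Lemma eval_tmap (K : rcfType) (e : nat -> K) m t : (tfree t <= m)%N ->
  qe_rcf.eval (mkseq e m) (tmap K t) = teval_rat e t.
Proof.
elim: t => //= [i Hi|u Hu v Hv|u Hu|u Hu n|u Hu v Hv|u Hu n]; rewrite ?geq_max.
- by rewrite nth_mkseq.
- by case/andP=> ? ?; rewrite Hu ?Hv.
- by move=> ?; rewrite Hu.
- by move=> ?; rewrite Hu.
- by case/andP=> ? ?; rewrite Hu ?Hv.
- by move=> ?; rewrite Hu.
Qed.

Lemma qf_eval_fmap (K : rcfType) (e : nat -> K) m f : (ffree f <= m)%N ->
  qe_rcf.qf_eval (mkseq e m) (fmap K f) <-> feval_rat e f.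
Proof.
elim: f => //= [t u|t u|t u|f H1 g H2|f H1 g H2|f H1 g H2|f H1]; rewrite ?geq_max.
- by case/andP=> ? ?; rewrite !eval_tmap //; split=> [/eqP|->].
- by case/andP=> ? ?; rewrite !eval_tmap.
- by case/andP=> ? ?; rewrite !eval_tmap.
- by case/andP=> ? ?; rewrite -H1 // -H2 //; split=> /andP.
- by case/andP=> ? ?; rewrite -H1 // -H2 //; split=> /orP.
- by case/andP=> ? ?; rewrite -H1 // -H2 //; split=> /implyP.
- by move=> ?; rewrite -H1 //; split=> /negP.
Qed.

Definition upd (T : Type) (e : nat -> T) (i : nat) (x : T) : nat -> T :=
  fun j => if j == i then x else e j.

Lemma pmap_abstrX (K : rcfType) i t :
  map (tmap K) (qe_rcf.abstrX i t) = qe_rcf.abstrX i (tmap K t).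
Proof.
elim: t => //= [j|u Hu v Hv|u Hu|u Hu n|u Hu v Hv|u Hu n].
- by case: ifP.
- by rewrite pmap_AddPoly Hu Hv.
- by rewrite pmap_OppPoly Hu.
- by rewrite pmap_NatMulPoly Hu.
- by rewrite pmap_MulPoly Hu Hv.
- by rewrite pmap_ExpPoly Hu.
Qed.

(** Elimination of one quantifier: once [i] is abstracted, each term is a polynomial whose
    coefficients are terms, and the sign conditions on these polynomials are settled by counting
    roots. *)
Lemma sdef_ex_clause i (c : clause) : sdef (fun K e => exists x, clause_holds (upd e i x) c).
Proof.
case: c => s1 s2.
pose f := qe_rcf.CcountGt0 (map (qe_rcf.abstrX i) s1) (map (qe_rcf.abstrX i) s2).
(* The finite environment read by the formula must contain its own variables, the variable [i] and
   those of the clause. *)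
pose m := maxn (ffree f) (maxn i.+1 (\max_(t <- s1 ++ s2) tfree t)).
apply: (sdef_iff _ (sdef_feval f)) => K e.
rewrite -(@qf_eval_fmap _ _ m) ?leq_maxl // fmap_CcountGt0 qe_rcf.eval_CcountGt0.
set p1 := map _ (map _ _); set p2 := map _ (map _ (map _ s2)).
have E t x : t \in s1 ++ s2 ->
    (qe_rcf.eval_poly (mkseq e m) (map (tmap K) (qe_rcf.abstrX i t))).[x]
    = teval_rat (upd e i x) t.
  move=> ts; rewrite pmap_abstrX qe_rcf.abstrXP.
  have -> : set_nth 0 (mkseq e m) i x = mkseq (upd e i x) m.
    have im : (i < m)%N by rewrite !leq_max leqnn !orbT.
    have sz : size (set_nth 0 (mkseq e m) i x) = m.
      by rewrite size_set_nth size_mkseq; apply/maxn_idPr.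
    apply: (@eq_from_nth _ 0) => [|j]; rewrite sz ?size_mkseq // => jm.
    by rewrite nth_set_nth /= /upd !nth_mkseq //; case: eqP.
  rewrite eval_tmap // !leq_max; apply/orP; right; apply/orP; right.
  by rewrite (big_rem t) //= leq_maxl.
have -> : qe_rcf_th.ccount_gt0 p1 p2 <->
    (exists x, \big[andb/true]_(p <- p1) (p.[x] == 0)
            && \big[andb/true]_(q <- p2) (q.[x] > 0)) by split=> /qe_rcf_th.ccount_gt0P.
suff Ex x : clause_holds (upd e i x) (s1, s2) =
    (\big[andb/true]_(p <- p1) (p.[x] == 0) && \big[andb/true]_(q <- p2) (q.[x] > 0)).
  by split=> -[x Hx]; exists x; rewrite ?Ex // -Ex.
rewrite !big_map !big_all /clause_holds /=.
by congr andb; apply: eq_in_all => t ts /=; rewrite E // mem_cat ts ?orbT.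
Qed.

Lemma sdef_ex i phi : sdef phi -> sdef (fun K e => exists x, phi K (upd e i x)).
Proof.
move=> [d Hd]; apply: (sdef_iff (phi := fun K e => exists x, has (clause_holds (upd e i x)) d)).
  by move=> K e; split=> -[x /Hd Hx]; exists x.
elim: {phi Hd} d => [|c d IH].
  by apply: (sdef_iff _ (sdef_const False)) => K e; split=> // -[].
apply: (sdef_iff _ (sdef_or (sdef_ex_clause i c) IH)) => K e /=.
split=> [[] [x Hx]|[x /orP[Hx|Hx]]]; by [exists x; rewrite Hx ?orbT|left; exists x|right; exists x].
Qed.

Lemma sdef_forall i phi : sdef phi -> sdef (fun K e => forall x, phi K (upd e i x)).
Proof.
move=> H; apply: (sdef_iff _ (sdef_not (sdef_ex i (sdef_not H)))) => K e.
split=> [Hn x|Hx [x]]; last exact.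
by apply: contrapT => Hx; apply: Hn; exists x.
Qed.

Lemma sdef_support phi : sdef phi -> exists m, forall (K : rcfType) (e e' : nat -> K),
  (forall i, (i < m)%N -> e i = e' i) -> phi K e <-> phi K e'.
Proof.
move=> [d Hd]; exists (\max_(c <- d) \max_(t <- c.1 ++ c.2) tfree t) => K e e' He.
rewrite !Hd; suff -> : has (clause_holds e) d = has (clause_holds e') d by [].
apply: eq_in_has => c cd; rewrite /clause_holds.
have E t : t \in c.1 ++ c.2 -> teval_rat e t = teval_rat e' t.
  move=> tc; apply: teval_ext => i Hi; apply: He; rewrite (leq_trans Hi) //.
  rewrite (big_rem c) //= leq_max; apply/orP; left.
  by rewrite (big_rem t) //= leq_maxl.
by congr andb; apply: eq_in_all => t tc; rewrite E // mem_cat tc ?orbT.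
Qed.

(** * Completeness of the theory of real closed fields and algebraic points *)

Fixpoint teval0 (t : rterm) : rat :=
  match t with
  | qe_rcf.Var i => 0
  | qe_rcf.Const x => x
  | qe_rcf.NatConst n => n%:R
  | qe_rcf.Add u v => teval0 u + teval0 v
  | qe_rcf.Opp u => - teval0 u
  | qe_rcf.NatMul u n => teval0 u *+ n
  | qe_rcf.Mul u v => teval0 u * teval0 v
  | qe_rcf.Exp u n => teval0 u ^+ n
  end.

(** At the zero environment every term has a rational value, so a definable predicate has the same
    truth value there in all real closed fields. *)
Lemma teval_ratr (K : rcfType) t : teval_rat (fun=> 0 : K) t = ratr (teval0 t).
Proof.
elim: t => //= [|n|u -> v ->|u ->|u -> n|u -> v ->|u -> n];
  by rewrite ?rmorph0 ?rmorph_nat ?rmorphD ?rmorphN ?rmorphMn ?rmorphM ?rmorphXn.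
Qed.

(* The theory of real closed fields is complete. *)
Lemma sdef_transfer0 (K L : rcfType) phi :
  sdef phi -> phi K (fun=> 0) -> phi L (fun=> 0).
Proof.
move=> [d Hd] /Hd Hk; apply/Hd.
move: Hk; suff -> : has (clause_holds (fun=> 0 : K)) d = has (clause_holds (fun=> 0 : L)) d by [].
apply: eq_has => c; rewrite /clause_holds; congr andb; apply: eq_all => t;
  by rewrite !teval_ratr ?fmorph_eq0 ?ltr0q.
Qed.

(** A predicate that ignores its environment may be moved to the zero environment, where its truth
    depends on signs of rational numbers. *)
Lemma sdef_transfer (K L : rcfType) phi :
  sdef phi -> (forall (F : rcfType) (f f' : nat -> F), phi F f -> phi F f') ->
  forall e e', phi K e -> phi L e'.
Proof. by move=> Hd H e e' /(H _ _ (fun=> 0))/(sdef_transfer0 L Hd)/H; apply. Qed.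

(** A function [f] overwrites [l] variables at once, so that one quantifier over functions stands
    for a block of [l] quantifiers. *)
Definition blk (T : Type) (o l : nat) (f e : nat -> T) : nat -> T :=
  fun i => if (o <= i < o + l)%N then f (i - o)%N else e i.

Lemma sdef_exblk o l phi :
  sdef phi -> sdef (fun K e => exists f, phi K (blk o l f e)).
Proof.
elim: l phi => [|l IH] phi H.
  apply: (sdef_iff _ H) => K e.
  have E f : blk o 0 f e = e.
    by apply/funext => i; rewrite /blk addn0; case: leqP => //= h; rewrite ltnNge h.
  by split=> [|[f]]; [exists (fun=> 0)|]; rewrite E.
apply: (sdef_iff _ (IH _ (sdef_ex (o + l) H))) => K e; split=> [[f [x Hx]]|[f Hf]].
  exists (upd f l x); suff -> : blk o l.+1 (upd f l x) e = upd (blk o l f e) (o + l) x by [].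
  apply/funext => i; rewrite /blk /upd addnS ltnS.
  case: (eqVneq i (o + l)%N) => [->|ni]; first by rewrite leq_addr leqnn /= addKn eqxx.
  rewrite [(i < _)%N]ltn_neqAle ni /=; case: ifP => // /andP[oi _].
  by rewrite ifN //; apply: contra ni => /eqP <-; rewrite subnKC.
exists f, (f l); suff -> : upd (blk o l f e) (o + l) (f l) = blk o l.+1 f e by [].
apply/funext => i; rewrite /blk /upd addnS ltnS.
case: (eqVneq i (o + l)%N) => [->|ni]; first by rewrite leq_addr leqnn /= addKn.
by rewrite [(i < _)%N]ltn_neqAle ni.
Qed.

Lemma sdef_allblk o l phi :
  sdef phi -> sdef (fun K e => forall f, phi K (blk o l f e)).
Proof.
move=> H; apply: (sdef_iff _ (sdef_not (sdef_exblk o l (sdef_not H)))) => K e.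
split=> [Hn f|Hf [f]]; last exact.
by apply: contrapT => Hx; apply: Hn; exists f.
Qed.

Lemma sdef_all_lt n (phi : nat -> forall K : rcfType, (nat -> K) -> Prop) :
  (forall i, (i < n)%N -> sdef (phi i)) ->
  sdef (fun K e => forall i, (i < n)%N -> phi i K e).
Proof.
elim: n => [|n IH] H.
  by apply: (sdef_iff _ (sdef_const True)) => K e; split.
have H' i : (i < n)%N -> sdef (phi i) by move=> Hi; apply: H; rewrite ltnS ltnW.
apply: (sdef_iff _ (sdef_and (IH H') (H n (ltnSn n)))) => K e.
split=> [[H1 H2] i|H1]; last by split=> [i Hi|]; apply: H1 => //; rewrite ltnS ltnW.
by rewrite ltnS leq_eqVlt => /orP[/eqP->|/H1].
Qed.

Lemma sdef_ex_lt n (phi : nat -> forall K : rcfType, (nat -> K) -> Prop) :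
  (forall i, (i < n)%N -> sdef (phi i)) ->
  sdef (fun K e => exists2 i, (i < n)%N & phi i K e).
Proof.
move=> H; apply: (sdef_iff _ (sdef_not (sdef_all_lt (fun i Hi => sdef_not (H i Hi))))) => K e.
split=> [Hn|[i Hi Hp] /(_ i Hi)]; last exact.
by apply: contrapT => Hx; apply: Hn => i Hi Hp; apply: Hx; exists i.
Qed.

Lemma sdef_root (g : {poly rat}) i : sdef (fun K e => root (map_poly ratr g) (e i)).
Proof.
pose t := foldr (fun c t => qe_rcf.Add (qe_rcf.Mul t (qe_rcf.Var _ i)) (qe_rcf.Const c))
  (qe_rcf.NatConst _ 0) g.
apply: (sdef_iff _ (sdef_eq0 t)) => K e.
suff -> : teval_rat e t = (map_poly ratr g).[e i] by split=> /eqP.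
rewrite -[g in RHS]polyseqK /t; elim: (polyseq g) => [|c s IH] /=.
  by rewrite map_polyC /= hornerC (rmorph0 (@ratr K)).
by rewrite IH cons_poly_def rmorphD rmorphM /= map_polyX map_polyC /= !hornerE.
Qed.

Lemma sdef_exall m phi : sdef phi ->
  (forall (K : rcfType) (e e' : nat -> K),
    (forall i, (i < m)%N -> e i = e' i) -> phi K e -> phi K e') ->
  forall K L : rcfType, (exists e, phi K e) -> exists e, phi L e.
Proof.
move=> H Hm K L [e He].
have T (F : rcfType) (f f' : nat -> F) :
    (exists h, phi F (blk 0 m h f)) -> exists h, phi F (blk 0 m h f').
  by move=> [h Hh]; exists h; apply: Hm Hh => i Hi; rewrite /blk leq0n add0n Hi.
have [|f Hf] := @sdef_transfer K L _ (sdef_exblk 0 m H) T (fun=> 0) (fun=> 0).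
  by exists e; apply: Hm He => i Hi; rewrite /blk leq0n add0n Hi subn0.
by exists (blk 0 m f (fun=> 0)).
Qed.

(** The real algebraic numbers are a real closed field, so [phi] has a solution among them. The
    existence of a solution with the same annihilating polynomials is again semialgebraic and
    returns to [K]. *)
Lemma algebraic_point m phi (K : rcfType) : sdef phi ->
  (forall (K : rcfType) (e e' : nat -> K),
    (forall i, (i < m)%N -> e i = e' i) -> phi K e -> phi K e') ->
  (exists e, phi K e) ->
  exists g : nat -> {poly rat}, (forall i, g i != 0) /\
    exists e : nat -> K, phi K e /\ forall i, (i < m)%N -> root (map_poly ratr (g i)) (e i).
Proof.
move=> Hphi Hm He; have alg (x : realalg) : exists q : {poly rat}, q != 0 /\
    root (map_poly ratr q) x.
  have [q mq rq] := realalg_algebraic x.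
  exists q; split; first exact: monic_neq0.
  by rewrite -(eq_map_poly (fmorph_eq_rat (realalg_of rat))).
have [e /= He0] := sdef_exall Hphi Hm realalg He.
have [g Hg] := choice (fun i => alg (e i)).
exists g; split=> [i|]; first by case: (Hg i).
apply: (@sdef_exall m (fun K e => phi K e /\
  forall i, (i < m)%N -> root (map_poly ratr (g i)) (e i)) _ _ realalg).
- by apply: sdef_and => //; apply: sdef_all_lt => i _; apply: sdef_root.
- move=> F f f' E [H1 H2]; split; first exact: Hm H1.
  by move=> i Hi; rewrite -E // H2.
- by exists e; split=> // i _; case: (Hg i).
Qed.

(** * Computable functions *)

Local Open Scope nat_scope.

(* [F] is computed by one recursive function from every sufficiently long
   initial segment of its argument. *)
Definition computable (F : (nat -> nat) -> nat) : Prop :=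
  exists f m, forall k e, m <= k -> reval f (mkseq e k) (F e).

Lemma comp_ext F G : F =1 G -> computable F -> computable G.
Proof. by move=> E [f [m H]]; exists f, m => k e mk; rewrite -E; apply: H. Qed.

Lemma length_size T (s : seq T) : length s = size s.
Proof. by []. Qed.

Lemma list_nth T (d : T) s i : List.nth i s d = nth d s i.
Proof. by elim: s i => [|a s IH] [|i] /=. Qed.

Lemma comp_var i : computable (fun e => e i).
Proof.
exists (RProj i), i.+1 => k e ik.
have E : List.nth i (mkseq e k) 0%N = e i by rewrite list_nth nth_mkseq.
rewrite -[X in reval _ _ X]E.
by apply: ev_proj; apply/ssrnat.ltP; rewrite length_size size_mkseq.
Qed.

Lemma comp_const c : computable (fun=> c).
Proof.
elim: c => [|c [f [m H]]]; first by exists RZero, 0 => k e _; constructor.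
exists (RComp RSucc [:: f]), m => k e mk.
by apply: (@ev_comp _ _ _ [:: c]); [apply: List.Forall2_cons; [apply: H|constructor]|constructor].
Qed.

Lemma Forall2_mkseq A B (P : A -> B -> Prop) f g m :
  (forall i, i < m -> P (f i) (g i)) -> List.Forall2 P (mkseq f m) (mkseq g m).
Proof.
rewrite /mkseq.
have E i : i \in iota 0 m -> i < m by rewrite mem_iota.
elim: (iota 0 m) E => [|i s IH] E H; first by constructor.
constructor; first by apply/H/E/mem_head.
by apply: IH => // j js; apply: E; rewrite in_cons js orbT.
Qed.

(** [F] reads finitely many arguments, so finitely many of the programs for [G] are composed; these
    are picked by choice. *)
Lemma comp_sub F G :
  computable F -> (forall i, computable (fun e => G e i)) -> computable (fun e => F (G e)).
Proof.
move=> [f [m Hf]] HG.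
have [gs Hgs] := choice HG; have [ms Hms] := choice Hgs.
exists (RComp f (mkseq gs m)), (\max_(i < m) ms i) => k e Hk.
apply: (@ev_comp _ _ _ (mkseq (G e) m)); last exact: Hf.
apply: Forall2_mkseq => i im; apply: Hms; apply: leq_trans Hk.
exact: (leq_bigmax (Ordinal im)).
Qed.

Lemma comp1 (g : nat -> nat) A :
  computable (fun e => g (e 0)) -> computable A -> computable (fun e => g (A e)).
Proof. by move=> Hg HA; apply: (comp_sub (G := fun e _ => A e) Hg). Qed.

Lemma comp2 (g : nat -> nat -> nat) A B :
  computable (fun e => g (e 0) (e 1)) -> computable A -> computable B -> computable (fun e => g (A e) (B e)).
Proof.
move=> Hg HA HB; apply: (comp_sub (G := fun e i => if i is 0 then A e else B e) Hg).
by case.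
Qed.

Lemma comp3 (g : nat -> nat -> nat -> nat) A B C :
  computable (fun e => g (e 0) (e 1) (e 2)) -> computable A -> computable B -> computable C ->
  computable (fun e => g (A e) (B e) (C e)).
Proof.
move=> Hg HA HB HC.
apply: (comp_sub (G := fun e i => if i is i'.+1 then if i' is 0 then B e else C e else A e) Hg).
by case=> [|[]].
Qed.

Fixpoint nrec (T : Type) (g : T) (h : nat -> T -> T) (n : nat) : T :=
  if n is n'.+1 then h n' (nrec g h n') else g.

(** The step sees the counter at index 0, the accumulator at index 1 and the outer environment from
    index 2 on. *)
Lemma comp_nrec G H T : computable G ->
  computable (fun e => H (fun i => e i.+2) (e 0) (e 1)) -> computable T ->
  computable (fun e => nrec (G e) (H e) (T e)).
Proof.
move=> [g [mg Hg]] [h [mh Hh]] HT.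
apply: (comp_sub (F := fun e => nrec (G (fun i => e i.+1)) (H (fun i => e i.+1)) (e 0))
  (G := fun e i => if i is j.+1 then e j else T e)); last first.
  by case=> // i; apply: comp_var.
exists (RPrec g h), (mg + mh).+2 => -[//|k] e Hk.
have -> : mkseq e k.+1 = e 0 :: mkseq (fun i => e i.+1) k.
  by rewrite /mkseq /= -[1]addn0 iotaDl -map_comp.
elim: (e 0) => [|n IH] /=.
  by apply: ev_prec0; apply: Hg; lia.
apply: ev_precS IH _; set z := nrec _ _ _.
(* The step runs on counter, accumulator and outer arguments in this order; the bound [e 0] of the
   recursion is dropped. *)
have := Hh k.+2 (fun i => if i is j.+1 then if j is l.+1 then e l.+1 else z else n).
rewrite /mkseq /= -[1]addn0 -[2]addn0 !iotaDl -!map_comp; apply.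
by lia.
Qed.

Lemma comp_S A : computable A -> computable (fun e => (A e).+1).
Proof.
apply: (comp1 (g := S)); exists RSucc, 1 => -[//|k] e _; rewrite /mkseq /=; constructor.
Qed.

Lemma comp_add A B : computable A -> computable B -> computable (fun e => A e + B e).
Proof.
move=> HA HB; apply: (comp_ext (F := fun e => nrec (A e) (fun _ z => z.+1) (B e))).
  by move=> e; elim: (B e) => [|n /= ->]; rewrite ?addn0 ?addnS.
by apply: comp_nrec => //; apply: comp_S; apply: comp_var.
Qed.

Lemma comp_pred A : computable A -> computable (fun e => (A e).-1).
Proof.
move=> HA; apply: (comp_ext (F := fun e => nrec 0 (fun n _ => n) (A e))).
  by move=> e; case: (A e).
by apply: comp_nrec => //; [apply: comp_const|apply: comp_var].
Qed.

Lemma comp_subn A B : computable A -> computable B -> computable (fun e => A e - B e).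
Proof.
move=> HA HB; apply: (comp_ext (F := fun e => nrec (A e) (fun _ z => z.-1) (B e))).
  by move=> e; elim: (B e) => [|n /= ->]; rewrite ?subn0 // subnS.
by apply: comp_nrec => //; apply: comp_pred; apply: comp_var.
Qed.

Lemma comp_mul A B : computable A -> computable B -> computable (fun e => A e * B e).
Proof.
move=> HA HB; apply: (comp_ext (F := fun e => nrec 0 (fun _ z => A e + z) (B e))).
  by move=> e; elim: (B e) => [|n /= ->]; rewrite ?muln0 // mulnS.
apply: comp_nrec => //; first exact: comp_const.
apply: comp_add; last exact: comp_var.
by apply: (comp_sub HA) => i; apply: comp_var.
Qed.

(* Expressions under a binder mention only variables of the outer environment. *)
Lemma comp_shift A k : computable A -> computable (fun e => A (fun i => e (k + i))).
Proof. by move=> HA; apply: (comp_sub HA) => i; apply: comp_var. Qed.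

Lemma comp_exp A B : computable A -> computable B -> computable (fun e => A e ^ B e).
Proof.
move=> HA HB; apply: (comp_ext (F := fun e => nrec 1 (fun _ z => A e * z) (B e))).
  by move=> e; elim: (B e) => [|n /= ->]; rewrite ?expn0 // expnS.
apply: comp_nrec => //; first exact: comp_const.
by apply: comp_mul; [apply: (comp_shift 2)|apply: comp_var].
Qed.

Lemma comp_neg (P : (nat -> nat) -> bool) : computable P -> computable (fun e => ~~ P e).
Proof.
move=> HP; apply: (comp_ext (F := fun e => 1 - P e)); first by move=> e; case: (P e).
by apply: comp_subn => //; apply: comp_const.
Qed.

Lemma comp_and (P Q : (nat -> nat) -> bool) :
  computable P -> computable Q -> computable (fun e => P e && Q e).
Proof.
move=> HP HQ; apply: (comp_ext (F := fun e => P e * Q e)); last exact: comp_mul.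
by move=> e; case: (P e); case: (Q e).
Qed.

Lemma comp_or (P Q : (nat -> nat) -> bool) :
  computable P -> computable Q -> computable (fun e => P e || Q e).
Proof.
move=> HP HQ; apply: (comp_ext (F := fun e => ~~ (~~ P e && ~~ Q e))).
  by move=> e; case: (P e); case: (Q e).
by apply: comp_neg; apply: comp_and; apply: comp_neg.
Qed.

Lemma comp_if (P : (nat -> nat) -> bool) A B :
  computable P -> computable A -> computable B -> computable (fun e => if P e then A e else B e).
Proof.
move=> HP HA HB; apply: (comp_ext (F := fun e => P e * A e + (~~ P e) * B e)).
  by move=> e; case: (P e); rewrite /= ?mul1n ?mul0n ?addn0.
by apply: comp_add; apply: comp_mul => //; apply: comp_neg.
Qed.

Lemma comp_leq A B : computable A -> computable B -> computable (fun e => A e <= B e).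
Proof.
move=> HA HB; apply: (comp_ext (F := fun e => 1 - (A e - B e))).
  by move=> e; rewrite -subn_eq0; case: (A e - B e).
by apply: comp_subn; [apply: comp_const|apply: comp_subn].
Qed.

Lemma comp_eq A B : computable A -> computable B -> computable (fun e => A e == B e).
Proof.
move=> HA HB; apply: (comp_ext (F := fun e => (A e <= B e) && (B e <= A e) : nat)).
  by move=> e; rewrite eqn_leq.
by apply: comp_and; apply: comp_leq.
Qed.

(** * Bounded quantifiers and finite truth assignments *)

Fixpoint ball (n : nat) (P : nat -> bool) : bool :=
  if n is n'.+1 then P n' && ball n' P else true.

Lemma ballP n (P : nat -> bool) : reflect (forall i, i < n -> P i) (ball n P).
Proof.
elim: n => [|n IH] /=; first by apply: ReflectT.
apply: (iffP andP) => [[Pn /IH H] i|H].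
  by rewrite ltnS leq_eqVlt => /orP[/eqP->|/H].
by split; [apply: H|apply/IH => i Hi; apply: H; rewrite ltnS ltnW].
Qed.

Lemma comp_ball N (P : (nat -> nat) -> nat -> bool) : computable N ->
  computable (fun e => P (fun i => e i.+1) (e 0)) -> computable (fun e => ball (N e) (P e)).
Proof.
move=> HN HP; apply: (comp_ext (F := fun e => nrec 1 (fun i z => P e i * z) (N e))).
  by move=> e; elim: (N e) => //= n ->; case: (P e n); case: ball.
apply: comp_nrec => //; first exact: comp_const.
apply: comp_mul; last exact: comp_var.
have := comp_sub (G := fun e i => if i is j.+1 then e j.+2 else e 0) HP; apply.
by case=> [|i]; apply: comp_var.
Qed.

Definition bex (n : nat) (P : nat -> bool) : bool := ~~ ball n (fun i => ~~ P i).

Lemma bexP n (P : nat -> bool) : reflect (exists2 i, i < n & P i) (bex n P).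
Proof.
apply: (iffP negP) => [H|[i Hi Pi] /ballP /(_ i Hi)]; last by rewrite Pi.
apply: contrapT => Hn; apply: H; apply/ballP => i Hi.
by apply/negP => Pi; apply: Hn; exists i.
Qed.

Lemma comp_bex N (P : (nat -> nat) -> nat -> bool) : computable N ->
  computable (fun e => P (fun i => e i.+1) (e 0)) -> computable (fun e => bex (N e) (P e)).
Proof.
move=> HN HP; apply: comp_neg; apply: (comp_ball (P := fun e i => ~~ P e i)) => //.
exact: comp_neg.
Qed.

Fixpoint bsum (n : nat) (f : nat -> nat) : nat :=
  if n is n'.+1 then f n' + bsum n' f else 0.

Lemma leq_bsum n f i : i < n -> f i <= bsum n f.
Proof.
elim: n => //= n IH; rewrite ltnS leq_eqVlt => /orP[/eqP->|/IH H]; first exact: leq_addr.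
exact: leq_trans H (leq_addl _ _).
Qed.

Lemma comp_bsum N (f : (nat -> nat) -> nat -> nat) : computable N ->
  computable (fun e => f (fun i => e i.+1) (e 0)) -> computable (fun e => bsum (N e) (f e)).
Proof.
move=> HN HP; apply: (comp_ext (F := fun e => nrec 0 (fun i z => f e i + z) (N e))).
  by move=> e; elim: (N e) => //= n ->.
apply: comp_nrec => //; first exact: comp_const.
apply: comp_add; last exact: comp_var.
have := comp_sub (G := fun e i => if i is j.+1 then e j.+2 else e 0) HP; apply.
by case=> [|i]; apply: comp_var.
Qed.

Create HintDb comp discriminated.
#[local] Hint Constants Opaque : comp.
#[local] Hint Resolve comp_var comp_const comp_S comp_pred comp_add comp_subn comp_mul
  comp_exp comp_neg comp_and comp_or comp_if comp_leq comp_eq comp_ball comp_bex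
  comp_bsum comp_nrec : comp.
Ltac cmp := intros; repeat (first [assumption | simple apply comp_and | simple apply comp_or
  | simple apply comp_neg | simple apply comp_add | simple apply comp_S | simple apply comp_if
  | simple apply comp_leq | simple apply comp_eq]); eauto 60 with comp.

Lemma comp_odd A : computable A -> computable (fun e => odd (A e)).
Proof.
move=> HA; apply: (comp_ext (F := fun e => nrec 0 (fun _ z => 1 - z) (A e))); last by cmp.
by move=> e; elim: (A e) => //= n ->; case: odd.
Qed.

Lemma comp_half A : computable A -> computable (fun e => (A e)./2).
Proof.
move=> HA; apply: (comp_ext (F := fun e => nrec 0 (fun n z => odd n + z) (A e))).
  by move=> e; elim: (A e) => //= n ->; rewrite uphalf_half.
by apply: comp_nrec => //; [cmp|apply: comp_add; [apply: comp_odd|]; cmp].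
Qed.
#[local] Hint Resolve comp_odd comp_half : comp.

(** A number codes a finite truth assignment by its binary digits, which turns the search over
    assignments into a bounded quantifier. *)
Definition bit (b t : nat) : bool := odd (nrec b (fun _ z => z./2) t).

Lemma comp_bit A B : computable A -> computable B -> computable (fun e => bit (A e) (B e)).
Proof. by move=> HA HB; apply: comp_odd; cmp. Qed.
#[local] Hint Resolve comp_bit : comp.

Lemma bitS b t : bit b t.+1 = bit b./2 t.
Proof. by rewrite /bit; congr odd; elim: t => //= t <-. Qed.

Lemma bits_exist (P : nat -> bool) n :
  exists2 b, b < 2 ^ n & forall t, t < n -> bit b t = P t.
Proof.
elim: n P => [|n IH] P; first by exists 0.
have [b Hb Pb] := IH (fun t => P t.+1).
exists (P 0 + b.*2); first by rewrite expnS mul2n -addnn; case: (P 0); lia.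
case=> [|t] Ht; first by rewrite /bit /= oddD odd_double addbF; case: (P 0).
by rewrite bitS half_bit_double Pb.
Qed.

Lemma computable_reval F L : computable F ->
  exists f, forall v, size v = L -> reval f v (F (nth 0 v)).
Proof.
move=> [f [m H]]; exists (RComp f (mkseq (fun i => if i < L then RProj i else RZero) m)).
move=> v sv; apply: (@ev_comp _ _ _ (mkseq (nth 0 v) m)); last exact: H.
apply: Forall2_mkseq => i im; case: ltnP => iL.
  by rewrite -list_nth; apply: ev_proj; apply/ssrnat.ltP; rewrite length_size sv.
by rewrite nth_default ?sv //; constructor.
Qed.

(** Post's theorem: a number that certifies one of the two sides exists classically, the least one
    is found by minimisation, and the side it certifies is then checked. *)
Lemma decidable_of_certificates (S : nat -> Prop) (c1 c0 : nat -> nat -> bool) :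
  computable (fun e => c1 (e 0) (e 1)) -> computable (fun e => c0 (e 0) (e 1)) ->
  (forall n, S n <-> exists c, c1 n c) -> (forall n, ~ S n <-> exists c, c0 n c) ->
  decidable_set S.
Proof.
move=> H1 H0 HS HnS.
have Hs : computable (fun e => ~~ (c1 (e 1) (e 0) || c0 (e 1) (e 0))).
  by apply: comp_neg; apply: comp_or;
    [apply: (comp_sub (G := fun e i => e (1 - i)) H1)|apply: (comp_sub (G := fun e i => e (1 - i)) H0)]; cmp.
have Hc : computable (fun e => ~~ c1 (e 1) (e 0)).
  by apply: comp_neg; apply: (comp_sub (G := fun e i => e (1 - i)) H1); cmp.
have [fs Hfs] := computable_reval 2 Hs; have [fc Hfc] := computable_reval 2 Hc.
(* [fc] negates the test [c1], so that the output 0 means membership. *)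
exists (RComp fc [:: RMin fs; RProj 0]) => n.
have ex : exists c, c1 n c || c0 n c.
  case: (pselect (S n)) => [/HS|/HnS] [c Hc']; exists c; by rewrite Hc' ?orbT.
pose c := ex_minn ex.
have E : reval (RComp fc [:: RMin fs; RProj 0]) [:: n] (~~ c1 n c).
  apply: (@ev_comp _ _ _ [:: c; n]); last by have := Hfc [:: c; n] erefl.
  apply: List.Forall2_cons; last apply: List.Forall2_cons; last exact: List.Forall2_nil.
    rewrite /c; case: ex_minnP => m Hm min; apply: ev_min.
      by have /= := Hfs [:: m; n] erefl; rewrite Hm.
    move=> k /ssrnat.ltP km; exists 0; have /= := Hfs [:: k; n] erefl.
    suff -> : c1 n k || c0 n k = false by [].
    by apply/negP => /min; rewrite leqNgt km.
  by apply: (ev_proj 0 [:: n]); apply/ssrnat.ltP.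
have Hm : c1 n c || c0 n c by rewrite /c; case: ex_minnP.
split=> [Sn|nSn]; move: E.
  suff -> : c1 n c by [].
  by case/orP: Hm => // Hm; have : ~ S n by apply/HnS; exists c.
suff -> : c1 n c = false by [].
by apply/negP => Hm'; apply: nSn; apply/HS; exists c.
Qed.

(** * The inverse of the Cantor pairing *)

Definition tri (n : nat) : nat := nrec 0 (fun k z => k.+1 + z) n.

Lemma triS n : tri n.+1 = n.+1 + tri n. Proof. by []. Qed.

Lemma comp_tri A : computable A -> computable (fun e => tri (A e)).
Proof. by move=> HA; apply: comp_nrec; cmp. Qed.

Lemma tri_half n : (tri n).*2 = n * n.+1.
Proof. by elim: n => // n IH; rewrite triS doubleD IH; lia. Qed.

Lemma npairE x y : npair x y = tri (x + y) + y.
Proof.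
rewrite /npair -[X in Nat.div X 2]/((x + y) * (x + y + 1)) addn1 -tri_half -muln2.
by rewrite PeanoNat.Nat.div_mul.
Qed.

Lemma leq_tri : {homo tri : m n / m <= n}.
Proof. by apply: homo_leq => // [|n]; [exact: leq_trans|rewrite triS leq_addl]. Qed.

(** The diagonal containing [n], that is the inverse of the triangular numbers; it is followed one
    unit at a time so as to be primitive recursive. *)
Definition usum (n : nat) : nat :=
  nrec 0 (fun k z => if tri z.+1 <= k.+1 then z.+1 else z) n.

Lemma usumP n : tri (usum n) <= n < tri (usum n).+1.
Proof.
elim: n => // n /andP[IH1 IH2].
rewrite /usum [nrec _ _ _]/= -/(usum n); case: ifP => H; rewrite ?triS in IH1 IH2 H *; lia.
Qed.

Definition usnd (n : nat) : nat := n - tri (usum n).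
Definition ufst (n : nat) : nat := usum n - usnd n.

Lemma comp_usum A : computable A -> computable (fun e => usum (A e)).
Proof.
by move=> HA; apply: comp_nrec; [cmp|apply: comp_if; [apply: comp_leq; [apply: comp_tri|]|..]; cmp|].
Qed.

Lemma comp_usnd A : computable A -> computable (fun e => usnd (A e)).
Proof. by move=> HA; apply: comp_subn => //; apply: comp_tri; apply: comp_usum. Qed.

Lemma comp_ufst A : computable A -> computable (fun e => ufst (A e)).
Proof. by move=> HA; apply: comp_subn; [apply: comp_usum|apply: comp_usnd]. Qed.

Lemma comp_npair A B : computable A -> computable B -> computable (fun e => npair (A e) (B e)).
Proof.
move=> HA HB; apply: (comp_ext (F := fun e => tri (A e + B e) + B e)).
  by move=> e; rewrite npairE.
by apply: comp_add => //; apply: comp_tri; cmp.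
Qed.
#[local] Hint Resolve comp_tri comp_usnd comp_ufst comp_npair : comp.

Lemma usum_npair x y : usum (npair x y) = x + y.
Proof.
have := usumP (npair x y); rewrite npairE; set s := usum _ => /andP[H1 H2].
case: (ltngtP s (x + y)) => // H; [have := leq_tri H|have := leq_tri H];
  rewrite ?triS in H1 H2 *; lia.
Qed.

Lemma usnd_npair x y : usnd (npair x y) = y.
Proof. by rewrite /usnd usum_npair npairE addKn. Qed.

Lemma ufst_npair x y : ufst (npair x y) = x.
Proof. by rewrite /ufst usnd_npair usum_npair addnK. Qed.

Lemma npair_unpair n : npair (ufst n) (usnd n) = n.
Proof.
have := usumP n; rewrite npairE triS /ufst /usnd => /andP[H1 H2].
by rewrite subnK; lia.
Qed.

Lemma leq_usnd n : usnd n <= n. Proof. exact: leq_subr. Qed.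

Lemma leq_ufst n : ufst n <= n.
Proof.
have [H _] := andP (usumP n); have : usum n <= tri (usum n).
  by elim: (usum n) => // m IH; rewrite triS; lia.
by rewrite /ufst; lia.
Qed.

(** Tag 0 always marks a leaf. Any other tag makes the argument smaller than the code, which is the
    descent behind the recursions on coded terms and formulas. *)
Lemma ltn_usnd n : 0 < ufst n -> usnd n < n.
Proof.
move=> H; rewrite -[X in _ < X]npair_unpair npairE.
by case: (ufst n) H => // m _; rewrite addSn triS; lia.
Qed.

(* Lists of naturals: [0] codes the empty list, [(npair a l).+1] the list [a :: l]. *)
Definition lcons (a l : nat) : nat := (npair a l).+1.
Definition lhd (l : nat) : nat := ufst l.-1.
Definition ltl (l : nat) : nat := usnd l.-1.
Definition look (l i : nat) : nat := lhd (nrec l (fun _ z => ltl z) i).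

Lemma lhd_cons a l : lhd (lcons a l) = a. Proof. exact: ufst_npair. Qed.
Lemma ltl_cons a l : ltl (lcons a l) = l. Proof. exact: usnd_npair. Qed.

Lemma lcons_eta l : 0 < l -> lcons (lhd l) (ltl l) = l.
Proof. by case: l => // l _; rewrite /lcons /lhd /ltl npair_unpair. Qed.

Lemma ltn_ltl l : 0 < l -> ltl l < l.
Proof. by case: l => // l _; rewrite /ltl ltnS leq_usnd. Qed.

Lemma ltn_lhd l : 0 < l -> lhd l < l.
Proof. by case: l => // l _; rewrite /lhd ltnS leq_ufst. Qed.

Lemma lookS l i : look l i.+1 = look (ltl l) i.
Proof. by rewrite /look; congr lhd; elim: i => //= i ->. Qed.

Lemma look_exists (s : seq nat) : exists l, forall i, i < size s -> look l i = nth 0 s i.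
Proof.
elim: s => [|a s [l IH]]; first by exists 0.
exists (lcons a l) => -[_|i]; first exact: lhd_cons.
by rewrite ltnS lookS ltl_cons; apply: IH.
Qed.

Lemma comp_lhd A : computable A -> computable (fun e => lhd (A e)).
Proof. by move=> HA; apply: comp_ufst; cmp. Qed.

Lemma comp_ltl A : computable A -> computable (fun e => ltl (A e)).
Proof. by move=> HA; apply: comp_usnd; cmp. Qed.

Lemma comp_lcons A B : computable A -> computable B -> computable (fun e => lcons (A e) (B e)).
Proof. by move=> HA HB; apply: comp_S; cmp. Qed.

Lemma comp_look A B : computable A -> computable B -> computable (fun e => look (A e) (B e)).
Proof.
by move=> HA HB; apply: comp_lhd; apply: comp_nrec => //; apply: comp_ltl; cmp.
Qed.

Fixpoint lcode (s : seq nat) : nat := if s is a :: s' then lcons a (lcode s') else 0.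

(** * Course-of-values recursion on codes *)

Section CodeRecursion.
Variables (A : Type) (F : (nat -> A) -> nat -> A) (d : A).

(** Fuel [n.+1] suffices for the value at [n] because [F] consults only smaller codes, as [F_ext]
    states. *)
Fixpoint crec_fuel (k n : nat) : A := if k is k'.+1 then F (crec_fuel k') n else d.
Definition crec (n : nat) : A := crec_fuel n.+1 n.

Hypothesis F_ext : forall g h n, (forall m, m < n -> g m = h m) -> F g n = F h n.

Lemma crec_fuelE k n : n < k -> crec_fuel k n = crec n.
Proof.
have H : forall m k k', m < k -> m < k' -> crec_fuel k m = crec_fuel k' m.
  elim/ltn_ind => m IH [//|k1] [//|k2] H1 H2 /=; apply: F_ext => j jm.
  by apply: IH => //; lia.
by move=> nk; apply: H.
Qed.

Lemma crecE n : crec n = F crec n.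
Proof. by apply: F_ext => m mn; apply: crec_fuelE. Qed.

End CodeRecursion.

Definition declist : nat -> seq nat :=
  crec (fun g l => if l is 0 then [::] else lhd l :: g (ltl l)) [::].

Lemma declistE l : declist l = if l is 0 then [::] else lhd l :: declist (ltl l).
Proof.
rewrite /declist crecE // => g h [|n] H //; by rewrite H // ltn_ltl.
Qed.

Lemma declist_lcode s : declist (lcode s) = s.
Proof. by elim: s => [|a s IH]; rewrite declistE //= lhd_cons ltl_cons IH. Qed.

Lemma declist_lt l a : a \in declist l -> a < l.
Proof.
elim/ltn_ind: l => -[|l] IH; rewrite declistE // in_cons => /orP[/eqP->|H].
  exact: ltn_lhd.
by apply: ltn_trans (IH _ _ H) _; apply: ltn_ltl.
Qed.

(** * Terms and their interpretation in a real closed field *)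
#[local] Hint Resolve comp_lhd comp_ltl comp_lcons comp_look : comp.

Definition cvar (i : nat) := npair 0 i.
Definition czero := npair 1 0.
Definition cone := npair 2 0.
Definition cadd (a b : nat) := npair 3 (npair a b).
Definition copp (a : nat) := npair 4 a.
Definition cmul (a b : nat) := npair 5 (npair a b).
Definition cinv (a : nat) := npair 6 a.
(* the value at [a] of the polynomial whose coefficients are listed in [l] *)
Definition cev (l a : nat) := npair 7 (npair l a).
(* a root between [a] and [b] of the polynomial listed in [l] *)
Definition croot (l a b : nat) := npair 8 (npair l (npair a b)).
(* the Skolem term answering the history [h] of a game *)
Definition csk (h : nat) := npair 9 h.

Lemma comp_cadd A B : computable A -> computable B -> computable (fun e => cadd (A e) (B e)).
Proof. by move=> HA HB; apply: comp_npair; cmp. Qed.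
Lemma comp_copp A : computable A -> computable (fun e => copp (A e)).
Proof. by move=> HA; apply: comp_npair; cmp. Qed.
Lemma comp_cmul A B : computable A -> computable B -> computable (fun e => cmul (A e) (B e)).
Proof. by move=> HA HB; apply: comp_npair; cmp. Qed.
Lemma comp_cinv A : computable A -> computable (fun e => cinv (A e)).
Proof. by move=> HA; apply: comp_npair; cmp. Qed.
Lemma comp_cev A B : computable A -> computable B -> computable (fun e => cev (A e) (B e)).
Proof. by move=> HA HB; apply: comp_npair; cmp. Qed.
Lemma comp_croot A B C : computable A -> computable B -> computable C ->
  computable (fun e => croot (A e) (B e) (C e)).
Proof. by move=> HA HB HC; apply: comp_npair; cmp. Qed.
Lemma comp_csk A : computable A -> computable (fun e => csk (A e)).
Proof. by move=> HA; apply: comp_npair; cmp. Qed.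
#[local] Hint Resolve comp_cadd comp_copp comp_cmul comp_cinv comp_cev comp_croot comp_csk : comp.

(** Only the field operations are constrained. The symbols for polynomial values, roots and Skolem
    terms serve to build a real closed field of terms; the codes of semialgebraic predicates do not
    contain them. *)
Record code_hom (K : fieldType) (I : nat -> K) : Prop := CodeHom {
  hom_zero : I czero = 0%R;
  hom_one : I cone = 1%R;
  hom_add : forall a b, I (cadd a b) = (I a + I b)%R;
  hom_opp : forall a, I (copp a) = (- I a)%R;
  hom_mul : forall a b, I (cmul a b) = (I a * I b)%R;
  hom_inv : forall a, I (cinv a) = (I a)^-1%R }.

Lemma ltn_npair2 x y y' : y < y' -> npair x y < npair x y'.
Proof.
move=> H; rewrite !npairE; have := @leq_tri (x + y) (x + y').
by rewrite leq_add2l (ltnW H) => /(_ isT) T; lia.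
Qed.

Lemma ltn_npair1 x x' y : x < x' -> npair x y < npair x' y.
Proof.
move=> H; rewrite !npairE; have := @leq_tri (x + y).+1 (x' + y).
by rewrite triS -addSn leq_add2r H => /(_ isT) T; lia.
Qed.

Section Interp.
Local Open Scope ring_scope.
Variables (K : rcfType) (var : nat -> K) (sk : seq K -> K).

Definition root_between (p : {poly K}) (a b : K) : K :=
  if pselect (exists x, a <= x <= b /\ root p x) is left H then sval (cid H) else 0.

Definition istep (g : nat -> K) (t : nat) : K :=
  let u := usnd t in
  match ufst t with
  | 0%N => var u
  | 1%N => 0
  | 2%N => 1
  | 3%N => g (ufst u) + g (usnd u)
  | 4%N => - g u
  | 5%N => g (ufst u) * g (usnd u)
  | 6%N => (g u)^-1
  | 7%N => if ufst u == 0%N then 0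
         else g (lhd (ufst u)) + g (usnd u) * g (cev (ltl (ufst u)) (usnd u))
  | 8%N => root_between (Poly (map g (declist (ufst u)))) (g (ufst (usnd u))) (g (usnd (usnd u)))
  | 9%N => sk (map g (declist u))
  | _ => 0
  end.

Definition interp : nat -> K := crec istep 0.

Lemma interpE t : interp t = istep interp t.
Proof.
rewrite /interp crecE // => g h n H; rewrite /istep.
case E : (ufst n) => [|k] //.
have Hu : (usnd n < n)%N by apply: ltn_usnd; rewrite E.
have H1 : g (ufst (usnd n)) = h (ufst (usnd n)).
  by apply: H; apply: leq_ltn_trans Hu; apply: leq_ufst.
have H2 : g (usnd (usnd n)) = h (usnd (usnd n)).
  by apply: H; apply: leq_ltn_trans Hu; apply: leq_usnd.
have Hm l : (l <= usnd n)%N -> map g (declist l) = map h (declist l).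
  move=> Hl; apply/eq_in_map => a /declist_lt Ha; apply: H.
  by rewrite (leq_trans Ha) // (leq_trans Hl) // ltnW.
do 9?[case: k E => [|k] E //]; rewrite ?H1 ?H2 ?(H (usnd n)) //.
- case: (ufst (usnd n) =P 0%N) => // E7; have {}E7 : (0 < ufst (usnd n))%N by case: (ufst _) E7.
  rewrite (H (lhd _)); last first.
    apply: ltn_trans Hu; apply: leq_trans (leq_ufst _).
    exact: ltn_lhd.
  rewrite (H (cev _ _)) //.
  (* The recursive call on [cev] goes to the tail of the list, whose pair with the same point has a
     smaller code. *)
  rewrite -[X in (_ < X)%N](npair_unpair n) E /cev; apply: ltn_npair2.
  rewrite -[X in (_ < X)%N](npair_unpair (usnd n)); apply: ltn_npair1.
  exact: ltn_ltl.
- rewrite Hm ?leq_ufst //; congr root_between; apply: H; apply: leq_ltn_trans Hu.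
    exact: leq_trans (leq_ufst _) (leq_usnd _).
  exact: leq_trans (leq_usnd _) (leq_usnd _).
- by rewrite Hm.
Qed.

Lemma interp_var i : interp (cvar i) = var i.
Proof. by rewrite interpE /istep ufst_npair usnd_npair. Qed.

Lemma interp_hom : code_hom interp.
Proof.
by split=> *; rewrite [LHS]interpE /istep ?ufst_npair ?usnd_npair /= ?ufst_npair ?usnd_npair.
Qed.

Lemma interp_sk s : interp (csk (lcode s)) = sk (map interp s).
Proof. by rewrite [LHS]interpE /istep ufst_npair usnd_npair /= declist_lcode. Qed.

Lemma interp_ev0 a : interp (cev 0 a) = 0.
Proof. by rewrite interpE /istep ?ufst_npair ?usnd_npair /= ?ufst_npair. Qed.

Lemma interp_evS c l a : interp (cev (lcons c l) a) = interp c + interp a * interp (cev l a).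
Proof.
rewrite [LHS]interpE /istep !ufst_npair usnd_npair ufst_npair usnd_npair.
by rewrite lhd_cons ltl_cons.
Qed.

Lemma interp_ev l a : interp (cev l a) = (Poly (map interp (declist l))).[interp a].
Proof.
elim/ltn_ind: l => -[|l] IH; first by rewrite interp_ev0 declistE /= horner0.
rewrite declistE -[X in cev X](@lcons_eta l.+1) // interp_evS IH ?ltn_ltl //=.
by rewrite cons_poly_def hornerMXaddC mulrC addrC.
Qed.

Lemma interp_root l a b : interp a <= interp b ->
  interp (cev l a) <= 0 -> 0 <= interp (cev l b) ->
  let r := interp (croot l a b) in
  interp a <= r <= interp b /\ interp (cev l (croot l a b)) = 0.
Proof.
move=> ab; rewrite !interp_ev => pa pb r.
have E : r = root_between (Poly (map interp (declist l))) (interp a) (interp b).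
  by rewrite /r [LHS]interpE /istep !(ufst_npair, usnd_npair).
rewrite -/r E /root_between; case: pselect => [H|[]].
  by case: (cid H) => x /= [Hx /eqP rx].
have [|x Hx rx] := poly_ivt ab (p := Poly (map interp (declist l))); first by rewrite pa pb.
by exists x.
Qed.

End Interp.

(** * Open formulas over the order, and the axioms of real closed fields *)

Inductive bexp : Type :=
| BLt (a b : nat)
| BCst (b : bool)
| BAnd (x y : bexp)
| BOr (x y : bexp)
| BNot (x : bexp)
| BAll (n : nat) (f : nat -> bexp)
| BEx (n : nat) (f : nat -> bexp).

Fixpoint bev (P : nat -> bool) (x : bexp) : bool :=
  match x with
  | BLt a b => P (npair a b)
  | BCst b => b
  | BAnd x y => bev P x && bev P y
  | BOr x y => bev P x || bev P y
  | BNot x => ~~ bev P x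
  | BAll n f => ball n (fun i => bev P (f i))
  | BEx n f => bex n (fun i => bev P (f i))
  end.

(* A bound on the atoms of [x]. *)
Fixpoint bsize (x : bexp) : nat :=
  match x with
  | BLt a b => (npair a b).+1
  | BCst b => 0
  | BAnd x y => bsize x + bsize y
  | BOr x y => bsize x + bsize y
  | BNot x => bsize x
  | BAll n f => bsum n (fun i => bsize (f i))
  | BEx n f => bsum n (fun i => bsize (f i))
  end.

Lemma eq_ball n (P Q : nat -> bool) : (forall i, i < n -> P i = Q i) -> ball n P = ball n Q.
Proof. by elim: n => //= n IH H; rewrite H // IH // => i Hi; rewrite H // ltnW. Qed.

Lemma bev_ext P Q x : (forall t, t < bsize x -> P t = Q t) -> bev P x = bev Q x.
Proof.
elim: x => //= [a b|x Hx y Hy|x Hx y Hy|x Hx|n f Hf|n f Hf] H.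
- exact: H.
- by rewrite Hx ?Hy // => t Ht; apply: H; rewrite (leq_trans Ht) // ?leq_addr ?leq_addl.
- by rewrite Hx ?Hy // => t Ht; apply: H; rewrite (leq_trans Ht) // ?leq_addr ?leq_addl.
- by rewrite Hx.
- apply: eq_ball => i Hi; apply: Hf => t Ht; apply: H; apply: leq_trans Ht _.
  exact: (leq_bsum (fun i => bsize (f i))).
- congr negb; apply: eq_ball => i Hi; congr negb; apply: Hf => t Ht; apply: H.
  by apply: leq_trans Ht _; apply: (leq_bsum (fun i => bsize (f i))).
Qed.

Definition BImp x y := BOr (BNot x) y.
(** Equality is incomparability: the order is the only relation, so a truth assignment to the atoms
    is a candidate order. *)
Definition BEq a b := BAnd (BNot (BLt a b)) (BNot (BLt b a)).
Definition BIff x y := BAnd (BImp x y) (BImp y x).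

(** All axioms are universal: inverses and roots have symbols, so the intermediate value property is
    one instance for each list [c] and bounds [a], [b]. A number is read as a term or as a list of
    coefficients, according to its place. *)
Definition rcf_axioms (a b c : nat) : seq bexp := [::
    BNot (BLt a a);
    BImp (BAnd (BLt a b) (BLt b c)) (BLt a c);
    BImp (BLt a b) (BOr (BLt a c) (BLt c b));
    BIff (BLt a b) (BLt (cadd a c) (cadd b c));
    BEq (cadd a b) (cadd b a);
    BEq (cadd a (cadd b c)) (cadd (cadd a b) c);
    BEq (cadd czero a) a;
    BEq (cadd (copp a) a) czero;
    BImp (BEq a b) (BEq (copp a) (copp b));
    BEq (cmul a b) (cmul b a);
    BEq (cmul a (cmul b c)) (cmul (cmul a b) c);
    BEq (cmul cone a) a;
    BEq (cmul (cadd a b) c) (cadd (cmul a c) (cmul b c));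
    BImp (BEq a b) (BEq (cmul a c) (cmul b c));
    BImp (BAnd (BLt czero a) (BLt czero b)) (BLt czero (cmul a b));
    BLt czero cone;
    BImp (BNot (BEq a czero)) (BEq (cmul (cinv a) a) cone);
    BImp (BEq a czero) (BEq (cinv a) czero);
    BEq (cev 0 a) czero;
    BEq (cev (lcons a c) b) (cadd a (cmul b (cev c b)));
    BImp (BAnd (BNot (BLt b a)) (BAnd (BNot (BLt czero (cev c a))) (BNot (BLt (cev c b) czero))))
      (BAnd (BNot (BLt (croot c a b) a)) (BAnd (BNot (BLt b (croot c a b)))
        (BEq (cev c (croot c a b)) czero)))].

Definition rcf_axiom (a b c : nat) : bexp := foldr BAnd (BCst true) (rcf_axioms a b c).

Definition order_of (K : rcfType) (I : nat -> K) (t : nat) : bool :=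
  (I (ufst t) < I (usnd t))%R.

Lemma order_ofE (K : rcfType) (I : nat -> K) a b : order_of I (npair a b) = (I a < I b)%R.
Proof. by rewrite /order_of ufst_npair usnd_npair. Qed.

Definition rcf_order (P : nat -> bool) : Prop := forall a b c, bev P (rcf_axiom a b c).

Lemma interp_rcf_order (K : rcfType) (var : nat -> K) sk : rcf_order (order_of (interp var sk)).
Proof.
move=> a b c; set I := interp var sk; have H := interp_hom var sk; rewrite -/I in H.
have EI (x y : bool) : (~~ x || y) = (x ==> y) by case: x.
have EE (x y : K) : (~~ (x < y)%R && ~~ (y < x)%R) = (x == y).
  by rewrite -!leNgt andbC eq_le.
rewrite /rcf_axiom /= !order_ofE !EI !EE.
rewrite !(hom_zero H, hom_one H, hom_add H, hom_opp H, hom_mul H, hom_inv H).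
have E0 t : I (cev 0 t) = 0%R by apply: interp_ev0.
have ES u l t : I (cev (lcons u l) t) = (I u + I t * I (cev l t))%R by apply: interp_evS.
rewrite !E0 !ES -?leNgt ?lexx ?eqxx /= ?andbT.
do !(apply/andP; split) => //.
- by apply/implyP; case/andP; apply: lt_trans.
- apply/implyP => ab; case: ltP => //= ca; exact: le_lt_trans ab.
- by rewrite ltrD2r implybb.
- by rewrite ltrD2r implybb.
- by apply/eqP; rewrite addrC.
- by apply/eqP; rewrite addrA.
- by apply/eqP; rewrite add0r.
- by apply/eqP; rewrite addNr.
- by apply/implyP; move/eqP->; rewrite eqxx.
- by apply/eqP; rewrite mulrC.
- by apply/eqP; rewrite mulrA.
- by apply/eqP; rewrite mul1r.
- by apply/eqP; rewrite mulrDl.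
- by apply/implyP; move/eqP->; rewrite eqxx.
- by apply/implyP; case/andP; apply: mulr_gt0.
- by apply/implyP => a0; rewrite mulVf.
- by apply/implyP; move/eqP->; rewrite invr0 eqxx.
- apply/implyP; case/and3P => ab pa pb; have [/andP[H1 H2] H3] := interp_root ab pa pb.
  by apply/and3P; split=> //; apply/eqP.
Qed.

(** * The real closed field of terms *)

Section TermModel.
Variables (P : nat -> bool) (HP : rcf_order P).

Let ltP a b := P (npair a b).
Let eqv a b := ~~ ltP a b && ~~ ltP b a.

Lemma rcf_axiom_nth i a b c : bev P (nth (BCst true) (rcf_axioms a b c) i).
Proof.
have := HP a b c; rewrite /rcf_axiom; elim: (rcf_axioms a b c) i => [|x s IH] [|i] //=.
  by case/andP.
by case/andP=> _; apply: IH.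
Qed.

Let lt_irr a : ~~ ltP a a. Proof. exact: (rcf_axiom_nth 0 a 0 0). Qed.

Let lt_tr a b c : ltP a b -> ltP b c -> ltP a c.
Proof. by have := rcf_axiom_nth 1 a b c => /= /orP[/nandP[]/negP|]. Qed.

Let lt_cotr a b c : ltP a b -> ltP a c || ltP c b.
Proof. by have := rcf_axiom_nth 2 a b c => /= /orP[/negP|]. Qed.

Let eqv_refl a : eqv a a. Proof. by rewrite /eqv lt_irr. Qed.

Let eqv_sym a b : eqv a b = eqv b a. Proof. by rewrite /eqv andbC. Qed.

(** Cotransitivity makes incomparability compatible with the order: an inequality splits at each
    replacement of an end, and incomparability refutes one half. *)
Let eqv_lt a a' b b' : eqv a a' -> eqv b b' -> ltP a b = ltP a' b'.
Proof.
have H x x' y y' : eqv x x' -> eqv y y' -> ltP x y -> ltP x' y'.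
  move=> /andP[/negbTE H1 _] /andP[_ /negbTE H2] H3.
  have := lt_cotr x' H3; rewrite H1 /= => H4.
  by have := lt_cotr y' H4; rewrite H2 orbF.
by move=> E1 E2; apply/idP/idP; apply: H => //; rewrite eqv_sym.
Qed.

Let eqv_tr a b c : eqv a b -> eqv b c -> eqv a c.
Proof. by move=> E1 E2; rewrite /eqv (eqv_lt E1 (eqv_refl c)) (eqv_lt (eqv_refl c) E1). Qed.

(** Each class is represented by its least code, so the quotient is a subtype of the natural numbers
    and inherits choice and countability. *)
Let is_repr t := ball t (fun s => ~~ eqv s t).

(* The proof is an argument so that it determines the structures on the type. *)
Definition tmodel_of (_ : rcf_order P) : Type := {t : nat | is_repr t}.
Notation tmodel := (tmodel_of HP).
HB.instance Definition _ := SubType.on tmodel.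
HB.instance Definition _ := Choice.on tmodel.

Lemma repr_exists t : exists s, eqv s t. Proof. by exists t. Qed.

Let repr t := ex_minn (repr_exists t).

Let repr_eqv t : eqv (repr t) t. Proof. by rewrite /repr; case: ex_minnP. Qed.

Lemma reprP t : is_repr (repr t).
Proof.
rewrite /repr; case: ex_minnP => m mt min; apply/ballP => s sm.
apply/negP => E; have := min s (eqv_tr E mt); lia.
Qed.

Definition cls (t : nat) : tmodel := exist _ (repr t) (reprP t).

Let cls_eqv a b : eqv a b -> cls a = cls b.
Proof.
move=> ab; apply: val_inj => /=; rewrite /repr.
case: ex_minnP => m ma minm; case: ex_minnP => n nb minn'.
by apply/eqP; rewrite eqn_leq minm ?minn' //; apply: eqv_tr nb _ || apply: eqv_tr ma _; rewrite // eqv_sym.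
Qed.

Lemma cls_val (x : tmodel) : cls (val x) = x.
Proof.
apply: val_inj => /=; rewrite /repr; case: ex_minnP => m mx min.
apply/eqP; rewrite eqn_leq min //= leqNgt; apply/negP => H.
by have /ballP/(_ _ H)/negP := valP x; apply.
Qed.

Let cls_eq a b : cls a = cls b -> eqv a b.
Proof.
move=> [E]; apply: eqv_tr (repr_eqv b); rewrite -E eqv_sym; exact: repr_eqv.
Qed.

Let zero : tmodel := cls czero.
Let one : tmodel := cls cone.
Let add (x y : tmodel) : tmodel := cls (cadd (val x) (val y)).
Let opp (x : tmodel) : tmodel := cls (copp (val x)).
Let mul (x y : tmodel) : tmodel := cls (cmul (val x) (val y)).
Let inv (x : tmodel) : tmodel := cls (cinv (val x)).
Let lt (x y : tmodel) : bool := ltP (val x) (val y).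
Let le (x y : tmodel) : bool := (x == y) || lt x y.
Let norm (x : tmodel) : tmodel := if le zero x then x else opp x.

Let addC a b : eqv (cadd a b) (cadd b a). Proof. exact: (rcf_axiom_nth 4 a b 0). Qed.

Let lt_add a b c : ltP (cadd a c) (cadd b c) = ltP a b.
Proof.
have /= /andP[H1 H2] := rcf_axiom_nth 3 a b c.
by apply/idP/idP => H; [move: H2|move: H1]; rewrite /ltP in H *; rewrite H.
Qed.

Let eqv_add a a' b b' : eqv a a' -> eqv b b' -> eqv (cadd a b) (cadd a' b').
Proof.
move=> E1 E2; apply: (@eqv_tr _ (cadd a' b)); first by rewrite /eqv !lt_add.
apply: eqv_tr (addC _ _) _; apply: eqv_tr (addC _ _); by rewrite /eqv !lt_add.
Qed.

Let clsD a b : cls (cadd a b) = add (cls a) (cls b).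
Proof. by apply: cls_eqv; apply: eqv_add; rewrite eqv_sym; apply: repr_eqv. Qed.

Let clsN a : cls (copp a) = opp (cls a).
Proof.
apply: cls_eqv; have /= /orP[/negP|//] := rcf_axiom_nth 8 a (repr a) 0.
by case; rewrite -[X in is_true X]/(eqv _ _) eqv_sym repr_eqv.
Qed.

Let mulC a b : eqv (cmul a b) (cmul b a). Proof. exact: (rcf_axiom_nth 9 a b 0). Qed.

Let eqv_mul a b c : eqv a b -> eqv (cmul a c) (cmul b c).
Proof. by move=> E; have /= /orP[/negP|] := rcf_axiom_nth 13 a b c. Qed.

Let clsM a b : cls (cmul a b) = mul (cls a) (cls b).
Proof.
apply: cls_eqv; apply: (@eqv_tr _ (cmul (repr a) b)).
  by apply: eqv_mul; rewrite eqv_sym repr_eqv.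
apply: (eqv_tr (mulC _ _)); apply: (eqv_tr _ (mulC _ _)).
by apply: eqv_mul; rewrite eqv_sym repr_eqv.
Qed.

Let clsL a b : ltP a b = lt (cls a) (cls b).
Proof. by apply: eqv_lt; rewrite eqv_sym repr_eqv. Qed.

Let wlog_cls (Q : tmodel -> Prop) : (forall t, Q (cls t)) -> forall x, Q x.
Proof. by move=> H x; rewrite -(cls_val x). Qed.

Let addA : associative add.
Proof.
move=> x y z; elim/wlog_cls: x => a; elim/wlog_cls: y => b; elim/wlog_cls: z => c.
by rewrite -!clsD; apply: cls_eqv; apply: (rcf_axiom_nth 5 a b c).
Qed.
Let addC' : commutative add.
Proof.
move=> x y; elim/wlog_cls: x => a; elim/wlog_cls: y => b.
by rewrite -!clsD; apply: cls_eqv.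
Qed.
Let add0 : left_id zero add.
Proof.
by elim/wlog_cls => a; rewrite -!clsD; apply: cls_eqv; apply: (rcf_axiom_nth 6 a 0 0).
Qed.
Let addN : left_inverse zero opp add.
Proof.
by elim/wlog_cls => a; rewrite -clsN -clsD; apply: cls_eqv; apply: (rcf_axiom_nth 7 a 0 0).
Qed.
HB.instance Definition _ := GRing.isZmodule.Build tmodel addA addC' add0 addN.

Let mulA : associative mul.
Proof.
move=> x y z; elim/wlog_cls: x => a; elim/wlog_cls: y => b; elim/wlog_cls: z => c.
by rewrite -!clsM; apply: cls_eqv; apply: (rcf_axiom_nth 10 a b c).
Qed.
Let mulC' : commutative mul.
Proof.
move=> x y; elim/wlog_cls: x => a; elim/wlog_cls: y => b.
by rewrite -!clsM; apply: cls_eqv.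
Qed.
Let mul1 : left_id one mul.
Proof.
by elim/wlog_cls => a; rewrite -!clsM; apply: cls_eqv; apply: (rcf_axiom_nth 11 a 0 0).
Qed.
Let mulD : left_distributive mul add.
Proof.
move=> x y z; elim/wlog_cls: x => a; elim/wlog_cls: y => b; elim/wlog_cls: z => c.
by rewrite -(clsD a b) -!(clsM _ c) -clsD; apply: cls_eqv; apply: (rcf_axiom_nth 12 a b c).
Qed.
Let one_neq0 : one != zero.
Proof.
apply/eqP => /cls_eq /andP[_ /negP]; apply.
exact: (rcf_axiom_nth 15 0 0 0).
Qed.
HB.instance Definition _ := GRing.Zmodule_isComNzRing.Build tmodel mulA mulC' mul1 mulD one_neq0.

Let mulV (x : tmodel) : x != zero -> mul (inv x) x = one.
Proof.
move=> x0; rewrite -[X in mul _ X]cls_val -clsM; apply: cls_eqv.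
have /= /orP[/negP|] // := rcf_axiom_nth 16 (val x) 0 0.
by case; apply/negP => E; case/negP: x0; rewrite -(cls_val x); apply/eqP/cls_eqv.
Qed.
Let inv0 : inv zero = zero.
Proof.
apply: cls_eqv; have /= /orP[/negP|] // := rcf_axiom_nth 17 (repr czero) 0 0.
by case; apply: repr_eqv.
Qed.
HB.instance Definition _ := GRing.ComNzRing_isField.Build tmodel mulV inv0.

Local Open Scope ring_scope.

Let lt0_add (x y : tmodel) : lt 0 x -> lt 0 y -> lt 0 (x + y).
Proof.
elim/wlog_cls: x => a; elim/wlog_cls: y => b; rewrite -[_ + _]clsD -!clsL => Ha Hb.
have H1 : ltP (cadd czero b) (cadd a b) by rewrite lt_add.
have E : eqv (cadd czero b) b := rcf_axiom_nth 6 b 0 0.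
by apply: lt_tr Hb _; rewrite -(eqv_lt E (eqv_refl _)).
Qed.
Let lt0_mul (x y : tmodel) : lt 0 x -> lt 0 y -> lt 0 (x * y).
Proof.
elim/wlog_cls: x => a; elim/wlog_cls: y => b; rewrite -[_ * _]clsM -!clsL => Ha Hb.
by have /= /orP[/nandP[]/negP|] := rcf_axiom_nth 14 a b 0.
Qed.
Let lt0_ngt0 (x : tmodel) : lt 0 x -> ~~ lt x 0.
Proof. by move=> H; apply/negP => H'; have /negP := lt_irr (val (0 : tmodel)); apply; apply: lt_tr H H'. Qed.
Let sub_gt0 (x y : tmodel) : lt 0 (y - x) = lt x y.
Proof.
elim/wlog_cls: x => a; elim/wlog_cls: y => b.
rewrite -[RHS]clsL -(lt_add _ _ (copp a)) clsL !clsD !clsN; congr lt.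
by rewrite -[RHS]/(cls a - cls a) subrr.
Qed.
Let lt0_total (x : tmodel) : x != 0 -> lt 0 x || lt x 0.
Proof.
elim/wlog_cls: x => a a0; rewrite -!clsL; apply/negPn/negP; rewrite negb_or => E.
by case/negP: a0; apply/eqP; apply: cls_eqv; rewrite eqv_sym.
Qed.
Let ge0_norm (x : tmodel) : le 0 x -> norm x = x. Proof. by rewrite /norm => ->. Qed.
Let normN (x : tmodel) : norm (- x) = norm x.
Proof.
have ltN (y : tmodel) : lt 0 (- y) = lt y 0 by rewrite -(sub_gt0 y 0) sub0r.
rewrite /norm /le -/zero; case: (eqVneq x 0) => [->|x0].
  by rewrite [- 0]oppr0 (_ : zero == 0).
have E1 : (zero == - x) = false.
  by apply/eqP => E; case/eqP: x0; rewrite -[x]opprK -E; apply: oppr0.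
rewrite E1 /= -[zero]/(0 : tmodel) ltN; have := lt0_total x0.
case: (boolP (lt 0 x)) => [/lt0_ngt0/negbTE ->|_ /= ->] //.
by move=> _; apply: opprK.
Qed.
Let le_def (x y : tmodel) : le x y = (x == y) || lt x y. Proof. by []. Qed.
HB.instance Definition _ := Num.IntegralDomain_isLtReal.Build tmodel
  lt0_add lt0_mul lt0_ngt0 sub_gt0 lt0_total normN ge0_norm le_def.

Lemma cls_lt a b : (cls a < cls b) = P (npair a b).
Proof. by rewrite -[P _]/(ltP a b) clsL. Qed.

Lemma cls_hom : code_hom cls.
Proof.
split=> // a.
have [/cls_eq E|/eqP a0] := pselect (cls a = 0).
  rewrite (cls_eqv E) invr0; apply: cls_eqv.
  by have /= /orP[/negP|] // := rcf_axiom_nth 17 a 0 0.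
apply: (mulIf a0); rewrite mulVf // -[LHS]clsM; apply: cls_eqv.
have /= /orP[/negP|] // := rcf_axiom_nth 16 a 0 0.
by case; apply/negP => E; case/negP: a0; apply/eqP/cls_eqv.
Qed.

Let cls_ev l a : cls (cev l a) = (Poly (map cls (declist l))).[cls a].
Proof.
elim/ltn_ind: l => -[|l] IH.
  by rewrite declistE /= horner0; apply: cls_eqv; apply: (rcf_axiom_nth 18 a 0 0).
rewrite declistE -[X in cev X](@lcons_eta l.+1) //= cons_poly_def hornerMXaddC.
rewrite -IH ?ltn_ltl // mulrC addrC -(hom_mul cls_hom) -(hom_add cls_hom).
by apply: cls_eqv; apply: (rcf_axiom_nth 19 _ _ _).
Qed.

Lemma tmodel_closed : Num.real_closed_axiom tmodel.
Proof.
move=> p x y xy /andP[px py].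
(* The coefficients of [p] have representatives, so [p] itself has a code [l], and [croot] applied
   to it names the required root. *)
pose l := lcode (map val (p : seq tmodel)).
have E z : cls (cev l z) = p.[cls z].
  rewrite cls_ev declist_lcode -map_comp (eq_map (g := id)) ?map_id ?polyseqK //.
  exact: cls_val.
pose r := croot l (val x) (val y).
have /= /orP[|] := rcf_axiom_nth 20 (val x) (val y) l.
  rewrite -!cls_lt !E !cls_val -!leNgt xy -[cls czero]/(0 : tmodel) px py.
  by [].
rewrite -!cls_lt !E -!leNgt -/r !cls_val -[cls czero]/(0 : tmodel) => /and3P[H1 H2 H3].
by exists (cls r); [rewrite H1 H2|by rewrite /root eq_le; case/andP: H3 => -> ->].
Qed.
HB.instance Definition _ := Num.RealField_isClosed.Build tmodel tmodel_closed.

End TermModel.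
Notation tmodel HP := (tmodel_of HP).

(** * Limits of truth assignments *)

Section Limit.
Variable Pk : nat -> nat -> bool.

Let often (m : nat) (Q : nat -> bool) : Prop :=
  forall C, exists2 k, C <= k & forall t, t < m -> Pk k t = Q t.

Let approx (m : nat) : nat -> bool :=
  nrec (fun=> false)
    (fun m Q => if pselect (often m.+1 (upd Q m true)) then upd Q m true else upd Q m false) m.

Let approxS m : approx m.+1 =
  if pselect (often m.+1 (upd (approx m) m true)) then upd (approx m) m true
  else upd (approx m) m false.
Proof. by []. Qed.

Let often_approx m : often m (approx m).
Proof.
elim: m => [|m IH]; first by move=> C; exists C.
rewrite approxS; case: pselect => //= Hn C.
(* If the value [true] does not recur, it fails from some [C0] on, and beyond [C0] every recurrence
   of the shorter prefix carries the value [false]. *)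
have [C0 HC0] : exists C0, forall k, C0 <= k ->
    ~ (forall t, t < m.+1 -> Pk k t = upd (approx m) m true t).
  apply: contrapT => H; apply: Hn => C'; apply: contrapT => H'.
  by apply: H; exists C' => k Ck Hk; apply: H'; exists k.
have [k Hk Hm] := IH (maxn C C0); move: Hk; rewrite geq_max => /andP[Ck C0k].
exists k => // t; rewrite ltnS leq_eqVlt /upd => /orP[/eqP->|tm]; last first.
  by rewrite ltn_eqF // Hm.
rewrite eqxx; apply/negbTE/negP => Pm; apply: (HC0 k C0k) => j.
rewrite ltnS leq_eqVlt /upd => /orP[/eqP->|jm]; first by rewrite eqxx.
by rewrite ltn_eqF // Hm.
Qed.

(** Compactness of Cantor space: the values are fixed one after the other in such a way that the
    prefix recurs for arbitrarily large [k]. *)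
Lemma cluster_point : exists P : nat -> bool,
  forall m C, exists2 k, C <= k & forall t, t < m -> Pk k t = P t.
Proof.
exists (fun t => approx t.+1 t) => m C.
have E t j : approx (t.+1 + j) t = approx t.+1 t.
  elim: j => [|j IH]; first by rewrite addn0.
  have Hn : (t == t.+1 + j) = false by apply/eqP; lia.
  by rewrite addnS approxS; case: pselect => ? /=; rewrite /upd Hn IH.
have [k Ck Hk] := often_approx m C; exists k => // t tm; rewrite Hk //.
by rewrite -(subnKC tm) E.
Qed.

End Limit.

Definition cluster (Pk : nat -> nat -> bool) (P : nat -> bool) : Prop :=
  forall m C, exists2 k, C <= k & forall t, t < m -> Pk k t = P t.

(** An open formula reads finitely many atoms, on which [P] agrees with arbitrarily late members of
    the sequence. *)
Lemma cluster_bev Pk P x C : cluster Pk P ->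
  (forall k, C <= k -> bev (Pk k) x) -> bev P x.
Proof.
move=> HP H; have [k Ck Hk] := HP (bsize x) C.
by rewrite -(bev_ext Hk); apply: H.
Qed.

Lemma cluster_rcf_order Pk P : cluster Pk P -> (forall k, rcf_order (Pk k)) -> rcf_order P.
Proof. by move=> HP H a b c; apply: (cluster_bev (C := 0) HP) => k _; apply: H. Qed.

Definition cnat (n : nat) : nat := nrec czero (fun _ t => cadd t cone) n.

Lemma comp_cnat A : computable A -> computable (fun e => cnat (A e)).
Proof. by move=> HA; apply: comp_nrec; cmp. Qed.
#[local] Hint Resolve comp_cnat : comp.

Definition cint (z : int) : nat :=
  match z with Posz n => cnat n | Negz n => copp (cnat n.+1) end.

Fixpoint tcode (t : rterm) : nat :=
  match t with
  | qe_rcf.Var i => cvar i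
  | qe_rcf.Const q => cmul (cint (numq q)) (cinv (cint (denq q)))
  | qe_rcf.NatConst n => cnat n
  | qe_rcf.Add u v => cadd (tcode u) (tcode v)
  | qe_rcf.Opp u => copp (tcode u)
  | qe_rcf.NatMul u n => cmul (cnat n) (tcode u)
  | qe_rcf.Mul u v => cmul (tcode u) (tcode v)
  | qe_rcf.Exp u n => nrec cone (fun _ t => cmul (tcode u) t) n
  end.

Section CodeHom.
Variables (K : rcfType) (I : nat -> K).
Hypothesis HI : code_hom I.

Lemma hom_cnat n : I (cnat n) = (n%:R)%R.
Proof.
elim: n => [|n IH]; first exact: hom_zero.
by rewrite /cnat /= (hom_add HI) -/(cnat n) IH (hom_one HI) -natr1.
Qed.

Lemma hom_cint z : I (cint z) = (z%:~R)%R.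
Proof.
case: z => n; first exact: hom_cnat.
by rewrite /cint (hom_opp HI) hom_cnat NegzE mulrNz.
Qed.

Lemma hom_tcode t : I (tcode t) = teval_rat (I \o cvar) t.
Proof.
elim: t => //= [q|n|u Hu v Hv|u Hu|u Hu n|u Hu v Hv|u Hu n].
- by rewrite (hom_mul HI) (hom_inv HI) !hom_cint.
- exact: hom_cnat.
- by rewrite (hom_add HI) Hu Hv.
- by rewrite (hom_opp HI) Hu.
- by rewrite (hom_mul HI) hom_cnat Hu mulr_natl.
- by rewrite (hom_mul HI) Hu Hv.
- elim: n => [|n IH] /=; first exact: hom_one.
  by rewrite (hom_mul HI) IH Hu exprS.
Qed.

End CodeHom.

Definition clause_code (c : clause) : bexp :=
  BAnd (foldr BAnd (BCst true) (map (fun t => BEq (tcode t) czero) c.1))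
       (foldr BAnd (BCst true) (map (fun t => BLt czero (tcode t)) c.2)).

Definition dnf_code (d : seq clause) : bexp := foldr BOr (BCst false) (map clause_code d).

Lemma bev_dnf_code (K : rcfType) (I : nat -> K) d : code_hom I ->
  bev (order_of I) (dnf_code d) = has (clause_holds (I \o cvar)) d.
Proof.
move=> HI; rewrite /dnf_code; elim: d => //= -[s1 s2] d ->; congr orb.
rewrite /clause_holds /=; congr andb.
  elim: s1 => //= t s ->; congr andb.
  by rewrite !order_ofE (hom_zero HI) (hom_tcode HI) -!leNgt andbC eq_le.
by elim: s2 => //= t s ->; rewrite order_ofE (hom_zero HI) (hom_tcode HI).
Qed.

Lemma order_of_cls P (HP : rcf_order P) : order_of (cls HP) =1 P.
Proof. by move=> t; rewrite /order_of cls_lt npair_unpair. Qed.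

(* Los's theorem for the limit of real interpretations. *)
Lemma sdef_limit (K : rcfType) (e : nat -> nat -> K) sk P (HP : rcf_order P) phi C :
  cluster (fun k => order_of (interp (e k) sk)) P -> sdef phi ->
  (forall k, C <= k -> phi K (e k)) -> phi (tmodel HP) (fun i => cls HP (cvar i)).
Proof.
move=> Hcl [d Hd] H; apply/Hd.
have -> : (fun i => cls HP (cvar i)) = cls HP \o cvar by [].
rewrite -bev_dnf_code; last exact: cls_hom.
rewrite (bev_ext (Q := P)) => [|t _]; last exact: order_of_cls.
apply: (cluster_bev (C := C) Hcl) => k Ck; rewrite bev_dnf_code; last exact: interp_hom.
have -> : interp (e k) sk \o cvar = e k by apply/funext => i; apply: interp_var.
by apply/Hd; apply: H.
Qed.

(** * Prenex games *)

Section Game.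
Variables (kind : nat -> bool) (Th : forall K : rcfType, (nat -> K) -> Prop).

(* Truth of the prenex statement whose [i]-th quantifier is universal when
   [kind i] holds; [l] quantifiers, starting with the [i]-th, remain. *)
Fixpoint ptrue (K : rcfType) (l i : nat) (e : nat -> K) : Prop :=
  if l is l'.+1 then
    if kind i then forall x, ptrue l' i.+1 (upd e i x)
    else exists x, ptrue l' i.+1 (upd e i x)
  else Th e.

Lemma sdef_ptrue l i : sdef Th -> sdef (fun K e => ptrue l i e).
Proof.
move=> H; elim: l i => [|l IH] i //=.
by case: (kind i); [apply: (sdef_forall i (IH i.+1))|apply: (sdef_ex i (IH i.+1))].
Qed.

Variables (len : nat) (mat : (nat -> nat) -> bexp).
Hypothesis mat_Th : forall (K : rcfType) (I : nat -> K), code_hom I ->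
  forall X, bev (order_of I) (mat X) <-> Th (I \o X).

(** Universal moves are arbitrary terms read from [m]; each existential move is the Skolem term of
    the history before it. Histories are listed with the latest move first. *)
Definition plays (m : nat) (i : nat) : seq nat :=
  nrec [::] (fun i s => (if kind i then look m i else csk (lcode s)) :: s) i.

Definition playx (m i : nat) : nat := if i < len then head 0 (plays m i.+1) else czero.

Lemma playsS m i :
  plays m i.+1 = (if kind i then look m i else csk (lcode (plays m i))) :: plays m i.
Proof. by []. Qed.

Lemma size_plays m i : size (plays m i) = i.
Proof. by elim: i => //= i ->. Qed.

Definition env_of (K : rcfType) (h : seq K) : nat -> K := fun i => nth 0%R (rev h) i.

Lemma env_of_cons (K : rcfType) (x : K) h : env_of (x :: h) = upd (env_of h) (size h) x.
Proof.
apply/funext => i; rewrite /env_of /upd rev_cons nth_rcons size_rev.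
by case: ltngtP => // H; rewrite nth_default // size_rev ltnW.
Qed.

Lemma env_of_plays (K : rcfType) (I : nat -> K) m : code_hom I ->
  env_of (map I (plays m len)) = I \o playx m.
Proof.
move=> HI; apply/funext => i; rewrite /env_of /playx /=.
have H l : i < l -> nth 0%R (rev (map I (plays m l))) i = I (head 0 (plays m i.+1)).
  elim: l => // l IH; rewrite ltnS leq_eqVlt /= rev_cons nth_rcons size_rev size_map.
  by rewrite size_plays => /orP[/eqP->|il]; [rewrite ltnn eqxx|rewrite il IH].
case: ltnP => [/H //|Hi]; rewrite nth_default ?(hom_zero HI) //.
by rewrite size_rev size_map size_plays.
Qed.

(** The number [j] codes three terms and a play, so these instances exhaust the Herbrand expansion
    of the axioms together with the matrix. *)
Definition inst (j : nat) : bexp :=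
  BAnd (rcf_axiom (ufst (ufst j)) (usnd (ufst j)) (ufst (usnd j)))
       (mat (playx (usnd (usnd j)))).

Lemma ptrue_order (K : rcfType) : ptrue len 0 (fun=> 0%R : K) ->
  exists P, forall j, bev P (inst j).
Proof.
(* The Skolem function answers a history by a move that keeps the remaining statement true, whenever
   there is one. *)
move=> H; pose sk (h : seq K) : K :=
  if pselect (exists x, ptrue (len - (size h).+1) (size h).+1 (env_of (x :: h))) is left E
  then sval (cid E) else 0%R.
pose I := interp (fun=> 0%R) sk; have HI : code_hom I := interp_hom _ _.
exists (order_of I) => j; rewrite /=; apply/andP; split; first exact: interp_rcf_order.
move: (usnd (usnd j)) => m {j}; apply/mat_Th => //; rewrite -env_of_plays //.
suff Hk k : k <= len -> ptrue (len - k) k (env_of (map I (plays m k))).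
  by have := Hk len (leqnn _); rewrite subnn.
elim: k => [|k IH] Hk.
  rewrite subn0 (_ : env_of _ = fun=> 0%R) //.
  by apply/funext => i; rewrite /env_of nth_nil.
have := IH (ltnW Hk); rewrite -(subnSK Hk) /=; case: ifP => _.
  by rewrite env_of_cons size_map size_plays; apply.
move=> [x Hx]; rewrite {1}/I interp_sk -/I /sk size_map size_plays.
case: pselect => [E|[]]; first by case: (cid E).
by exists x; rewrite env_of_cons size_map size_plays.
Qed.

(** These are the histories that occur in plays; the universal moves are unrestricted. *)
Fixpoint consistent (s : seq nat) : Prop :=
  if s is x :: s' then (~~ kind (size s') -> x = csk (lcode s')) /\ consistent s' else True.

Lemma consistent_plays s m : consistent s ->
  (forall i, i < size s -> look m i = nth 0 (rev s) i) -> plays m (size s) = s.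
Proof.
elim: s => //= x s IH [Hx Hs] Hm.
have E : plays m (size s) = s.
  apply: IH => // i Hi; rewrite Hm ?ltnS ?(ltnW Hi) //.
  by rewrite rev_cons nth_rcons size_rev Hi.
rewrite playsS E; congr cons; case: ifP => [_|/negbT/Hx ->] //.
by rewrite Hm // rev_cons nth_rcons size_rev ltnn eqxx.
Qed.

Lemma ptrue_tmodel P (HP : rcf_order P) : (forall j, bev P (inst j)) ->
  ptrue len 0 (fun=> 0%R : tmodel HP).
Proof.
move=> H; have Hc := cls_hom HP; pose I := cls HP.
suff Hl l s : size s + l = len -> consistent s -> ptrue l (size s) (env_of (map I s)).
  have := Hl len [::] (add0n _) Logic.I; rewrite (_ : env_of _ = fun=> 0%R) //.
  by apply/funext => i; rewrite /env_of nth_nil.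
elim: l s => [|l IH] s; rewrite ?addn0 => Hs cs /=.
  have [m Hm] := look_exists (rev s).
  have E : plays m len = s by rewrite -Hs; apply: consistent_plays => // i Hi; rewrite Hm // size_rev.
  rewrite -E env_of_plays //; apply/(mat_Th Hc).
  have /= /andP[_] := H (npair 0 (npair 0 m)); rewrite !usnd_npair.
  by rewrite (bev_ext (Q := P)) // => t _; apply: order_of_cls.
case: ifP => kd.
  (* Each element of the model is the class of a term, so an arbitrary universal move is one that
     some play makes. *)
  move=> x; rewrite -(cls_val x) -[size s](size_map I) -env_of_cons -map_cons.
  rewrite size_map; apply: (IH (_ :: s)); first by rewrite /= addSnnS.
  by split=> //; rewrite kd.
exists (I (csk (lcode s))); rewrite -[size s](size_map I) -env_of_cons -map_cons.
by rewrite size_map; apply: (IH (_ :: s)); first by rewrite /= addSnnS.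
Qed.

(** Propositional unsatisfiability of the first [C] instances, tested on all assignments to the
    atoms below a common bound. *)
Definition refuted (C : nat) : bool :=
  ~~ bex (2 ^ bsum C (fun j => bsize (inst j)))
      (fun b => ball C (fun j => bev (bit b) (inst j))).

(* Herbrand's theorem, with the completeness of real closed fields. *)
Lemma refutedP (K : rcfType) : sdef Th ->
  (exists C, refuted C) <-> ~ ptrue len 0 (fun=> 0%R : K).
Proof.
move=> HT; split=> [[C /negP HC] /ptrue_order [P HP]|Hn].
  apply: HC; have [b Hb Pb] := bits_exist P (bsum C (fun j => bsize (inst j))).
  apply/bexP; exists b => //; apply/ballP => j Hj; rewrite (bev_ext (Q := P)) // => t Ht.
  by apply: Pb; apply: leq_trans Ht (leq_bsum (fun j => bsize (inst j)) Hj).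
(* If no finite set of instances is inconsistent, compactness yields an order satisfying all of
   them. The statement holds in its term model, and completeness brings it back to [K]. *)
apply: contrapT => Hne; apply: Hn.
have Hb C : exists b, forall j, j < C -> bev (bit b) (inst j).
  have /negPn/bexP[b _ /ballP Hb] : ~~ refuted C by apply/negP => HC; apply: Hne; exists C.
  by exists b.
have [b {}Hb] := choice Hb.
have [P HP] := cluster_point (fun k => bit (b k)).
have Pinst j : bev P (inst j) by apply: (cluster_bev (C := j.+1) HP) => k; apply: Hb.
have HPo : rcf_order P.
  move=> x y z; have /= /andP[+ _] := Pinst (npair (npair x y) (npair z 0)).
  by rewrite !(ufst_npair, usnd_npair).
apply: (sdef_transfer0 (K := tmodel HPo) K (sdef_ptrue len 0 HT)).
exact: ptrue_tmodel.
Qed.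

End Game.

Lemma ptrue_dual (kind : nat -> bool) Th (K : rcfType) l i (e : nat -> K) :
  ptrue (fun i => ~~ kind i) (fun K e => ~ Th K e) l i e <-> ~ ptrue kind Th l i e.
Proof.
elim: l i e => //= l IH i e; case: (kind i) => /=; split.
- by move=> [x /IH Hx] H; apply: Hx.
- move=> H; apply: contrapT => Hn; apply: H => x; apply: contrapT => Hx.
  by apply: Hn; exists x; apply/IH.
- by move=> H [x Hx]; have /IH := H x; apply.
- by move=> H x; apply/IH => Hx; apply: H; exists x.
Qed.

(** * Computability of the search for refutations *)

Section RefutedComputable.
Variables (kind : nat -> nat -> bool) (len : nat -> nat) (mat : nat -> (nat -> nat) -> bexp).
Hypotheses (comp_kind : computable (fun e => kind (e 0) (e 1)))
  (comp_len : computable (fun e => len (e 0)))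
  (comp_bev : forall X : nat -> nat -> nat -> nat, computable (fun e => X (e 0) (e 1) (e 2)) ->
    computable (fun e => bev (bit (e 0)) (mat (e 1) (X (e 1) (e 2)))))
  (comp_bsize : forall X : nat -> nat -> nat -> nat, computable (fun e => X (e 0) (e 1) (e 2)) ->
    computable (fun e => bsize (mat (e 0) (X (e 0) (e 1))))).

Let phist (n m i : nat) : nat :=
  nrec 0 (fun i h => lcons (if kind n i then look m i else csk h) h) i.

Lemma phistE n m i : phist n m i = lcode (plays (kind n) m i).
Proof.
elim: i => // i IH; rewrite playsS /= -IH.
by rewrite /phist [in LHS]/= -/(phist n m i).
Qed.

Lemma comp_playx : computable (fun e => playx (kind (e 0)) (len (e 0)) (e 1) (e 2)).
Proof.
apply: (comp_ext (F := fun e => if e 2 < len (e 0) then lhd (phist (e 0) (e 1) (e 2).+1) else czero)).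
  by move=> e; rewrite /playx; case: ifP => // _; rewrite phistE playsS /= lhd_cons.
apply: comp_if; [by cmp| |by cmp].
apply: comp_lhd; apply: comp_nrec; [by cmp| |by cmp].
apply: comp_lcons; last by cmp.
apply: comp_if; [|by cmp|by cmp].
by apply: (comp2 (g := fun x y => kind x y)); cmp.
Qed.

Lemma comp_rcf_axiom (B : (nat -> nat) -> nat) (X Y Z : (nat -> nat) -> nat) :
  computable B -> computable X -> computable Y -> computable Z ->
  computable (fun e => bev (bit (B e)) (rcf_axiom (X e) (Y e) (Z e))).
Proof. move=> HB HX HY HZ; cbn [rcf_axiom rcf_axioms foldr BImp BIff BEq bev bsize]; cmp. Qed.

Lemma comp_bsize_rcf_axiom (X Y Z : (nat -> nat) -> nat) :
  computable X -> computable Y -> computable Z ->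
  computable (fun e => bsize (rcf_axiom (X e) (Y e) (Z e))).
Proof. move=> HX HY HZ; cbn [rcf_axiom rcf_axioms foldr BImp BIff BEq bev bsize]; cmp. Qed.

Lemma comp_refuted : computable (fun e => refuted (kind (e 0)) (len (e 0)) (mat (e 0)) (e 1)).
Proof.
apply: comp_neg; apply: comp_bex.
  apply: comp_exp; first by cmp.
  apply: comp_bsum; first by cmp.
  apply: comp_add; first by apply: comp_bsize_rcf_axiom; cmp.
  have H := @comp_bsize (fun n m i => playx (kind n) (len n) m i) comp_playx.
  by apply: (comp2 (g := fun n m => bsize (mat n (playx (kind n) (len n) m))) H); cmp.
apply: comp_ball; first by cmp.
apply: comp_and; first by apply: comp_rcf_axiom; cmp.
have H := @comp_bev (fun n m i => playx (kind n) (len n) m i) comp_playx.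
by apply: (comp3 (g := fun b n m => bev (bit b) (mat n (playx (kind n) (len n) m))) H); cmp.
Qed.

End RefutedComputable.

(** Truth is certified by refuting the dual game, falsity by refuting the game itself. *)
Theorem decidable_game (K : rcfType) (kind : nat -> nat -> bool) (len : nat -> nat)
    (mat : nat -> (nat -> nat) -> bexp) (Th : nat -> forall K : rcfType, (nat -> K) -> Prop)
    (S : nat -> Prop) :
  computable (fun e => kind (e 0) (e 1)) -> computable (fun e => len (e 0)) ->
  (forall X : nat -> nat -> nat -> nat, computable (fun e => X (e 0) (e 1) (e 2)) ->
    computable (fun e => bev (bit (e 0)) (mat (e 1) (X (e 1) (e 2))))) ->
  (forall X : nat -> nat -> nat -> nat, computable (fun e => X (e 0) (e 1) (e 2)) ->
    computable (fun e => bsize (mat (e 0) (X (e 0) (e 1))))) ->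
  (forall n (K : rcfType) (I : nat -> K), code_hom I ->
    forall X, bev (order_of I) (mat n X) <-> Th n K (I \o X)) ->
  (forall n, sdef (Th n)) ->
  (forall n, S n <-> ptrue (kind n) (Th n) (len n) 0 (fun=> 0%R : K)) ->
  decidable_set S.
Proof.
move=> Hk Hl Hb Hs HT HsT HS.
pose kind' n i := ~~ kind n i; pose mat' n X := BNot (mat n X).
pose Th' n (K : rcfType) (e : nat -> K) := ~ Th n K e.
have HT' n (F : rcfType) (I : nat -> F) : code_hom I -> forall X, bev (order_of I) (mat' n X) <-> Th' n F (I \o X).
  by move=> HI X; rewrite /Th' -(HT n F I HI) /=; split=> /negP.
apply: (@decidable_of_certificates _ (fun n => refuted (kind' n) (len n) (mat' n))
  (fun n => refuted (kind n) (len n) (mat n))).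
- apply: (@comp_refuted kind' len mat') => //; first exact: comp_neg.
  by move=> X HX; apply: comp_neg; apply: Hb.
- exact: (@comp_refuted kind len mat).
- move=> n; rewrite HS (@refutedP (kind' n) (Th' n) (len n) (mat' n) (HT' n) K); last first.
    exact: sdef_not.
  by rewrite ptrue_dual; split=> [H|/contrapT].
- by move=> n; rewrite HS (@refutedP (kind n) (Th n) (len n) (mat n) (HT n) K).
Qed.

(** * Codes of algebraic numbers, terms and formulas *)

Notation R := Rdefinitions.R.

(** Inverse of [code_Z] with values in an arbitrary ring; the odd codes are those of the negative
    integers. *)
Definition zcoef (K : nzRingType) (n : nat) : K :=
  (if odd n then - (n.+1)./2%:R else n./2%:R)%R.

Definition cpoly (K : nzRingType) (l : nat) : {poly K} := Poly (map (zcoef K) (declist l)).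

Definition decZ (n : nat) : BinNums.Z :=
  if odd n then BinInt.Z.opp (BinInt.Z.of_nat (n.+1)./2) else BinInt.Z.of_nat n./2.

Lemma IZR_decZ n : Rdefinitions.IZR (decZ n) = zcoef R n.
Proof.
have H m : Rdefinitions.IZR (BinInt.Z.of_nat m) = (m%:R : R)%R by rewrite -RIneq.INR_IZR_INZ INRE.
by rewrite /decZ /zcoef; case: ifP => _; rewrite ?RIneq.opp_IZR H.
Qed.

Lemma code_ZK n : code_Z (decZ n) = n.
Proof.
rewrite /decZ; case: ifP => on.
  have : n = ((n.+1)./2.*2).-1 by lia.
  by case: (n.+1)./2 => [|m] -> //=; lia.
have : n = (n./2).*2 by lia.
by case: n./2 => [|m] -> //=; lia.
Qed.

Lemma decZK z : decZ (code_Z z) = z.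
Proof.
case: z => [|p|p] //=; rewrite /decZ.
  have -> : odd (2 * BinPos.Pos.to_nat p)%coq_nat = false by lia.
  have -> : (2 * BinPos.Pos.to_nat p)%coq_nat./2 = BinPos.Pos.to_nat p by lia.
  by rewrite Znat.positive_nat_Z.
have Hp : 0 < BinPos.Pos.to_nat p by lia.
have -> : odd (2 * BinPos.Pos.to_nat p - 1)%coq_nat by lia.
have -> : ((2 * BinPos.Pos.to_nat p - 1)%coq_nat).+1./2 = BinPos.Pos.to_nat p by lia.
by rewrite Znat.positive_nat_Z.
Qed.

Lemma code_Zlist_lcode p : code_Zlist p = lcode (map code_Z p).
Proof. by elim: p => //= z p ->. Qed.

Lemma lcode_declist l : lcode (declist l) = l.
Proof.
elim/ltn_ind: l => -[|l] IH; rewrite declistE //=.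
by rewrite IH ?ltn_ltl // lcons_eta.
Qed.

Lemma Zpoly_evalE p x : Zpoly_eval p x = (cpoly R (code_Zlist p)).[x]%R.
Proof.
rewrite /cpoly code_Zlist_lcode declist_lcode -map_comp.
elim: p => [|z p IH]; first by rewrite /= horner0.
rewrite /= cons_poly_def hornerMXaddC -IH -IZR_decZ decZK.
by rewrite RplusE RmultE addrC mulrC.
Qed.

Lemma Poly_eq0 (K : nzRingType) (s : seq K) : (Poly s == 0)%R = all (fun x => x == 0)%R s.
Proof.
apply/eqP/allP => [H x /(nthP 0%R) [i _ <-]|H]; first by rewrite -coef_Poly H coef0.
apply/polyP => i; rewrite coef_Poly coef0; have [lt|ge] := ltnP i (size s).
  by apply/eqP/H/mem_nth.
by rewrite nth_default.
Qed.

Lemma zcoef_eq0 n : (zcoef R n == 0)%R = (n == 0).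
Proof.
rewrite /zcoef; case: ifP => on; rewrite ?oppr_eq0 pnatr_eq0.
  by case: n on => // n; rewrite /=; case: n./2.
by rewrite -[n in RHS](odd_double_half n) on /= double_eq0.
Qed.

Lemma cpoly_eq0 l : (cpoly R l == 0)%R = all (fun x => x == 0) (declist l).
Proof. by rewrite Poly_eq0 all_map; apply: eq_all => n /=; rewrite zcoef_eq0. Qed.

Lemma In_mem (T : eqType) (x : T) s : List.In x s <-> x \in s.
Proof.
elim: s => //= y s IH; rewrite in_cons IH; split=> [[->|->]|/orP[/eqP->|]]; rewrite ?eqxx ?orbT //;
  by [left|right].
Qed.

Lemma Zpoly_nonzeroE p : Zpoly_nonzero p <-> (cpoly R (code_Zlist p) != 0)%R.
Proof.
rewrite cpoly_eq0 code_Zlist_lcode declist_lcode all_map -has_predC.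
split=> [[c [cp c0]]|].
  elim: p cp => //= z p IH [zc|/IH ->]; last by rewrite orbT.
  by apply/orP; left; move: c0; rewrite -zc; case: (z) => //= *; lia.
elim: p => //= z p IH /orP[z0|/IH [c [cp c0]]]; last by exists c; split=> //; right.
by exists z; split; [left|move=> zE; move: z0; rewrite zE].
Qed.

(* The [j]-th real root of the polynomial coded by [l]; the last root for
   larger [j], and [0] if there is none. *)
Definition aroot (l j : nat) : R := let rs := rootsR (cpoly R l) in nth (last 0%R rs) rs j.

Definition aval (c : nat) : R := aroot (ufst c) (usnd c).

Definition avalid (c : nat) : Prop :=
  (cpoly R (ufst c) != 0)%R /\ usnd c < size (rootsR (cpoly R (ufst c))).

Lemma aroot_mem l j : rootsR (cpoly R l) != [::] -> aroot l j \in rootsR (cpoly R l).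
Proof.
rewrite /aroot; set rs := rootsR _; case: (ltnP j (size rs)) => [jr _|jr].
  exact: mem_nth.
by rewrite nth_default //; case: rs {jr} => //= a s _; apply: mem_last.
Qed.

Lemma root_rootsR (p : {poly R}) x : p != 0%R -> (x \in rootsR p) = root p x.
Proof. by move=> p0; have := roots_on_rootsR p0 x; rewrite inE /= => ->. Qed.

Lemma cpoly_decZ l : cpoly R (code_Zlist (map decZ (declist l))) = cpoly R l.
Proof.
rewrite code_Zlist_lcode -map_comp (eq_map (g := id)) ?map_id ?lcode_declist //.
exact: code_ZK.
Qed.

Lemma is_real_algebraic_root l x : (cpoly R l != 0)%R -> root (cpoly R l) x -> is_real_algebraic x.
Proof.
move=> l0 /eqP rx; exists (map decZ (declist l)).
by rewrite Zpoly_nonzeroE Zpoly_evalE cpoly_decZ.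
Qed.

Lemma aval_algebraic c : is_real_algebraic (aval c).
Proof.
have [E|ne] := eqVneq (rootsR (cpoly R (ufst c))) [::].
  (* Without real roots the value is 0, a root of the polynomial [X]: the codes 0 and 2 stand for
     the coefficients 0 and 1. *)
  rewrite /aval /aroot E nth_nil; apply: (@is_real_algebraic_root (lcode [:: 0; 2])).
    by rewrite cpoly_eq0 declist_lcode.
  by rewrite /cpoly declist_lcode /root /= !cons_poly_def !hornerE /zcoef /= ?mulr0n ?mulr0 ?addr0 ?eqxx.
have p0 : (cpoly R (ufst c) != 0)%R by apply: contraNneq ne => ->; rewrite rootsR0.
by apply: (is_real_algebraic_root p0); rewrite -root_rootsR //; apply: aroot_mem.
Qed.

(** Decoding is total: an invalid code also names an algebraic number, and validity is tested
    separately. *)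
Definition dalg (c : nat) : Alg := exist _ (aval c) (aval_algebraic c).

Lemma lt_sorted_take (s : seq R) k : sorted <%R s -> k < size s ->
  forall x, (x \in take k s) = (x \in s) && (x < nth 0 s k)%R.
Proof.
move=> ss ks x; have [xs|] := boolP (x \in s); last by apply: contraNF => /mem_take.
rewrite -[x in RHS](nth_index 0%R xs) lt_sorted_ltn_nth ?inE ?index_mem //.
by rewrite in_take.
Qed.

(** The list of roots is sorted, so the number of roots smaller than [a] is the index of [a] in
    it. *)
Lemma code_algP c a : code_alg c a <-> avalid c /\ a = dalg c.
Proof.
set rs := rootsR (cpoly R (ufst c)).
have srs : sorted <%R rs by rewrite /rs /rootsR; apply: sorted_roots.
have aE : sval a = aval c <-> a = dalg c.
  by split=> [|->//]; case: a => x Hx /= xE; apply: eq_exist.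
split.
  case=> p [k [cE [/Zpoly_nonzeroE p0 [ra [l [ndl [sl Hl]]]]]]].
  have cp : cpoly R (code_Zlist p) = cpoly R (ufst c) by rewrite cE ufst_npair.
  have ars : sval a \in rs.
    by rewrite /rs -cp root_rootsR // /root; apply/eqP; rewrite -Zpoly_evalE.
  have kE : k = index (sval a) rs.
    have iE : index (sval a) rs < size rs by rewrite index_mem.
    rewrite -sl -[LHS]/(size l) -[RHS](size_takel (ltnW iE)).
    apply/perm_size/uniq_perm.
    - by elim: {sl Hl} l ndl => //= y s IH H; inversion H; rewrite IH // andbT; apply/negP => /In_mem.
    - by apply: take_uniq; apply: lt_sorted_uniq.
    - move=> x; rewrite lt_sorted_take // nth_index //; apply/idP/idP.
        move/In_mem/Hl => [/RltP xa /eqP xr]; rewrite xa andbT /rs -cp root_rootsR //.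
        by rewrite /root -Zpoly_evalE.
      case/andP; rewrite /rs -cp root_rootsR // => /eqP xr xa.
      by apply/In_mem/Hl; split; [apply/RltP|rewrite Zpoly_evalE].
  have kc : usnd c = k by rewrite cE usnd_npair.
  split; first by split; [rewrite -cp|rewrite kc kE index_mem].
  by apply/aE; rewrite /aval /aroot kc kE -/rs nth_index.
move=> [[p0 ks] ->]; exists (map decZ (declist (ufst c))), (usnd c).
rewrite Zpoly_nonzeroE cpoly_decZ; have sE : aval c = nth 0%R rs (usnd c).
  by rewrite /aval /aroot; apply: set_nth_default.
have rE : aval c \in rs by rewrite sE mem_nth.
split.
  rewrite code_Zlist_lcode -map_comp (eq_map (g := id)) ?map_id ?lcode_declist ?npair_unpair //.
  exact: code_ZK.
split=> //; split; first by rewrite Zpoly_evalE cpoly_decZ; apply/eqP; rewrite -[_ == _]/(root _ _) -root_rootsR.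
exists (take (usnd c) rs); split.
  have : uniq (take (usnd c) rs).
    by apply: take_uniq; apply: lt_sorted_uniq.
  elim: (take _ _) => [|y s IH] /=; first by constructor.
  by case/andP=> /negP ys us; constructor; [move/In_mem|apply: IH].
split; first by rewrite length_size size_takel // ltnW.
move=> x; rewrite In_mem lt_sorted_take // -sE /= Zpoly_evalE cpoly_decZ root_rootsR //.
by split=> [/andP[/eqP -> /RltP]|[/RltP -> /eqP]]; [|rewrite andbT].
Qed.

(** * Decoding of terms and open formulas *)

Notation arg1 t := (ufst (usnd t)).
Notation arg2 t := (usnd (usnd t)).

Lemma ltn_arg1 t : 0 < ufst t -> arg1 t < t.
Proof. by move=> H; apply: leq_ltn_trans (leq_ufst _) (ltn_usnd H). Qed.

Lemma ltn_arg2 t : 0 < ufst t -> arg2 t < t.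
Proof. by move=> H; apply: leq_ltn_trans (leq_usnd _) (ltn_usnd H). Qed.

(* Every natural number is read as a term: an ill-formed code is [TZero]. *)
Definition dterm_step (g : nat -> term) (t : nat) : term :=
  match ufst t with
  | 0 => TVar (usnd t)
  | 1 => TZero
  | 2 => TOne
  | 3 => TAdd (g (arg1 t)) (g (arg2 t))
  | 4 => TSub (g (arg1 t)) (g (arg2 t))
  | 5 => TMul (g (arg1 t)) (g (arg2 t))
  | 6 => TDiv (g (arg1 t)) (g (arg2 t))
  | 7 => TScal (dalg (arg1 t)) (g (arg2 t))
  | _ => TZero
  end.

Definition dterm : nat -> term := crec dterm_step TZero.

Lemma dtermE t : dterm t = dterm_step dterm t.
Proof.
rewrite /dterm crecE // => g h n H; rewrite /dterm_step; case E: (ufst n) => [|k] //.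
by rewrite !H // ?ltn_arg1 ?ltn_arg2 ?E.
Qed.

(** The validity [va] of scalar codes is a parameter because it is later expressed through a table
    of roots in an arbitrary real closed field. *)
Definition wft_step (va : nat -> Prop) (k : nat) (g : nat -> Prop) (t : nat) : Prop :=
  match ufst t with
  | 0 => usnd t < k
  | 1 | 2 => usnd t = 0
  | 3 | 4 | 5 | 6 => g (arg1 t) /\ g (arg2 t)
  | 7 => va (arg1 t) /\ g (arg2 t)
  | _ => False
  end.

Lemma wft_step_ext va k g h n : (forall m, m < n -> g m = h m) ->
  wft_step va k g n = wft_step va k h n.
Proof.
move=> H; rewrite /wft_step; case E: (ufst n) => [|j] //.
by rewrite !H // ?ltn_arg1 ?ltn_arg2 ?E.
Qed.

Definition wft (va : nat -> Prop) (k : nat) : nat -> Prop := crec (wft_step va k) False.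

Lemma wftE va k t : wft va k t = wft_step va k (wft va k) t.
Proof. by rewrite /wft crecE //; apply: wft_step_ext. Qed.

Lemma code_term_dterm k t : wft avalid k t -> code_term (dterm t) t /\ term_closed k (dterm t).
Proof.
elim/ltn_ind: t => t IH; rewrite wftE dtermE /wft_step /dterm_step.
have := ltn_arg1 (t := t); have := ltn_arg2 (t := t).
have := npair_unpair t; have := npair_unpair (usnd t).
case: (ufst t) => [|j] E2 E1 H2 H1; first by move=> H; split=> //=; apply/ssrnat.ltP.
have {}H1 := H1 isT; have {}H2 := H2 isT.
have IH2 : wft avalid k (arg1 t) /\ wft avalid k (arg2 t) -> (exists m j, usnd t = npair m j /\
    code_term (dterm (arg1 t)) m /\ code_term (dterm (arg2 t)) j) /\
    term_closed k (dterm (arg1 t)) /\ term_closed k (dterm (arg2 t)).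
  by case=> /(IH _ H1) [? ?] /(IH _ H2) [? ?]; split=> //; exists (arg1 t), (arg2 t).
move: E1; do 6?[case: j => [|j]] => E1 /=.
- by move=> u0; rewrite -E1 u0.
- by move=> u0; rewrite -E1 u0.
- by case/IH2 => [[m [l [E H]]] Hc]; split=> //; exists m, l; rewrite -E.
- by case/IH2 => [[m [l [E H]]] Hc]; split=> //; exists m, l; rewrite -E.
- by case/IH2 => [[m [l [E H]]] Hc]; split=> //; exists m, l; rewrite -E.
- by case/IH2 => [[m [l [E H]]] Hc]; split=> //; exists m, l; rewrite -E.
case: j E1 => [|j] E1 // [va /(IH _ H2) [? ?]]; split=> //.
exists (arg1 t), (arg2 t); split; first by rewrite E2.
by split=> //; apply/code_algP.
Qed.

Lemma code_term_wft k s t : code_term s t -> term_closed k s -> wft avalid k t /\ s = dterm t.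
Proof.
elim: s t => [i|||s1 IH1 s2 IH2|s1 IH1 s2 IH2|s1 IH1 s2 IH2|s1 IH1 s2 IH2|a s IH] t /=.
- move=> -> /ssrnat.ltP ik; rewrite wftE dtermE /wft_step /dterm_step.
  by rewrite !ufst_npair !usnd_npair.
- by move=> -> _; rewrite wftE dtermE /wft_step /dterm_step !ufst_npair !usnd_npair.
- by move=> -> _; rewrite wftE dtermE /wft_step /dterm_step !ufst_npair !usnd_npair.
- move=> [m [j [-> [/IH1 {}IH1 /IH2 {}IH2]]]] [/IH1 [? ->] /IH2 [? ->]].
  by rewrite wftE [in RHS]dtermE /wft_step /dterm_step !(ufst_npair, usnd_npair).
- move=> [m [j [-> [/IH1 {}IH1 /IH2 {}IH2]]]] [/IH1 [? ->] /IH2 [? ->]].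
  by rewrite wftE [in RHS]dtermE /wft_step /dterm_step !(ufst_npair, usnd_npair).
- move=> [m [j [-> [/IH1 {}IH1 /IH2 {}IH2]]]] [/IH1 [? ->] /IH2 [? ->]].
  by rewrite wftE [in RHS]dtermE /wft_step /dterm_step !(ufst_npair, usnd_npair).
- move=> [m [j [-> [/IH1 {}IH1 /IH2 {}IH2]]]] [/IH1 [? ->] /IH2 [? ->]].
  by rewrite wftE [in RHS]dtermE /wft_step /dterm_step !(ufst_npair, usnd_npair).
- move=> [m [j [-> [/code_algP [? ->] /IH {}IH]]]] /IH [? ->].
  by rewrite wftE [in RHS]dtermE /wft_step /dterm_step !(ufst_npair, usnd_npair).
Qed.

Definition dform_step (g : nat -> formula) (t : nat) : formula :=
  match ufst t with
  | 0 => FFalse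
  | 1 => FEq (dterm (arg1 t)) (dterm (arg2 t))
  | 2 => FLt (dterm (arg1 t)) (dterm (arg2 t))
  | 3 => FNot (g (usnd t))
  | 4 => FAnd (g (arg1 t)) (g (arg2 t))
  | 5 => FOr (g (arg1 t)) (g (arg2 t))
  | 6 => FImp (g (arg1 t)) (g (arg2 t))
  | _ => FFalse
  end.

Definition dform : nat -> formula := crec dform_step FFalse.

Lemma dformE t : dform t = dform_step dform t.
Proof.
rewrite /dform crecE // => g h n H; rewrite /dform_step; case E: (ufst n) => [|k] //.
by rewrite !H // ?ltn_usnd ?ltn_arg1 ?ltn_arg2 ?E.
Qed.

Definition wff_step (va : nat -> Prop) (k : nat) (g : nat -> Prop) (t : nat) : Prop :=
  match ufst t with
  | 0 => usnd t = 0
  | 1 | 2 => wft va k (arg1 t) /\ wft va k (arg2 t)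
  | 3 => g (usnd t)
  | 4 | 5 | 6 => g (arg1 t) /\ g (arg2 t)
  | _ => False
  end.

Lemma wff_step_ext va k g h n : (forall m, m < n -> g m = h m) ->
  wff_step va k g n = wff_step va k h n.
Proof.
move=> H; rewrite /wff_step; case E: (ufst n) => [|j] //.
by rewrite !H // ?ltn_usnd ?ltn_arg1 ?ltn_arg2 ?E.
Qed.

Definition wff (va : nat -> Prop) (k : nat) : nat -> Prop := crec (wff_step va k) False.

Lemma wffE va k t : wff va k t = wff_step va k (wff va k) t.
Proof. by rewrite /wff crecE //; apply: wff_step_ext. Qed.

Lemma code_form_dform k t : wff avalid k t ->
  code_form (dform t) t /\ qfree (dform t) /\ form_closed k (dform t).
Proof.
elim/ltn_ind: t => t IH; rewrite wffE dformE /wff_step /dform_step.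
have := ltn_arg1 (t := t); have := ltn_arg2 (t := t); have := ltn_usnd (n := t).
have := npair_unpair t; have := npair_unpair (usnd t).
case: (ufst t) => [|j] E2 E1 H0 H2 H1; first by move=> u0; rewrite -E1 u0.
have {}H1 := H1 isT; have {}H2 := H2 isT; have {}H0 := H0 isT.
have IH2 : wff avalid k (arg1 t) /\ wff avalid k (arg2 t) -> (exists m j, usnd t = npair m j /\
    code_form (dform (arg1 t)) m /\ code_form (dform (arg2 t)) j) /\
    (qfree (dform (arg1 t)) /\ qfree (dform (arg2 t))) /\
    form_closed k (dform (arg1 t)) /\ form_closed k (dform (arg2 t)).
  by case=> /(IH _ H1) [? [? ?]] /(IH _ H2) [? [? ?]]; split=> //; exists (arg1 t), (arg2 t).
have IHt : wft avalid k (arg1 t) /\ wft avalid k (arg2 t) -> (exists m j, usnd t = npair m j /\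
    code_term (dterm (arg1 t)) m /\ code_term (dterm (arg2 t)) j) /\
    term_closed k (dterm (arg1 t)) /\ term_closed k (dterm (arg2 t)).
  by case=> /code_term_dterm [? ?] /code_term_dterm [? ?]; split=> //; exists (arg1 t), (arg2 t).
move: E1; do 6?[case: j => [|j]] => E1 //=.
- by case/IHt => [[m [l [E H]]] Hc]; split=> //; exists m, l; rewrite -E.
- by case/IHt => [[m [l [E H]]] Hc]; split=> //; exists m, l; rewrite -E.
- by case/(IH _ H0) => H [? ?]; split=> //; exists (usnd t).
- by case/IH2 => [[m [l [E H]]] Hc]; split=> //; exists m, l; rewrite -E.
- by case/IH2 => [[m [l [E H]]] Hc]; split=> //; exists m, l; rewrite -E.
- by case/IH2 => [[m [l [E H]]] Hc]; split=> //; exists m, l; rewrite -E.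
Qed.

Lemma code_form_wff k p t : code_form p t -> qfree p -> form_closed k p ->
  wff avalid k t /\ p = dform t.
Proof.
elim: p t => [|s1 s2|s1 s2|p IH|p IH1 q IH2|p IH1 q IH2|p IH1 q IH2|p|p] t //=.
- by move=> -> _ _; rewrite wffE dformE /wff_step /dform_step ufst_npair usnd_npair.
- move=> [m [j [-> [H1 H2]]]] _ [/(code_term_wft H1) [? ->] /(code_term_wft H2) [? ->]].
  by rewrite wffE dformE /wff_step /dform_step !(ufst_npair, usnd_npair).
- move=> [m [j [-> [H1 H2]]]] _ [/(code_term_wft H1) [? ->] /(code_term_wft H2) [? ->]].
  by rewrite wffE dformE /wff_step /dform_step !(ufst_npair, usnd_npair).
- move=> [m [-> /IH {}IH]] /IH {}IH /IH [? ->].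
  by rewrite wffE [in RHS]dformE /wff_step /dform_step !(ufst_npair, usnd_npair).
- move=> [m [j [-> [/IH1 {}IH1 /IH2 {}IH2]]]] [/IH1 {}IH1 /IH2 {}IH2] [/IH1 [? ->] /IH2 [? ->]].
  by rewrite wffE [in RHS]dformE /wff_step /dform_step !(ufst_npair, usnd_npair).
- move=> [m [j [-> [/IH1 {}IH1 /IH2 {}IH2]]]] [/IH1 {}IH1 /IH2 {}IH2] [/IH1 [? ->] /IH2 [? ->]].
  by rewrite wffE [in RHS]dformE /wff_step /dform_step !(ufst_npair, usnd_npair).
- move=> [m [j [-> [/IH1 {}IH1 /IH2 {}IH2]]]] [/IH1 {}IH1 /IH2 {}IH2] [/IH1 [? ->] /IH2 [? ->]].
  by rewrite wffE [in RHS]dformE /wff_step /dform_step !(ufst_npair, usnd_npair).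
Qed.

(** * The leading universal quantifiers *)

Definition strip (n j : nat) : nat := nrec n (fun _ m => usnd m) j.
(** [n] rounds suffice for the count, since each stripped quantifier lowers the code. *)
Definition alls (n : nat) : nat := nrec 0 (fun _ z => if ufst (strip n z) == 7 then z.+1 else z) n.
Definition core (n : nat) : nat := strip n (alls n).

Lemma stripS n j : strip n j.+1 = strip (usnd n) j.
Proof.
have E m i : strip m i.+1 = usnd (strip m i) by [].
by elim: j => // j IH; rewrite E IH.
Qed.

Lemma strip_iter p n k : code_form (iter k FAll p) n ->
  (forall j, j < k -> ufst (strip n j) = 7) /\ code_form p (strip n k) /\ k <= n.
Proof.
elim: k n => [|k IH] n //= [m [-> /IH [H1 [H2 H3]]]]; split.
  by case=> [|j] Hj; rewrite ?stripS ?usnd_npair; [apply: ufst_npair|apply: H1].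
rewrite stripS usnd_npair; split=> //; apply: leq_ltn_trans H3 _.
by rewrite -[X in X < _](usnd_npair 7 m) ltn_usnd // ufst_npair.
Qed.

Lemma iter_strip p n k : (forall j, j < k -> ufst (strip n j) = 7) ->
  code_form p (strip n k) -> code_form (iter k FAll p) n.
Proof.
elim: k n => [|k IH] n //= H Hp; exists (usnd n); split.
  by rewrite -{1}(H 0 isT) npair_unpair.
by apply: IH => [j Hj|]; rewrite -stripS //; apply: H.
Qed.

Lemma alls_strip n j : j < alls n -> ufst (strip n j) = 7.
Proof.
rewrite /alls; set f := (X in nrec _ X _); suff H m i : i < nrec 0 f m -> ufst (strip n i) = 7 by apply: H.
rewrite /f; elim: m i => //= m IH i; case: eqP => [E|_]; last exact: IH.
by rewrite ltnS leq_eqVlt => /orP[/eqP->|/IH].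
Qed.

Lemma alls_eq n k : k <= n -> (forall j, j < k -> ufst (strip n j) = 7) ->
  ufst (strip n k) != 7 -> alls n = k.
Proof.
move=> kn H /negbTE Hk; rewrite /alls.
suff E m : nrec 0 (fun _ z => if ufst (strip n z) == 7 then z.+1 else z) m = minn k m.
  by rewrite E; apply/minn_idPl.
elim: m => [|m IH] /=; first by rewrite minn0.
rewrite IH; case: (ltnP m k) => mk; first by rewrite !(minn_idPr _) ?H // ltnW.
by rewrite !(minn_idPl _) ?Hk // leqW.
Qed.

(** Truth in a structure ranges over all environments, so it absorbs a leading universal
    quantifier. *)
Lemma true_in_FAll M p : true_in M (FAll p) <-> true_in M p.
Proof.
split=> H e; last by move=> x; apply: H.
have := H (fun i => e i.+1) (e 0); congr sat; apply/funext; by case.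
Qed.

Lemma universal_iter p : universal p -> exists k q, p = iter k FAll q /\ qfree q.
Proof.
elim=> [q Hq|q _ [k [q' [-> Hq]]]]; first by exists 0, q.
by exists k.+1, q'.
Qed.

Lemma form_closed_iter k m q : form_closed m (iter k FAll q) <-> form_closed (k + m) q.
Proof. by elim: k m => //= k IH m; rewrite IH addSnnS. Qed.

Lemma universal_fragmentE n : universal_fragment_T_A n <->
  wff avalid (alls n) (core n) /\ forall M, model_of_T_A M -> true_in M (dform (core n)).
Proof.
have PE k q : provable_T_A (iter k FAll q) <-> forall M, model_of_T_A M -> true_in M q.
  have E M : true_in M (iter k FAll q) <-> true_in M q.
    by elim: k => //= k IH; rewrite true_in_FAll.
  by split=> H M HM; apply/E; apply: H.
split=> [[p [Hc [Hs [Hu Hp]]]]|[Hw Hp]].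
  have [k [q [pE Hq]]] := universal_iter Hu; rewrite {}pE in Hc Hs Hp.
  have [H7 [Hcq kn]] := strip_iter Hc.
  have {}Hs : form_closed k q by move/form_closed_iter: Hs; rewrite addn0.
  have [Hw qE] := code_form_wff Hcq Hq Hs.
  (* A well-formed core does not begin with a quantifier tag, so the count stops exactly at [k]. *)
  have kE : alls n = k.
    apply: alls_eq => //; apply/eqP => E7.
    by move: Hw; rewrite wffE /wff_step E7.
  by rewrite /core kE; split=> //; rewrite -qE; apply/(PE k).
have [Hc [Hq Hcl]] := code_form_dform Hw.
exists (iter (alls n) FAll (dform (core n))); split.
  by apply: iter_strip => // j; apply: alls_strip.
split; first by apply/form_closed_iter; rewrite addn0.
split; last exact/PE.
by elim: (alls n) => [|k IH]; [apply: univ_qf|apply: univ_all].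
Qed.

(** * Extension of partial automorphisms *)

Section BackAndForth.
Local Open Scope ring_scope.
Variables (K : rcfType) (G : K -> Prop) (iota : K).
(** [G] stands for the positive algebraic scalars inside a field with infinitesimals. By [G_fin] and
    [G_sep] they are neither infinite nor infinitely close to 1 without being 1, while [iota] is
    infinitesimal. *)
Hypotheses (G_gt0 : forall g, G g -> 0 < g)
  (G_mul : forall g h, G g -> G h -> G (g * h))
  (G_inv : forall g, G g -> G g^-1)
  (G_rat : forall m n : nat, G (m.+1%:R / n.+1%:R))
  (G_fin : forall g, G g -> exists n : nat, g < n%:R)
  (G_sep : forall g, G g -> 1 < g -> exists n : nat, 1 + n.+1%:R^-1 < g)
  (iota_gt0 : 0 < iota) (iota_lt : forall n : nat, iota * n%:R < 1).

Lemma G_one : G 1.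
Proof. by have := G_rat 0 0; rewrite divr1. Qed.

Lemma iota_ltG g : G g -> iota < g.
Proof.
move=> Gg; have [n Hn] := G_fin (G_inv Gg); have g0 := G_gt0 Gg.
have : iota * g^-1 < 1 by apply: le_lt_trans (iota_lt n); rewrite ler_pM2l // ltW.
by rewrite ltr_pdivrMr // mul1r.
Qed.

Lemma finite_max (T : eqType) (s : seq T) (W : T -> K -> Prop) :
  (forall r a b, r \in s -> W r a -> W r b -> a = b) ->
  (exists2 r, r \in s & exists a, W r a) ->
  exists2 r, r \in s & exists2 a, W r a & forall r' b, r' \in s -> W r' b -> b <= a.
Proof.
elim: s => [|r s IH] Hu [r0]; first by [].
case: (pselect (exists2 r, r \in s & exists a, W r a)) => [Hex _ _|Hn].
  have [|r1 r1s [a Wa Ha]] := IH _ Hex.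
    by move=> r' a b r's; apply: Hu; rewrite in_cons r's orbT.
  case: (pselect (exists2 b, W r b & a < b)) => [[b Wb ab]|Hb].
    exists r; first exact: mem_head.
    exists b => // r' c; rewrite in_cons => /orP[/eqP -> Wc|r's Wc].
      by rewrite (Hu _ _ _ (mem_head _ _) Wb Wc).
    exact: le_trans (Ha _ _ r's Wc) (ltW ab).
  exists r1; first by rewrite in_cons r1s orbT.
  exists a => // r' c; rewrite in_cons => /orP[/eqP -> Wc|r's Wc]; last exact: Ha Wc.
  by rewrite leNgt; apply/negP => ac; apply: Hb; exists c.
rewrite in_cons => /orP[/eqP ->|r0s] [a Wa]; last by case: Hn; exists r0 => //; exists a.
exists r; first exact: mem_head.
exists a => // r' c; rewrite in_cons => /orP[/eqP -> Wc|r's Wc].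
  by rewrite (Hu _ _ _ (mem_head _ _) Wa Wc).
by case: Hn; exists r' => //; exists c.
Qed.

Definition between (p y : K) : Prop := exists g g', [/\ G g, G g', g * p < y & y < g' * p].

(** Division by [p] reduces this to finding a rational number in an interval: [y / p] is neither
    infinite nor infinitesimal, and the interval below it has a relative length bounded from
    below. *)
Lemma G_dense p d y (n : nat) : 0 < p -> 0 < d -> between p y -> d * (1 + n.+1%:R^-1) < y ->
  exists2 g, G g & d < g * p < y.
Proof.
move=> p0 d0 [g [g' [Gg Gg' gy yg']]] dy.
pose u := y / p; pose c := d / p.
have c0 : 0 < c by apply: divr_gt0.
have cu : c * (1 + n.+1%:R^-1) < u by rewrite /c /u mulrAC ltr_pM2r ?invr_gt0.
have gu : g < u by rewrite /u ltr_pdivlMr.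
have [N HN] := G_fin Gg'.
have uN : u < N%:R by apply: lt_trans HN; rewrite /u ltr_pdivrMr.
have [M HM] := G_fin (G_inv Gg).
have g0 := G_gt0 Gg.
have M0 : 0 < M%:R :> K by apply: lt_trans HM; rewrite invr_gt0.
have uM : M%:R^-1 < u by apply: lt_trans gu; rewrite invf_plt ?posrE.
(* the gap between c and u is at least u / (n + 2) *)
pose D := (M * n.+2)%N.
have D0 : 0 < D%:R :> K by rewrite natrM mulr_gt0.
have gap : c + D%:R^-1 < u.
  have n1 : (0 : K) < n.+1%:R by rewrite ltr0n.
  have n2 : (0 : K) < n.+2%:R by rewrite ltr0n.
  have cE : c < u * (n.+1%:R / n.+2%:R).
    rewrite mulrA ltr_pdivlMr // -ltr_pdivrMr // -mulrA.
    suff -> : n.+2%:R / n.+1%:R = 1 + n.+1%:R^-1 :> K by [].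
    by rewrite -[n.+2%:R]natr1 mulrDl divff ?lt0r_neq0 // div1r.
  have DE : D%:R^-1 < u * n.+2%:R^-1.
    by rewrite natrM invfM ltr_pM2r ?invr_gt0.
  apply: lt_le_trans (ltrD cE DE) _.
  have -> : u * (n.+1%:R / n.+2%:R) + u * n.+2%:R^-1 = u * ((n.+1%:R + 1) / n.+2%:R).
    by ring.
  by rewrite natr1 divff ?mulr1 // lt0r_neq0.
(* The least [m] with [u <= (m + 1) / D] puts [m / D] below [u], and above [c] because the gap
   exceeds [1 / D]. It is positive, so that [m / D] belongs to [G]. *)
have ex : exists m, u <= m.+1%:R / D%:R.
  exists (N * D)%N; rewrite ler_pdivlMr // (le_trans (ltW (_ : u * D%:R < (N * D)%:R))) //.
    by rewrite natrM ltr_pM2r.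
  by rewrite ler_nat.
case: (ex_minnP ex) => m Hm min.
have m0 : (0 < m)%N.
  case: m Hm {min} => // Hm; have := lt_le_trans gap Hm.
  by rewrite div1r gtrDr ltNge ltW.
case: m m0 Hm min => // m _ Hm min.
have Gm : G (m.+1%:R / D%:R).
  by rewrite -[D]prednK ?G_rat // -(ltr0n K).
have H1 : m.+1%:R / D%:R < u.
  by rewrite ltNge; apply/negP => /min; rewrite ltnn.
have H2 : c < m.+1%:R / D%:R.
  rewrite -(ltrD2r D%:R^-1); apply: lt_le_trans gap _; apply: le_trans Hm _.
  by rewrite -[X in _ <= _ + X]mul1r -mulrDl natr1.
exists (m.+1%:R / D%:R) => //.
by rewrite -ltr_pdivrMr // H2 -ltr_pdivlMr.
Qed.

Definition has_greatest (xs : seq K) (y : K) : Prop :=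
  exists2 x0, x0 \in xs & exists g0, [/\ G g0, g0 * x0 < y &
    forall x g, x \in xs -> G g -> g * x < y -> g * x <= g0 * x0].

(* If no multiple of [p] lay between [h * q] and [y], each orbit would have at
   most one point there, and the largest of these would be greatest below [y]. *)
Lemma fill_below xs y p q h : {in xs, forall x, 0 < x} -> ~ has_greatest xs y ->
  0 < p -> between p y -> q \in xs -> G h -> h * q < y ->
  exists2 g, G g & h * q < g * p < y.
Proof.
move=> xs0 Hno p0 bp qs Gh hqy; apply: contrapT => Hn; apply: Hno.
pose W (x d : K) := exists g, [/\ G g, d = g * x, h * q <= d & d < y].
have q0 := xs0 _ qs; have h0 := G_gt0 Gh; have hq0 : 0 < h * q by rewrite mulr_gt0.
have Hu x g g' : x \in xs -> G g -> G g' -> h * q <= g * x -> g' * x < y -> ~ g < g'.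
  move=> xs' Gg Gg' Hd Hd' gg'; apply: Hn; have g0 := G_gt0 Gg.
  have [|n Hn] := G_sep (G_mul Gg' (G_inv Gg)); first by rewrite ltr_pdivlMr // mul1r.
  apply: (G_dense (n := n)) => //; apply: lt_trans Hd'.
  apply: le_lt_trans (_ : g * x * (1 + n.+1%:R^-1) < _).
    by rewrite ler_pM2r // addr_gt0 // invr_gt0 ltr0n.
  by rewrite mulrAC ltr_pM2r ?xs0 // mulrC -ltr_pdivlMr.
have [||x0 x0s [_ [g0 [Gg0 -> hg0 g0y]] Hmax]] := @finite_max _ xs W.
- move=> x _ _ xs' [g [Gg -> H1 H2]] [g' [Gg' -> H3 H4]]; congr (_ * _).
  case: (ltgtP g g') => // /Hu; [move/(_ x xs' Gg Gg' H1 H4)|move/(_ x xs' Gg' Gg H3 H2)] => //.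
- by exists q => //; exists (h * q), h.
exists x0 => //; exists g0; split=> // x g xs' Gg gy.
case: (leP (h * q) (g * x)) => Hq; last exact: le_trans (ltW Hq) hg0.
by apply: (Hmax x) => //; exists g.
Qed.

Definition has_least (xs : seq K) (y : K) : Prop :=
  exists2 x0, x0 \in xs & exists g0, [/\ G g0, y < g0 * x0 &
    forall x g, x \in xs -> G g -> y < g * x -> g0 * x0 <= g * x].

(** Inversion reverses the order and sends orbits of [G] to orbits, so this is [fill_below] for the
    cut of [y^-1]. *)
Lemma fill_above xs y p q h : {in xs, forall x, 0 < x} -> 0 < y -> ~ has_least xs y ->
  0 < p -> between p y -> q \in xs -> G h -> y < h * q ->
  exists2 g, G g & y < g * p < h * q.
Proof.
move=> xs0 y0 Hno p0 [g1 [g2 [Gg1 Gg2 H1 H2]]] qs Gh hqy.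
have q0 := xs0 _ qs; have h0 := G_gt0 Gh; have hq0 : 0 < h * q by rewrite mulr_gt0.
have Hinv x g : 0 < x -> G g -> (g^-1 * x^-1 < y^-1) = (y < g * x).
  by move=> x0 /G_gt0 gg; rewrite -invfM ltf_pV2 // posrE ?mulr_gt0.
have Hinv' x g : 0 < x -> G g -> (y^-1 < g^-1 * x^-1) = (g * x < y).
  by move=> x0 /G_gt0 gg; rewrite -invfM ltf_pV2 // posrE ?mulr_gt0.
have := @fill_below (map (@GRing.inv K) xs) y^-1 p^-1 q^-1 h^-1; case.
- by move=> _ /mapP[x xs' ->]; rewrite invr_gt0 xs0.
- move=> [_ /mapP[x0 x0s ->] [g0 [Gg0 g0y Hmax]]]; apply: Hno.
  have x00 := xs0 _ x0s; have g00 := G_gt0 Gg0.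
  exists x0 => //; exists g0^-1; split; first exact: G_inv.
    by rewrite -Hinv ?invrK //; apply: G_inv.
  move=> x g xs' Gg gy; have x0' := xs0 _ xs'; have gg := G_gt0 Gg.
  have := Hmax x^-1 g^-1 (map_f _ xs') (G_inv Gg); rewrite Hinv // => /(_ gy).
  have -> : g0^-1 * x0 = (g0 * x0^-1)^-1 by rewrite invfM invrK.
  have -> : g * x = (g^-1 * x^-1)^-1 by rewrite invfM !invrK.
  by rewrite lef_pV2 // posrE mulr_gt0 ?invr_gt0.
- by rewrite invr_gt0.
- by exists g2^-1, g1^-1; split; rewrite ?Hinv ?Hinv' //; apply: G_inv.
- exact: map_f.
- exact: G_inv.
- by rewrite Hinv.
move=> g Gg /andP[Ha Hb]; have gg := G_gt0 Gg; exists g^-1; first exact: G_inv.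
apply/andP; split; first by rewrite -Hinv ?invrK //; apply: G_inv.
have -> : h * q = (h^-1 * q^-1)^-1 by rewrite invfM !invrK.
have -> : g^-1 * p = (g * p^-1)^-1 by rewrite invfM invrK.
by rewrite ltf_pV2 // posrE mulr_gt0 ?invr_gt0.
Qed.

(** A finite partial isomorphism: the signs determine the order on the union of all orbits of [G],
    not only on the listed points. *)
Definition good (l : seq (K * K)) : Prop :=
  (forall p, p \in l -> 0 < p.1 /\ 0 < p.2) /\
  (forall p q g, p \in l -> q \in l -> G g -> Num.sg (p.1 - g * q.1) = Num.sg (p.2 - g * q.2)).

Lemma good_mono l p q g h : good l -> p \in l -> q \in l -> G g -> G h ->
  (g * p.1 < h * q.1) = (g * p.2 < h * q.2).
Proof.
move=> [_ H] pl ql Gg Gh; have g0 := G_gt0 Gg.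
have E (a b : K) : (g * a < h * b) = (Num.sg (a - (g^-1 * h) * b) == -1).
  by rewrite sgr_cp0 subr_lt0 -mulrA -[in RHS](ltr_pM2l g0) mulVKf ?lt0r_neq0.
by rewrite !E H //; apply: G_mul => //; apply: G_inv.
Qed.

Lemma good_eq l p q g h : good l -> p \in l -> q \in l -> G g -> G h ->
  g * p.1 = h * q.1 -> g * p.2 = h * q.2.
Proof.
move=> Hl pl ql Gg Gh E.
have := good_mono Hl pl ql Gg Gh; have := good_mono Hl ql pl Gh Gg.
by rewrite E ltxx => H1 H2; case: ltgtP H1 H2.
Qed.

Lemma good_cons l y t : good l -> 0 < y -> 0 < t ->
  (forall p g, p \in l -> G g -> g * p.1 < y -> g * p.2 < t) ->
  (forall p g, p \in l -> G g -> y < g * p.1 -> t < g * p.2) ->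
  (forall p g, p \in l -> G g -> y = g * p.1 -> t = g * p.2) -> good ((y, t) :: l).
Proof.
move=> [H0 H1] y0 t0 HL HU HE; split=> [p|].
  by rewrite in_cons => /orP[/eqP ->|/H0].
have Hyp q g : q \in l -> G g -> Num.sg (y - g * q.1) = Num.sg (t - g * q.2).
  move=> ql Gg; case: (ltgtP y (g * q.1)) => Hc.
  - by rewrite !ltr0_sg ?subr_lt0 //; apply: HU.
  - by rewrite !gtr0_sg ?subr_gt0 //; apply: HL.
  - by rewrite -(HE _ _ ql Gg Hc) -Hc !subrr.
move=> p q g; rewrite !in_cons => /orP[/eqP ->|pl] /orP[/eqP ->|ql] Gg /=.
- by rewrite -{1}[y]mul1r -{1}[t]mul1r -!mulrBl !sgrM !(gtr0_sg y0) !(gtr0_sg t0).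
- exact: Hyp.
- have g0 := G_gt0 Gg; have := Hyp p g^-1 pl (G_inv Gg).
  have E (a b : K) : a - g * b = - (g * (b - g^-1 * a)).
    by rewrite mulrBr mulVKf ?lt0r_neq0 // opprB.
  by rewrite !E !sgrN !sgrM => ->.
- exact: H1.
Qed.

Lemma seq_min (s : seq (K * K)) : s != [::] ->
  exists2 p, p \in s & forall q, q \in s -> p.1 <= q.1.
Proof.
elim: s => // p s IH _; case: (eqVneq s [::]) => [->|/IH [q qs Hq]].
  by exists p => [|q]; rewrite ?mem_head // inE => /eqP ->.
case: (leP p.1 q.1) => pq; [exists p|exists q]; rewrite ?mem_head ?in_cons ?qs ?orbT // => r.
  by rewrite in_cons => /orP[/eqP ->//|/Hq]; apply: le_trans.
by rewrite in_cons => /orP[/eqP ->|/Hq //]; apply: ltW.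
Qed.

Lemma seq_max (s : seq (K * K)) : s != [::] ->
  exists2 p, p \in s & forall q, q \in s -> q.1 <= p.1.
Proof.
elim: s => // p s IH _; case: (eqVneq s [::]) => [->|/IH [q qs Hq]].
  by exists p => [|q]; rewrite ?mem_head // inE => /eqP ->.
case: (leP q.1 p.1) => pq; [exists p|exists q]; rewrite ?mem_head ?in_cons ?qs ?orbT // => r.
  by rewrite in_cons => /orP[/eqP ->//|/Hq H]; apply: le_trans pq.
by rewrite in_cons => /orP[/eqP ->|/Hq //]; apply: ltW.
Qed.

(** The element [t] has to fill, among the orbits of the images, the cut that [y] fills among the
    orbits of [l]. If some orbit has points on both sides of [y], then either [y] has nearest orbit
    points on both sides, or a single orbit determines the cut and its scaling factor can be applied
    to [y]. Otherwise all orbits are infinitely far from [y]. A point of an orbit has a forced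
    image. *)
Lemma good_extend l y : good l -> l != [::] -> 0 < y -> exists t, good ((y, t) :: l).
Proof.
move=> Hl l0 y0; have [Hpos _] := Hl.
have mono p q g h := @good_mono l p q g h Hl.
have mono1 p q : p \in l -> q \in l -> p.1 <= q.1 -> p.2 <= q.2.
  move=> pl ql; rewrite !leNgt; have := mono q p 1 1 ql pl G_one G_one.
  by rewrite !mul1r => ->.
case: (pselect (exists2 p, p \in l & exists2 g, G g & y = g * p.1)).
  move=> [p pl [g Gg yE]]; exists (g * p.2); have [p1 p2] := Hpos p pl.
  apply: good_cons => //; first by rewrite mulr_gt0 ?(G_gt0 Gg).
  - by move=> q h ql Gh; rewrite yE mono.
  - by move=> q h ql Gh; rewrite yE mono.
  - by move=> q h ql Gh; rewrite yE; apply: (good_eq Hl).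
move=> Hneq.
have HE (t : K) p g : p \in l -> G g -> y = g * p.1 -> t = g * p.2.
  by move=> pl Gg yE; case: Hneq; exists p => //; exists g.
have lo_hi p g : p \in l -> G g -> ~ g * p.1 < y -> y < g * p.1.
  move=> pl Gg /negP; rewrite -leNgt le_eqVlt => /orP[/eqP E|//].
  by case: Hneq; exists p => //; exists g.
pose xs := map fst l.
have xs0 : {in xs, forall x, 0 < x} by move=> _ /mapP[p /Hpos[? _] ->].
(* y is transported along the orbit of p when both sides of y are filled by it *)
have transport p : p \in l ->
    (forall q h, q \in l -> G h -> h * q.1 < y -> exists2 g, G g & h * q.1 <= g * p.1 < y) ->
    (forall q h, q \in l -> G h -> y < h * q.1 -> exists2 g, G g & y < g * p.1 <= h * q.1) ->
    exists t, good ((y, t) :: l).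
  move=> pl HL HU; have [p1 p2] := Hpos p pl.
  pose c := p.2 / p.1; have c0 : 0 < c by rewrite divr_gt0.
  have cE g : g * p.2 = c * (g * p.1).
    by rewrite mulrCA /c divfK ?lt0r_neq0.
  exists (c * y); apply: good_cons => //; first by rewrite mulr_gt0.
  - move=> q h ql Gh hy; have [g Gg /andP[H1 H2]] := HL q h ql Gh hy.
    have : h * q.2 <= g * p.2 by rewrite leNgt -mono // -leNgt.
    by move=> H; apply: le_lt_trans H _; rewrite cE ltr_pM2l.
  - move=> q h ql Gh hy; have [g Gg /andP[H1 H2]] := HU q h ql Gh hy.
    have : g * p.2 <= h * q.2 by rewrite leNgt -mono // -leNgt.
    by apply: lt_le_trans; rewrite cE ltr_pM2l.
  - by move=> q h; apply: HE.
have G2 : G 2 by have := G_rat 1 0; rewrite divr1.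
case: (pselect (exists2 p, p \in l & between p.1 y)) => [[p pl bp]|Hnb].
  have fillL p' : p' \in l -> between p'.1 y -> ~ has_greatest xs y ->
      forall q h, q \in l -> G h -> h * q.1 < y -> exists2 g, G g & h * q.1 <= g * p'.1 < y.
    move=> pl' bp' Hg q h ql Gh hy; have [p1 _] := Hpos p' pl'.
    have [g Gg /andP[H1 H2]] := fill_below xs0 Hg p1 bp' (map_f _ ql) Gh hy.
    by exists g => //; rewrite ltW.
  have fillU p' : p' \in l -> between p'.1 y -> ~ has_least xs y ->
      forall q h, q \in l -> G h -> y < h * q.1 -> exists2 g, G g & y < g * p'.1 <= h * q.1.
    move=> pl' bp' Hg q h ql Gh hy; have [p1 _] := Hpos p' pl'.
    have [g Gg /andP[H1 H2]] := fill_above xs0 y0 Hg p1 bp' (map_f _ ql) Gh hy.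
    by exists g => //; rewrite H1 ltW.
  case: (pselect (has_greatest xs y)) => [[_ /mapP[a al ->] [g0 [Gg0 ay Ha]]]|Hng];
    case: (pselect (has_least xs y)) => [[_ /mapP[b bl ->] [h0 [Gh0 yb Hb]]]|Hnl].
  (* With nearest points on both sides, any value strictly between their images will do. *)
  - have ab : g0 * a.2 < h0 * b.2 by rewrite -mono // (lt_trans ay).
    have [m1 m2] : g0 * a.2 < (g0 * a.2 + h0 * b.2) / 2 /\ (g0 * a.2 + h0 * b.2) / 2 < h0 * b.2.
      by split; lra.
    exists ((g0 * a.2 + h0 * b.2) / 2); apply: good_cons => //.
    + by apply: lt_trans m1; rewrite mulr_gt0 ?(G_gt0 Gg0) //; case: (Hpos a al).
    + move=> q h ql Gh hy; apply: le_lt_trans m1.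
      by rewrite leNgt -mono // -leNgt Ha // map_f.
    + move=> q h ql Gh hy; apply: lt_le_trans m2 _.
      by rewrite leNgt -mono // -leNgt Hb // map_f.
    + by move=> q h; apply: HE.
  (* Since [g0 * a.1] is the greatest orbit point below [y], its double lies above, so the orbit of
     [a] surrounds [y] and determines both sides of the cut. *)
  - have ba : between a.1 y.
      exists g0, (2 * g0); split=> //; first exact: G_mul.
      apply: lo_hi => //; first exact: G_mul.
      move=> H; have := Ha a.1 (2 * g0) (map_f _ al) (G_mul G2 Gg0) H.
      have [a1 _] := Hpos a al; have := mulr_gt0 (G_gt0 Gg0) a1.
      by rewrite -mulrA; lra.
    apply: (transport a) => //; last exact: fillU.
    by move=> q h ql Gh hy; exists g0 => //; rewrite ay Ha // map_f.
  - have bb : between b.1 y.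
      exists (2^-1 * h0), h0; split=> //; first by apply: G_mul => //; apply: G_inv.
      apply: contrapT => /(lo_hi b _ bl (G_mul (G_inv G2) Gh0)) H.
      have := Hb b.1 _ (map_f _ bl) (G_mul (G_inv G2) Gh0) H.
      have [b1 _] := Hpos b bl; have := mulr_gt0 (G_gt0 Gh0) b1.
      by rewrite -mulrA; lra.
    apply: (transport b) => //; first exact: fillL.
    by move=> q h ql Gh hy; exists h0 => //; rewrite yb Hb // map_f.
  - by apply: (transport p) => //; [apply: fillL|apply: fillU].
have side p : p \in l -> (forall g, G g -> g * p.1 < y) \/ (forall g, G g -> y < g * p.1).
  move=> pl; case: (pselect (exists2 g, G g & g * p.1 < y)) => [[g Gg gy]|Hn].
    left=> h Gh; apply: contrapT => /(lo_hi _ _ pl Gh) hy; apply: Hnb; exists p => //.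
    by exists g, h.
  by right=> h Gh; apply: lo_hi => // hy; apply: Hn; exists h.
pose low := [seq p <- l | p.1 < y]; pose high := [seq p <- l | y < p.1].
have lowP p : p \in low -> p \in l /\ forall g, G g -> g * p.1 < y.
  rewrite mem_filter => /andP[py pl]; split=> //; case: (side p pl) => // /(_ 1 G_one).
  by rewrite mul1r => /(lt_trans py); rewrite ltxx.
have highP p : p \in high -> p \in l /\ forall g, G g -> y < g * p.1.
  rewrite mem_filter => /andP[py pl]; split=> //; case: (side p pl) => // /(_ 1 G_one).
  by rewrite mul1r => /(lt_trans py); rewrite ltxx.
have lowI p g : p \in l -> G g -> g * p.1 < y -> p \in low.
  move=> pl Gg gy; rewrite mem_filter pl andbT; case: (side p pl) => [/(_ 1 G_one)|/(_ g Gg)].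
    by rewrite mul1r.
  by move/(lt_trans gy); rewrite ltxx.
have highI p g : p \in l -> G g -> y < g * p.1 -> p \in high.
  move=> pl Gg gy; rewrite mem_filter pl andbT; case: (side p pl) => [/(_ g Gg)|/(_ 1 G_one)].
    by move/(lt_trans gy); rewrite ltxx.
  by rewrite mul1r.
case: (eqVneq low [::]) => [low0|/seq_max [a alow Ha]];
  case: (eqVneq high [::]) => [high0|/seq_min [b bhigh Hb]].
- case: l l0 @low @high Hpos side low0 high0 {Hl mono mono1 Hneq HE lo_hi xs xs0 transport Hnb lowP highP lowI highI} => // p l _ /= _ side.
  by case: (side p (mem_head _ _)) => /(_ 1 G_one); rewrite mul1r => ->.
(* Every orbit lies above [y]: an infinitesimal multiple of the least image is below all orbits of
   the images. The next case is the mirror image, with an infinite multiple of the greatest one. *)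
- have [bl _] := highP b bhigh; have [_ b2] := Hpos b bl.
  exists (iota * b.2); apply: good_cons => //; first by rewrite mulr_gt0.
  + by move=> q g ql Gg /(lowI q g ql Gg); rewrite low0.
  + move=> q g ql Gg /(highI q g ql Gg) qh.
    apply: lt_le_trans (_ : g * b.2 <= _); first by rewrite ltr_pM2r // iota_ltG.
    by rewrite ler_pM2l ?(G_gt0 Gg) // mono1 // Hb.
  + by move=> q h; apply: HE.
- have [al _] := lowP a alow; have [_ a2] := Hpos a al.
  exists (iota^-1 * a.2); apply: good_cons => //; first by rewrite mulr_gt0 ?invr_gt0.
  + move=> q g ql Gg /(lowI q g ql Gg) qh.
    apply: le_lt_trans (_ : _ <= g * a.2) _.
      by rewrite ler_pM2l ?(G_gt0 Gg) // mono1 // Ha.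
    rewrite ltr_pM2r // -[g]invrK ltf_pV2 ?posrE ?invr_gt0 ?(G_gt0 Gg) //.
    exact/iota_ltG/G_inv.
  + by move=> q g ql Gg /(highI q g ql Gg); rewrite high0.
  + by move=> q h; apply: HE.
(* The orbits below and above [y] are infinitely far apart, so the geometric mean of the adjacent
   images is infinitely far from both. *)
have [al Hal] := lowP a alow; have [bl Hbl] := highP b bhigh.
have [_ a2] := Hpos a al; have [_ b2] := Hpos b bl.
have ab0 : 0 <= a.2 * b.2 by rewrite mulr_ge0 ?ltW.
have sq0 : 0 < Num.sqrt (a.2 * b.2) by rewrite sqrtr_gt0 mulr_gt0.
have gab g : G g -> g * a.2 < b.2.
  move=> Gg; rewrite -[b.2]mul1r -mono //; last exact: G_one.
  exact: lt_trans (Hal g Gg) (Hbl 1 G_one).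
exists (Num.sqrt (a.2 * b.2)); apply: good_cons => //.
- move=> q g ql Gg /(lowI q g ql Gg) qh; have g0 := G_gt0 Gg.
  apply: le_lt_trans (_ : _ <= g * a.2) _; first by rewrite ler_pM2l // mono1 // Ha.
  rewrite -(ltr_pXn2r (n := 2)) ?nnegrE ?ltW ?mulr_gt0 // sqr_sqrtr //.
  have -> : (g * a.2) ^+ 2 = g * g * a.2 * a.2 by ring.
  by rewrite [a.2 * b.2]mulrC ltr_pM2r // gab //; apply: G_mul.
- move=> q g ql Gg /(highI q g ql Gg) qh; have g0 := G_gt0 Gg.
  apply: lt_le_trans (_ : g * b.2 <= _); last by rewrite ler_pM2l // mono1 // Hb.
  rewrite -(ltr_pXn2r (n := 2)) ?nnegrE ?ltW ?mulr_gt0 // sqr_sqrtr //.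
  have -> : (g * b.2) ^+ 2 = g * g * b.2 * b.2 by ring.
  rewrite ltr_pM2r //; have := gab _ (G_inv (G_mul Gg Gg)).
  by rewrite ltr_pdivrMl // mulr_gt0.
- by move=> q h; apply: HE.
Qed.

Definition swap (l : seq (K * K)) := map (fun p => (p.2, p.1)) l.

Lemma good_swap l : good l -> good (swap l).
Proof.
move=> [H1 H2]; split=> [_ /mapP[p /H1[? ?] ->] //|].
by move=> _ _ g /mapP[p pl ->] /mapP[q ql ->] Gg; rewrite /= H2.
Qed.

Lemma swapK : involutive swap.
Proof. by move=> l; rewrite /swap -map_comp; elim: l => //= -[a b] l ->. Qed.

Lemma good_extend_back l z : good l -> l != [::] -> 0 < z -> exists t, good ((t, z) :: l).
Proof.
move=> Hl l0 z0; have [|t Ht] := good_extend (good_swap Hl) _ z0.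
  by case: (l) l0.
by exists t; have := good_swap Ht; rewrite /swap /= -/(swap _) swapK.
Qed.

Variable enum : nat -> K.
Hypothesis enum_onto : forall x, exists n, enum n = x.

(* A finite partial isomorphism extends to an automorphism of the ordered set
   with the action of [G], by Cantor's back-and-forth. *)
Lemma good_automorphism l0 : good l0 -> (1, 1) \in l0 ->
  exists s t : K -> K, [/\ cancel s t /\ cancel t s, {mono s : x y / x < y},
    (forall g x, G g -> s (g * x) = g * s x), {morph s : x / - x} &
    s 1 = 1 /\ forall p, p \in l0 -> s p.1 = p.2].
Proof.
move=> Hl0 one0.
(* Each stage puts the next element into both the domain and the range. *)
have step l y : exists l', good l /\ (1, 1) \in l -> [/\ good l', {subset l <= l'} &
    0 < y -> (exists z, (y, z) \in l') /\ (exists x, (x, y) \in l')].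
  case: (pselect (good l /\ (1, 1) \in l)) => [[Hl l1]|Hn]; last by exists l.
  have ne : l != [::] by case: (l) l1.
  case: (ltP 0 y) => y0; last by exists l => _; split.
  have [z Hz] := good_extend Hl ne y0; have [x Hx] := good_extend_back Hz isT y0.
  exists [:: (x, y), (y, z) & l] => _; split=> // [p pl|_]; first by rewrite !in_cons pl !orbT.
  by split; [exists z|exists x]; rewrite !in_cons eqxx ?orbT.
have [next Hnext] := choice (fun ly => step ly.1 ly.2).
pose L n := nrec l0 (fun n l => next (l, enum n)) n.
have HL n : good (L n) /\ (1, 1) \in L n.
  elim: n => [|n IH] //; have [? Hs _] := Hnext (L n, enum n) IH.
  by split=> //; apply: Hs; case: IH.
have HS n : {subset L n <= L n.+1} by have [_ Hs _] := Hnext (L n, enum n) (HL n).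
have Hsub m n : (m <= n)%N -> {subset L m <= L n}.
  by move=> /subnKC <-; elim: (n - m)%N => [|k IH] p; rewrite ?addn0 // addnS => /IH/HS.
pose rel x z := exists n, (x, z) \in L n.
have tot x : 0 < x -> exists z, rel x z.
  move=> x0; have [n En] := enum_onto x; rewrite -En in x0 *.
  by have [_ _ /(_ x0) [[z Hz] _]] := Hnext (L n, enum n) (HL n); exists z, n.+1.
have tot' z : 0 < z -> exists x, rel x z.
  move=> z0; have [n En] := enum_onto z; rewrite -En in z0 *.
  by have [_ _ /(_ z0) [_ [y Hy]]] := Hnext (L n, enum n) (HL n); exists y, n.+1.
have rel_pos x z : rel x z -> 0 < x /\ 0 < z.
  by move=> [n Hn]; have [[H _] _] := HL n; have := H _ Hn.
have rel_mono x z x' z' g h : G g -> G h -> rel x z -> rel x' z' ->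
    (g * x < h * x') = (g * z < h * z').
  move=> Gg Gh [n Hn] [m Hm]; have [Hg _] := HL (maxn n m).
  exact: (good_mono (p := (x, z)) (q := (x', z')) Hg
    (Hsub _ _ (leq_maxl _ _) _ Hn) (Hsub _ _ (leq_maxr _ _) _ Hm) Gg Gh).
have rel_eq x z x' z' g : G g -> rel x z -> rel x' z' -> x' = g * x -> z' = g * z.
  move=> Gg r r' E; have := rel_mono _ _ _ _ _ _ Gg G_one r r'; have := rel_mono _ _ _ _ _ _ G_one Gg r' r.
  by rewrite !mul1r E ltxx; case: ltgtP.
have rel_eq' x z x' z' g : G g -> rel x z -> rel x' z' -> z' = g * z -> x' = g * x.
  move=> Gg r r' E; have := rel_mono _ _ _ _ _ _ Gg G_one r r'; have := rel_mono _ _ _ _ _ _ G_one Gg r' r.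
  by rewrite !mul1r E ltxx; case: ltgtP.
have ext (r : K -> K -> Prop) : (forall x, 0 < x -> exists z, r x z) ->
    exists f, forall x, 0 < x -> r x (f x).
  move=> H; have Hc x : exists z, 0 < x -> r x z.
    by case: (ltP 0 x) => [/H [z Hz]|]; [exists z|exists 0].
  have [f Hf] := choice Hc; exists f; exact: Hf.
have [f Hf] := ext _ tot.
have [h Hh] := ext (fun z x => rel x z) tot'.
have fE x z : 0 < x -> rel x z -> f x = z.
  by move=> x0 r; have := rel_eq _ _ _ _ 1 G_one r (Hf x x0); rewrite !mul1r => ->.
have hE x z : 0 < z -> rel x z -> h z = x.
  by move=> z0 r; have := rel_eq' _ _ _ _ 1 G_one r (Hh z z0); rewrite !mul1r => ->.
have f0 x : 0 < x -> 0 < f x by move=> /Hf/rel_pos[].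
have h0 x : 0 < x -> 0 < h x by move=> /Hh/rel_pos[].
(* The finite isomorphisms concern positive elements only; the odd extension covers the rest of the
   field. *)
pose odd (u : K -> K) x := if 0 < x then u x else if x < 0 then - u (- x) else 0.
have oddN u x : odd u (- x) = - odd u x.
  rewrite /odd oppr_gt0 oppr_lt0 opprK; case: (ltgtP x 0) => // _; by rewrite ?opprK ?oppr0.
have odd_cancel u v : (forall x, 0 < x -> 0 < u x /\ v (u x) = x) -> cancel (odd u) (odd v).
  move=> H x; case: (ltgtP x 0) => x0.
  - have : 0 < - x by rewrite oppr_gt0.
    rewrite -[in X in _ -> X](opprK x); move: (- x) => y y0.
    by rewrite !oddN /odd y0; case: (H _ y0) => -> ->.
  - by rewrite /odd x0; case: (H _ x0) => -> ->.
  - by rewrite x0 /odd !ltxx.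
have c1 : cancel (odd f) (odd h).
  by apply: odd_cancel => x x0; split; [apply: f0|apply: hE; [apply: f0|apply: Hf]].
have c2 : cancel (odd h) (odd f).
  by apply: odd_cancel => x x0; split; [apply: h0|apply: fE; [apply: h0|apply: Hh]].
have odd_pos x : 0 < x -> odd f x = f x by rewrite /odd => ->.
have odd0 : odd f 0 = 0 by rewrite /odd !ltxx.
have mono_pos x y : 0 < x -> 0 < y -> (odd f x < odd f y) = (x < y).
  move=> x0 y0; rewrite !odd_pos //.
  by have := rel_mono _ _ _ _ _ _ G_one G_one (Hf x x0) (Hf y y0); rewrite !mul1r.
have homo : {homo odd f : x y / x < y}.
  move=> x y xy; case: (ltgtP x 0) => x0; case: (ltgtP y 0) => y0; rewrite ?x0 ?y0 ?odd0; try lra.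
  - by rewrite -ltrN2 -!oddN mono_pos ?oppr_gt0 // ltrN2.
  - apply: (@lt_trans _ _ 0); last by rewrite odd_pos ?f0.
    by rewrite -oppr_gt0 -oddN odd_pos ?f0 ?oppr_gt0.
  - by rewrite -oppr_gt0 -oddN odd_pos ?f0 ?oppr_gt0.
  - by rewrite mono_pos.
  - by rewrite odd_pos ?f0.
exists (odd f), (odd h); split=> //.
- by apply: leW_mono; apply: le_mono.
- move=> g x Gg; have g0 := G_gt0 Gg.
  have Hp y : 0 < y -> odd f (g * y) = g * odd f y.
    move=> y0; have gy : 0 < g * y by rewrite mulr_gt0.
    rewrite !odd_pos //; exact: (rel_eq _ _ _ _ g Gg (Hf y y0) (Hf _ gy)).
  case: (ltgtP x 0) => x0; last by rewrite x0 mulr0 odd0 mulr0.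
    have : 0 < - x by rewrite oppr_gt0.
    rewrite -[in X in _ -> X](opprK x); move: (- x) => y y0.
    by rewrite mulrN !oddN Hp // mulrN.
  exact: Hp.
have Hl p : p \in l0 -> odd f p.1 = p.2.
  move=> pl; have [p1 _] := rel_pos p.1 p.2 (ex_intro _ 0%N (eq_ind p (fun q => q \in l0) pl _ (surjective_pairing p))).
  by rewrite odd_pos //; apply: fE => //; exists 0%N; rewrite -surjective_pairing.
by split=> //; apply: (Hl _ one0).
Qed.

End BackAndForth.

(** * From approximate solutions to a model *)

Lemma ratr_zcoef (K : numFieldType) n : ratr (zcoef rat n) = zcoef K n.
Proof. by rewrite /zcoef; case: ifP => _; rewrite ?rmorphN rmorph_nat. Qed.

Lemma map_cpoly (K : numFieldType) l : map_poly ratr (cpoly rat l) = cpoly K l.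
Proof.
rewrite /cpoly map_Poly_id0 ?rmorph0 // -map_comp; congr Poly; apply: eq_map => n /=.
exact: ratr_zcoef.
Qed.

Definition zenc (z : int) : nat := match z with Posz n => n.*2 | Negz n => n.*2.+1 end.

Lemma zcoef_zenc (K : nzRingType) z : zcoef K (zenc z) = (z%:~R)%R.
Proof.
case: z => n; rewrite /zcoef /zenc /= odd_double /=; first by rewrite doubleK.
by rewrite doubleK NegzE mulrNz.
Qed.

(** Clearing denominators passes from rational to integer coefficients; the rational form gives
    access to closure of algebraic elements under the field operations. *)
Lemma real_algebraicP (x : R) : is_real_algebraic x <-> algebraicOver (@ratr R) x.
Proof.
split=> [[p [/Zpoly_nonzeroE p0]]|[p p0 rp]].
  rewrite Zpoly_evalE => /eqP rx; exists (cpoly rat (code_Zlist p)); rewrite ?map_cpoly //.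
  by rewrite -(map_poly_eq0 (@ratr R)) map_cpoly.
have [q [a a0 pE]] := rat_poly_scale p.
pose l := lcode (map zenc q).
have lE : cpoly R l = map_poly intr q.
  rewrite /cpoly declist_lcode -map_comp map_polyE; congr Poly.
  by apply: eq_map => z /=; rewrite zcoef_zenc.
have q0 : q != 0%R by apply: contraNneq p0 => q0; rewrite pE q0 map_poly0 scaler0.
apply: (@is_real_algebraic_root l); rewrite lE.
  by rewrite map_poly_eq0_id0 // intr_eq0 lead_coef_eq0.
move: rp; rewrite pE map_polyZ /= rootZ ?fmorphV ?invr_eq0 ?ratr_int ?intr_eq0 //.
by rewrite -map_poly_comp (eq_map_poly (g := intr)) // => z /=; rewrite ratr_int.
by rewrite fmorph_eq0 intr_eq0.
Qed.

Lemma dalg_onto (a : Alg) : exists c, dalg c = a.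
Proof.
case: a => x Hx; have [p [p0 rx]] := Hx; set l := code_Zlist p.
have l0 : cpoly R l != 0%R by apply/Zpoly_nonzeroE.
have xr : x \in rootsR (cpoly R l) by rewrite root_rootsR // /root -Zpoly_evalE; apply/eqP.
exists (npair l (index x (rootsR (cpoly R l)))); apply: eq_exist => /=.
rewrite /aval /aroot !ufst_npair !usnd_npair -[RHS](nth_index 0%R xr).
by apply: set_nth_default; rewrite index_mem.
Qed.

(** * Node equations and approximate solutions *)

Section Nodes.
Variables (K : fieldType) (s : nat -> K) (v : nat -> K).

(** Values are indexed by term codes, and each code ties its value to those of its arguments. A code
    whose head is foreign to the language, here 5 or 6, is left free like a variable. *)
Definition addnode (i : nat) : Prop :=
  match ufst i with
  | 0 | 5 | 6 => True
  | 2 => v i = 1%R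
  | 3 => v i = (v (arg1 i) + v (arg2 i))%R
  | 4 => v i = (v (arg1 i) - v (arg2 i))%R
  | 7 => v i = (s (arg1 i) * v (arg2 i))%R
  | _ => v i = 0%R
  end.

Definition mulnode (i : nat) : Prop :=
  match ufst i with
  | 0 | 3 | 4 => True
  | 2 => v i = 1%R
  | 5 => v i = (v (arg1 i) * v (arg2 i))%R
  | 6 => v i = (v (arg1 i) / v (arg2 i))%R
  | 7 => v i = (s (arg1 i) * v (arg2 i))%R
  | _ => v i = 0%R
  end.

End Nodes.

Definition ftruth_step (E L : nat -> nat -> Prop) (g : nat -> Prop) (t : nat) : Prop :=
  match ufst t with
  | 1 => E (arg1 t) (arg2 t)
  | 2 => L (arg1 t) (arg2 t)
  | 3 => ~ g (usnd t)
  | 4 => g (arg1 t) /\ g (arg2 t)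
  | 5 => g (arg1 t) \/ g (arg2 t)
  | 6 => g (arg1 t) -> g (arg2 t)
  | _ => False
  end.

Lemma ftruth_step_ext E L g h n : (forall m, m < n -> g m = h m) ->
  ftruth_step E L g n = ftruth_step E L h n.
Proof.
move=> H; rewrite /ftruth_step; case En: (ufst n) => [|j] //.
by rewrite !H // ?ltn_usnd ?ltn_arg1 ?ltn_arg2 ?En.
Qed.

Definition ftruth (E L : nat -> nat -> Prop) : nat -> Prop := crec (ftruth_step E L) False.

Lemma ftruthE E L t : ftruth E L t = ftruth_step E L (ftruth E L) t.
Proof. by rewrite /ftruth crecE //; apply: ftruth_step_ext. Qed.

Lemma ftruth_ext E L E' L' N t : t <= N ->
  (forall a b, a < N -> b < N -> E a b <-> E' a b) ->
  (forall a b, a < N -> b < N -> L a b <-> L' a b) ->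
  ftruth E L t <-> ftruth E' L' t.
Proof.
elim/ltn_ind: t => t IH tN HE HL; rewrite !ftruthE /ftruth_step.
have := ltn_arg1 (t := t); have := ltn_arg2 (t := t); have := ltn_usnd (n := t).
case: (ufst t) => [|j] // /(_ isT) H0 /(_ isT) H2 /(_ isT) H1.
have N0 := leq_trans (ltnW H0) tN; have N1 := leq_trans H1 tN; have N2 := leq_trans H2 tN.
have I0 := IH _ H0 N0 HE HL; have I1 := IH _ H1 (ltnW N1) HE HL; have I2 := IH _ H2 (ltnW N2) HE HL.
move: (HE _ _ N1 N2) (HL _ _ N1 N2) => I3 I4.
do 6?[case: j => [|j] //]; tauto.
Qed.

Lemma sat_dform M e t : sat M e (dform t) <->
  ftruth (fun a b => teval M e (dterm a) = teval M e (dterm b))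
         (fun a b => s_lt M (teval M e (dterm a)) (teval M e (dterm b))) t.
Proof.
elim/ltn_ind: t => t IH; rewrite dformE ftruthE /dform_step /ftruth_step.
have := ltn_arg1 (t := t); have := ltn_arg2 (t := t); have := ltn_usnd (n := t).
case: (ufst t) => [|j] // /(_ isT) H0 /(_ isT) H2 /(_ isT) H1.
have I0 := IH _ H0; have I1 := IH _ H1; have I2 := IH _ H2.
do 6?[case: j => [|j] //=]; tauto.
Qed.

Definition near (K : realDomainType) (eps r x y x' y' : K) : Prop :=
  (`|x - r * y| <= eps * `|y| /\ `|x' - r * y'| <= eps * `|y'| /\
   Num.sg (x - r * y) = Num.sg (x' - r * y'))%R.

(** The bound [n.+4] exceeds 3, the code [npair 2 0] of the constant one, so that the automorphism
    is always required to fix 1. *)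
Definition solution (K : realFieldType) (s : nat -> K) (n : nat) (v w : nat -> K) : Prop :=
  (forall i, i < n.+4 -> addnode s v i /\ mulnode s w i /\ Num.sg (v i) = Num.sg (w i)) /\
  ~ ftruth (fun a b => v a = v b) (fun a b => (v a < v b)%R) n.

(* [v] and [w] are values of the terms with code less than [n.+4] computed in
   the additive and in the multiplicative structure; the ratios of [v] and those
   of [w] are to be in the same cuts of the algebraic numbers, in the limit. *)
Definition Star (n : nat) : Prop :=
  exists rho : nat -> nat -> R, forall eps, (0 < eps)%R -> exists v w, solution aval n v w /\
    forall i j, i < n.+4 -> j < n.+4 ->
      near eps (rho i j) (v i) (v j) (w i) (w j) \/ near eps (rho j i) (v j) (v i) (w j) (w i).

Section NearSign.
Local Open Scope ring_scope.

Lemma sgr_dominant (F : realDomainType) (u t : F) : `|u| < `|t| -> Num.sg (u + t) = Num.sg t.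
Proof.
case: (ltrgt0P t) => t0; rewrite ?t0 ?normr0 ?normr_lt0 // ltr_norml => /andP[H1 H2].
- by rewrite !gtr0_sg //; lra.
- by rewrite !ltr0_sg //; lra.
Qed.

(** If [a] is [r], the signs agree by the last clause of [near]. Otherwise [x - a * y] is a small
    perturbation of [(r - a) * y], and half the distance from [a] to [r] is an admissible
    tolerance. *)
Lemma sgr_near (r a : R) : exists2 d, 0 < d & forall eps x y x' y', eps <= d ->
  near eps r x y x' y' -> Num.sg y = Num.sg y' -> Num.sg (x - a * y) = Num.sg (x' - a * y').
Proof.
have [->|ra] := eqVneq a r; first by exists 1 => // eps x y x' y' _ [_ []].
have d0 : 0 < `|r - a| by rewrite normr_gt0 subr_eq0 eq_sym.
have E eps x y : eps <= `|r - a| / 2 -> `|x - r * y| <= eps * `|y| ->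
    Num.sg (x - a * y) = Num.sg ((r - a) * y).
  move=> He Hx; have -> : x - a * y = (x - r * y) + (r - a) * y by ring.
  have [y0|y0] := eqVneq y 0.
    by move: Hx; rewrite y0 normr0 !mulr0 normr_le0 => /eqP ->; rewrite add0r.
  apply: sgr_dominant; rewrite normrM; have y1 : 0 < `|y| by rewrite normr_gt0.
  apply: le_lt_trans Hx _; rewrite ltr_pM2r //; lra.
exists (`|r - a| / 2); first by rewrite divr_gt0.
move=> eps x y x' y' He [H1 [H2 _]] Hy.
by rewrite (E _ _ _ He H1) (E _ _ _ He H2) !sgrM Hy.
Qed.

(** A pair may be approximated in the other orientation; the sign is then read off
    [x - a * y = - a * (y - a^-1 * x)]. *)
Lemma sgr_near_swap (r a : R) : exists2 d, 0 < d & forall eps x y x' y', eps <= d ->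
  near eps r y x y' x' -> Num.sg x = Num.sg x' -> Num.sg (x - a * y) = Num.sg (x' - a * y').
Proof.
have [->|a0] := eqVneq a 0.
  by exists 1 => // eps x y x' y' _ _ H; rewrite !mul0r !subr0.
have [d d0 Hd] := sgr_near r a^-1; exists d => // eps x y x' y' He Hn Hx.
have E z t : z - a * t = - a * (t - a^-1 * z).
  by rewrite mulrBr mulNr mulrA mulNr divff // mulN1r opprK addrC.
by rewrite !E !sgrM (Hd _ _ _ _ _ He Hn Hx).
Qed.

End NearSign.

(** * Semialgebraic functions *)

Section Sfun.
Local Open Scope ring_scope.

(* The graph of [F] is semialgebraic, and [F] only reads the first [m] variables. *)
Definition sfun (m : nat) (F : forall K : rcfType, (nat -> K) -> K) : Prop :=
  (forall (K : rcfType) (E E' : nat -> K), (forall i, (i < m)%N -> E i = E' i) -> F K E = F K E') /\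
  (forall i, (m <= i)%N -> sdef (fun K E => E i = F K E)).

Lemma sfun_weaken m m' F : (m <= m')%N -> sfun m F -> sfun m' F.
Proof.
move=> mm' [H1 H2]; split=> [K E E' HE|i mi]; last by apply: H2; apply: leq_trans mi.
by apply: H1 => i im; apply: HE; apply: leq_trans mm'.
Qed.

Lemma sfun_var m j : (j < m)%N -> sfun m (fun K E => E j).
Proof.
move=> jm; split=> [K E E' HE|i mi]; first exact: HE.
exact: (sdef_eq (qe_rcf.Var _ i) (qe_rcf.Var _ j)).
Qed.

Lemma sfun_nat m n : sfun m (fun K E => n%:R).
Proof.
split=> // i _; exact: (sdef_eq (qe_rcf.Var _ i) (qe_rcf.NatConst _ n)).
Qed.

(** The two values are put into fresh variables, beyond those that the functions read. *)
Lemma sdef_rel2 m F1 F2 (r : forall K : rcfType, K -> K -> Prop) i : sfun m F1 -> sfun m F2 ->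
  (m <= i)%N ->
  sdef (fun K E => r K (E i.+1) (E i.+2)) -> sdef (fun K E => r K (F1 K E) (F2 K E)).
Proof.
move=> [D1 H1] [D2 H2] mi Hr.
apply: (sdef_iff _ (sdef_ex i.+1 (sdef_and (H1 i.+1 (leqW mi))
  (sdef_ex i.+2 (sdef_and (H2 i.+2 (leqW (leqW mi))) Hr))))) => K E.
have E1 (x : K) : F1 K (upd E i.+1 x) = F1 K E.
  by apply: D1 => j jm; rewrite /upd ltn_eqF // ltnS ltnW // (leq_trans jm).
have E2 (x y : K) : F2 K (upd (upd E i.+1 x) i.+2 y) = F2 K E.
  apply: D2 => j jm; have ji := leq_trans jm mi.
  by rewrite /upd !ltn_eqF // ltnS ltnW // ltnW.
have u11 (x : K) : upd E i.+1 x i.+1 = x by rewrite /upd eqxx.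
have u12 (x y : K) : upd (upd E i.+1 x) i.+2 y i.+1 = x by rewrite /upd ltn_eqF // eqxx.
have u22 (x y : K) : upd (upd E i.+1 x) i.+2 y i.+2 = y by rewrite /upd eqxx.
split=> [[x [Hx [y [Hy Hr']]]]|Hr'].
  by rewrite u11 E1 in Hx; rewrite u22 E2 in Hy; rewrite u12 u22 in Hr'; rewrite -Hx -Hy.
exists (F1 K E); rewrite u11 E1; split=> //.
by exists (F2 K E); rewrite u22 E2 u12.
Qed.

Lemma sdef_eq_fun m F1 F2 : sfun m F1 -> sfun m F2 -> sdef (fun K E => F1 K E = F2 K E).
Proof.
move=> H1 H2; apply: (sdef_rel2 (r := fun K x y => x = y) H1 H2 (leqnn m)).
exact: (sdef_eq (qe_rcf.Var _ m.+1) (qe_rcf.Var _ m.+2)).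
Qed.

Lemma sdef_lt_fun m F1 F2 : sfun m F1 -> sfun m F2 -> sdef (fun K E => F1 K E < F2 K E).
Proof.
move=> H1 H2; apply: (sdef_rel2 (r := fun K x y => x < y) H1 H2 (leqnn m)).
exact: (sdef_lt (qe_rcf.Var _ m.+1) (qe_rcf.Var _ m.+2)).
Qed.

Lemma sfun_op m F1 F2 (op : forall K : rcfType, K -> K -> K) : sfun m F1 -> sfun m F2 ->
  (forall i j k, sdef (fun K E => E i = op K (E j) (E k))) ->
  sfun m (fun K E => op K (F1 K E) (F2 K E)).
Proof.
move=> H1 H2 Hop; split=> [K E E' HE|i mi].
  by case: H1 => /(_ K E E' HE) -> _; case: H2 => /(_ K E E' HE) -> _.
have [D1 G1] := H1; have [D2 G2] := H2.
apply: (sdef_iff _ (sdef_ex i.+1 (sdef_and (G1 i.+1 (leqW mi))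
  (sdef_ex i.+2 (sdef_and (G2 i.+2 (leqW (leqW mi))) (Hop i i.+1 i.+2)))))) => K E.
have E1 (x : K) : F1 K (upd E i.+1 x) = F1 K E.
  by apply: D1 => j jm; rewrite /upd ltn_eqF // ltnS ltnW // (leq_trans jm).
have E2 (x y : K) : F2 K (upd (upd E i.+1 x) i.+2 y) = F2 K E.
  apply: D2 => j jm; have ji := leq_trans jm mi.
  by rewrite /upd !ltn_eqF // ltnS ltnW // ltnW.
have u11 (x : K) : upd E i.+1 x i.+1 = x by rewrite /upd eqxx.
have u12 (x y : K) : upd (upd E i.+1 x) i.+2 y i.+1 = x by rewrite /upd ltn_eqF // eqxx.
have u22 (x y : K) : upd (upd E i.+1 x) i.+2 y i.+2 = y by rewrite /upd eqxx.
have u0 (x y : K) : upd (upd E i.+1 x) i.+2 y i = E i by rewrite /upd !ltn_eqF.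
split=> [[x [Hx [y [Hy Hr']]]]|Hr'].
  by rewrite u11 E1 in Hx; rewrite u22 E2 in Hy; rewrite u0 u12 u22 in Hr'; rewrite -Hx -Hy.
exists (F1 K E); rewrite u11 E1; split=> //.
by exists (F2 K E); rewrite u22 E2 u12 u0.
Qed.

Notation V i := (qe_rcf.Var rat i).

Lemma sfun_add m F1 F2 : sfun m F1 -> sfun m F2 -> sfun m (fun K E => F1 K E + F2 K E).
Proof.
move=> H1 H2; apply: (sfun_op (op := fun K x y => x + y) H1 H2) => i j k.
exact: (sdef_eq (V i) (qe_rcf.Add (V j) (V k))).
Qed.

Lemma sfun_sub m F1 F2 : sfun m F1 -> sfun m F2 -> sfun m (fun K E => F1 K E - F2 K E).
Proof.
move=> H1 H2; apply: (sfun_op (op := fun K x y => x - y) H1 H2) => i j k.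
exact: (sdef_eq (V i) (qe_rcf.Add (V j) (qe_rcf.Opp (V k)))).
Qed.

Lemma sfun_mul m F1 F2 : sfun m F1 -> sfun m F2 -> sfun m (fun K E => F1 K E * F2 K E).
Proof.
move=> H1 H2; apply: (sfun_op (op := fun K x y => x * y) H1 H2) => i j k.
exact: (sdef_eq (V i) (qe_rcf.Mul (V j) (V k))).
Qed.

Lemma sfun_div m F1 F2 : sfun m F1 -> sfun m F2 -> sfun m (fun K E => F1 K E / F2 K E).
Proof.
move=> H1 H2; apply: (sfun_op (op := fun K x y => x / y) H1 H2) => i j k.
have Hj := sdef_eq0 (V k).
apply: (sdef_iff _ (sdef_and (sdef_imp Hj (sdef_eq0 (V i)))
  (sdef_imp (sdef_not Hj) (sdef_eq (qe_rcf.Mul (V i) (V k)) (V j))))) => K E /=.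
split=> [[Ha Hb]|->]; last by split=> [->|/eqP k0]; rewrite ?invr0 ?mulr0 // divfK.
have [k0|k0] := eqVneq (E k) 0; first by rewrite (Ha k0) k0 invr0 mulr0.
by rewrite -(Hb _) ?mulfK //; apply/eqP.
Qed.

Lemma sdef_sg m F1 F2 : sfun m F1 -> sfun m F2 ->
  sdef (fun K E => Num.sg (F1 K E) = Num.sg (F2 K E)).
Proof.
move=> H1 H2; have Z := sfun_nat m 0.
apply: (sdef_iff _ (sdef_and (sdef_equiv (sdef_lt_fun Z H1) (sdef_lt_fun Z H2))
  (sdef_equiv (sdef_lt_fun H1 Z) (sdef_lt_fun H2 Z)))) => K E /=.
rewrite !mulr0n; split=> [[[Ha Hb] [Hc Hd]]|Hs]; last first.
  have -> : (0 < F1 K E) = (0 < F2 K E) by rewrite -[LHS]sgr_gt0 Hs sgr_gt0.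
  by have -> : (F1 K E < 0) = (F2 K E < 0) by rewrite -[LHS]sgr_lt0 Hs sgr_lt0.
case: (ltgtP (F1 K E) 0) Ha Hb Hc Hd => c1 Ha Hb Hc Hd.
- by rewrite !ltr0_sg //; apply: Hc.
- by rewrite !gtr0_sg //; apply: Ha.
- case: (ltgtP (F2 K E) 0) => c2; last by rewrite c1 c2.
    by have := Hd c2; rewrite ?c1 ?ltxx.
  by have := Hb c2; rewrite ?c1 ?ltxx.
Qed.

End Sfun.

(** * Structures on fields and definability of truth *)

Definition fieldst (K : fieldType) (lt : K -> K -> Prop) (s : Alg -> K) : structure := {|
  carrier := K; s_zero := 0%R; s_one := 1%R;
  s_add := fun x y => (x + y)%R; s_sub := fun x y => (x - y)%R;
  s_mul := fun x y => (x * y)%R; s_div := fun x y => (x / y)%R;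
  s_lt := lt; s_scal := fun a x => (s a * x)%R |}.

Definition rcfst (K : rcfType) (s : Alg -> K) : structure := fieldst (fun x y => (x < y)%R) s.

(** [f] respects only the terms of [L]; the two structures may interpret the remaining function
    symbols independently, and gluing relies on this freedom. *)
Lemma sat_iff (M N : structure) (f : carrier M -> carrier N) (L : term -> Prop) p :
  (forall y, exists x, f x = y) ->
  (forall t e, L t -> f (teval M e t) = teval N (f \o e) t) ->
  (forall x y, f x = f y -> x = y) -> (forall x y, s_lt M x y <-> s_lt N (f x) (f y)) ->
  form_in L p -> forall e, sat M e p <-> sat N (f \o e) p.
Proof.
move=> onto Ht inj Hlt; elim: p => [|t u|t u|p IH|p IHp q IHq|p IHp q IHq|p IHp q IHq|p IH|p IH] /=.
- by [].
- by move=> [Lt Lu] e; rewrite -!Ht //; split=> [->|/inj].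
- by move=> [Lt Lu] e; rewrite -!Ht.
- by move=> Lp e; rewrite IH.
- by move=> [Lp Lq] e; rewrite IHp ?IHq.
- by move=> [Lp Lq] e; rewrite IHp ?IHq.
- by move=> [Lp Lq] e; rewrite IHp ?IHq.
- move=> Lp e; split=> [H y|H x].
    have [x <-] := onto y; have /(IH Lp) := H x; congr sat; apply/funext; by case.
  by apply/(IH Lp); have := H (f x); congr sat; apply/funext; case.
- move=> Lp e; split=> [[x /(IH Lp) H]|[y]].
    by exists (f x); move: H; congr sat; apply/funext; case.
  have [x <-] := onto y => H; exists x; apply/(IH Lp).
  by move: H; congr sat; apply/funext; case.
Qed.

Lemma Rdiv0E (x y : R) : Rdiv0 x y = (x / y)%R.
Proof.
rewrite /Rdiv0; case: RIneq.Req_EM_T => [->|]; last by rewrite RdivE.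
by rewrite invr0 mulr0.
Qed.

Lemma sat_Rstd p e : sat Rstd e p <-> sat (rcfst (fun a : Alg => sval a : R)) e p.
Proof.
apply: (@sat_iff Rstd (rcfst (fun a : Alg => sval a : R)) id (fun=> True)) => //.
- by move=> y; exists y.
- move=> t e0 _; elim: t => //= [t -> u ->|t -> u ->|t -> u ->|t -> u ->|a t ->] //.
  exact: Rdiv0E.
- by move=> x y; split=> /RltP.
- by elim: p => //=.
Qed.

Lemma teval_closed M k t e e' : term_closed k t -> (forall i, i < k -> e i = e' i) ->
  teval M e t = teval M e' t.
Proof.
move=> Hc He; elim: t Hc => //= [i /ssrnat.ltP/He //|t IH u IHu|t IH u IHu|t IH u IHu|t IH u IHu|a t IH].
1-4: by case=> /IH -> /IHu ->.
by move/IH => ->.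
Qed.

Lemma sat_closed M k p e e' : form_closed k p -> (forall i, i < k -> e i = e' i) ->
  sat M e p <-> sat M e' p.
Proof.
elim: p k e e' => [|t u|t u|p IH|p IHp q IHq|p IHp q IHq|p IHp q IHq|p IH|p IH] k e e' /=.
- by [].
- by move=> [Ht Hu] He; rewrite (teval_closed Ht He) (teval_closed Hu He).
- by move=> [Ht Hu] He; rewrite (teval_closed Ht He) (teval_closed Hu He).
- by move=> Hp He; rewrite (IH _ _ _ Hp He).
- by move=> [Hp Hq] He; rewrite (IHp _ _ _ Hp He) (IHq _ _ _ Hq He).
- by move=> [Hp Hq] He; rewrite (IHp _ _ _ Hp He) (IHq _ _ _ Hq He).
- by move=> [Hp Hq] He; rewrite (IHp _ _ _ Hp He) (IHq _ _ _ Hq He).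
- move=> Hp He; have HS x i : i < k.+1 -> scons x e i = scons x e' i by case: i => //= i /He.
  by split=> H x; apply/(IH _ _ _ Hp (HS x)).
- move=> Hp He; have HS x i : i < k.+1 -> scons x e i = scons x e' i by case: i => //= i /He.
  by split=> -[x H]; exists x; apply/(IH _ _ _ Hp (HS x)).
Qed.

(* In a formula under [d] quantifiers the variable [i < d] is read at
   [2 (d - 1 - i)], and the scalar [a] at [2 (cd a) + 1]. *)
Section SatSdef.
Variable cd : Alg -> nat.

Definition scal_env (K : rcfType) (E : nat -> K) : structure := rcfst (fun a => E (cd a).*2.+1).
Definition level_env (K : rcfType) (d : nat) (E : nat -> K) (i : nat) : K :=
  if i < d then E (d.-1 - i).*2 else 0%R.

Lemma sfun_teval d t : term_closed d t ->
  exists m, sfun m (fun K E => teval (scal_env E) (level_env d E) t).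
Proof.
have bin (op : forall K : rcfType, K -> K -> K) F1 F2 :
    (forall m G1 G2, sfun m G1 -> sfun m G2 -> sfun m (fun K E => op K (G1 K E) (G2 K E))) ->
    (exists m, sfun m F1) -> (exists m, sfun m F2) ->
    exists m, sfun m (fun K E => op K (F1 K E) (F2 K E)).
  move=> Hop [m1 H1] [m2 H2]; exists (maxn m1 m2); apply: Hop.
    exact: sfun_weaken (leq_maxl _ _) H1.
  exact: sfun_weaken (leq_maxr _ _) H2.
elim: t => [i|||t IHt u IHu|t IHt u IHu|t IHt u IHu|t IHt u IHu|a t IHt] /=.
- move/ssrnat.ltP => id; exists (d.-1 - i).*2.+1.
  have := @sfun_var (d.-1 - i).*2.+1 (d.-1 - i).*2 (ltnSn _).
  by rewrite /level_env id.
- by move=> _; exists 0; apply: (sfun_nat 0 0).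
- by move=> _; exists 0; apply: (sfun_nat 0 1).
- by case=> /IHt H1 /IHu H2; apply: (bin (fun K x y => (x + y)%R)) => // *; apply: sfun_add.
- by case=> /IHt H1 /IHu H2; apply: (bin (fun K x y => (x - y)%R)) => // *; apply: sfun_sub.
- by case=> /IHt H1 /IHu H2; apply: (bin (fun K x y => (x * y)%R)) => // *; apply: sfun_mul.
- by case=> /IHt H1 /IHu H2; apply: (bin (fun K x y => (x / y)%R)) => // *; apply: sfun_div.
- move/IHt => H; apply: (bin (fun K x y => (x * y)%R) (fun K E => E (cd a).*2.+1)) => //.
    by move=> *; apply: sfun_mul.
  by exists (cd a).*2.+2; apply: sfun_var.
Qed.

(** Scalars are parameters at odd indices, clear of the variables bound at even ones. Every sentence
    of the theory is thus semialgebraic in its scalars and passes to the limit. *)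
Lemma sdef_sat d p : form_closed d p -> sdef (fun K E => sat (scal_env E) (level_env d E) p).
Proof.
have rel k t u : term_closed k t -> term_closed k u -> exists m,
    sfun m (fun K E => teval (scal_env E) (level_env k E) t) /\
    sfun m (fun K E => teval (scal_env E) (level_env k E) u).
  move=> /sfun_teval [m1 H1] /sfun_teval [m2 H2]; exists (maxn m1 m2).
  by split; [apply: sfun_weaken (leq_maxl _ _) H1|apply: sfun_weaken (leq_maxr _ _) H2].
have lev k (K : rcfType) (E : nat -> K) x : level_env k.+1 (upd E k.*2 x) = scons x (level_env k E).
  apply/funext => -[|i]; rewrite /level_env /upd /= ?subn0 ?eqxx // ltnS.
  case: ltnP => // ik; have -> : ((k - i.+1).*2 == k.*2) = false by apply/eqP; lia.
  by congr (E _); lia.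
have scl k (K : rcfType) (E : nat -> K) x :
    (fun a => upd E k.*2 x (cd a).*2.+1) = (fun a => E (cd a).*2.+1).
  apply/funext => a; rewrite /upd.
  by have -> : ((cd a).*2.+1 == k.*2) = false by apply/eqP; lia.
elim: p d => [|t u|t u|p IH|p IHp q IHq|p IHp q IHq|p IHp q IHq|p IH|p IH] d /=.
- by move=> _; apply: (sdef_const False).
- by case=> Ht Hu; have [m [H1 H2]] := rel _ _ _ Ht Hu; apply: (sdef_eq_fun H1 H2).
- by case=> Ht Hu; have [m [H1 H2]] := rel _ _ _ Ht Hu; apply: (sdef_lt_fun H1 H2).
- by move/IH; apply: sdef_not.
- by case=> /IHp H1 /IHq H2; apply: (sdef_and H1 H2).
- by case=> /IHp H1 /IHq H2; apply: (sdef_or H1 H2).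
- by case=> /IHp H1 /IHq H2; apply: (sdef_imp H1 H2).
- move/IH => H; apply: (sdef_iff _ (sdef_forall d.*2 H)) => K E.
  by split=> Hx x; have := Hx x; rewrite /scal_env lev scl.
- move/IH => H; apply: (sdef_iff _ (sdef_ex d.*2 H)) => K E.
  by split=> -[x Hx]; exists x; move: Hx; rewrite /scal_env lev scl.
Qed.

End SatSdef.

Section SdefNodes.
Variables (vi : nat -> nat) (si : nat -> nat).

Notation V i := (qe_rcf.Var rat i).

Lemma sdef_addnode i :
  sdef (fun K E => addnode (fun c => E (si c)) (fun j => E (vi j)) i).
Proof.
have Z := sdef_eq0 (V (vi i)); rewrite /addnode.
case: (ufst i) => [|j]; first exact: sdef_const.
do 7?[case: j => [|j]]; try exact: Z; try exact: sdef_const.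
- exact: (sdef_eq (V (vi i)) (qe_rcf.NatConst _ 1)).
- exact: (sdef_eq (V (vi i)) (qe_rcf.Add (V _) (V _))).
- exact: (sdef_eq (V (vi i)) (qe_rcf.Add (V _) (qe_rcf.Opp (V _)))).
- exact: (sdef_eq (V (vi i)) (qe_rcf.Mul (V _) (V _))).
Qed.

Lemma sdef_mulnode i :
  sdef (fun K E => mulnode (fun c => E (si c)) (fun j => E (vi j)) i).
Proof.
have Z := sdef_eq0 (V (vi i)); rewrite /mulnode.
case: (ufst i) => [|j]; first exact: sdef_const.
do 7?[case: j => [|j]]; try exact: Z; try exact: sdef_const.
- exact: (sdef_eq (V (vi i)) (qe_rcf.NatConst _ 1)).
- exact: (sdef_eq (V (vi i)) (qe_rcf.Mul (V _) (V _))).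
- pose m := maxn (vi i) (maxn (vi (arg1 i)) (vi (arg2 i))).
  have F l : l <= m -> sfun m.+1 (fun K E => E l) by move=> lm; apply: sfun_var.
  by apply: (@sdef_eq_fun m.+1); [|apply: sfun_div]; apply: F; rewrite !leq_max leqnn ?orbT.
- exact: (sdef_eq (V (vi i)) (qe_rcf.Mul (V _) (V _))).
Qed.

Lemma sdef_ftruth t : sdef (fun K E =>
  ftruth (fun a b => E (vi a) = E (vi b)) (fun a b => (E (vi a) < E (vi b))%R) t).
Proof.
elim/ltn_ind: t => t IH.
apply: (sdef_iff (phi := fun K E => ftruth_step (fun a b => E (vi a) = E (vi b))
  (fun a b => (E (vi a) < E (vi b))%R) (ftruth (fun a b => E (vi a) = E (vi b))
  (fun a b => (E (vi a) < E (vi b))%R)) t)); first by move=> K E; rewrite -ftruthE.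
have := ltn_arg1 (t := t); have := ltn_arg2 (t := t); have := ltn_usnd (n := t).
rewrite /ftruth_step; case: (ufst t) => [|j]; first by move=> _ _ _; apply: sdef_const.
move=> /(_ isT)/IH H0 /(_ isT)/IH H2 /(_ isT)/IH H1.
do 6?[case: j => [|j]].
- exact: (sdef_eq (V _) (V _)).
- exact: (sdef_lt (V _) (V _)).
- exact: sdef_not H0.
- exact: sdef_and H1 H2.
- exact: sdef_or H1 H2.
- exact: sdef_imp H1 H2.
- exact: sdef_const.
Qed.

End SdefNodes.

(** The partial isomorphism lives on positive elements, so sign conditions are restated for absolute
    values; the signs of [x] and [y] are absorbed into the scalar [d]. *)
Lemma sgr_norm_sub (F : realDomainType) (x y x' y' g d : F) :
  (Num.sg x = Num.sg x' -> Num.sg y = Num.sg y' -> d = g * (Num.sg x * Num.sg y) ->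
  x != 0 -> Num.sg (x - d * y) = Num.sg (x' - d * y') ->
  Num.sg (`|x| - g * `|y|) = Num.sg (`|x'| - g * `|y'|))%R.
Proof.
move=> xx' yy' dE x0 H.
have E (a b u t : F) : (a * a = 1 -> a * u - g * (b * t) = a * (u - (g * (a * b)) * t))%R.
  move=> aa; have -> : (a * (u - (g * (a * b)) * t) = a * u - (a * a) * (g * (b * t)))%R by ring.
  by rewrite aa mul1r.
have s2 : (Num.sg x * Num.sg x = 1)%R by rewrite -expr2 sqr_sg x0.
rewrite (normrEsg x) (normrEsg y) (normrEsg x') (normrEsg y') -xx' -yy' !E // -dE.
by rewrite !sgrM H.
Qed.

(** * The glued model *)

Section StarModel.
Local Open Scope ring_scope.
Variables (n : nat) (rho : nat -> nat -> R) (v w : nat -> nat -> R).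
Hypothesis Hsol : forall k, solution aval n (v k) (w k).
Hypothesis Hnear : forall k i j, (i < n.+4)%N -> (j < n.+4)%N ->
  near k.+1%:R^-1 (rho i j) (v k i) (v k j) (w k i) (w k j) \/
  near k.+1%:R^-1 (rho j i) (v k j) (v k i) (w k j) (w k i).

(** One environment carries everything whose limit is taken: scalars at odd indices, and at even
    ones first [1 / (k + 1)], which becomes infinitesimal, then [v] and [w] alternately. *)
Let e (k i : nat) : R :=
  if odd i then aval i./2 else
  if i./2 is j.+1 then (if odd j then w k j./2 else v k j./2) else k.+1%:R^-1.

Let vi (j : nat) : nat := (j.*2.+1).*2.
Let wi (j : nat) : nat := (j.*2.+2).*2.
Let si (c : nat) : nat := c.*2.+1.

Let e_s k c : e k (si c) = aval c.
Proof. by rewrite /e /si /= odd_double /= uphalf_double. Qed.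
Let e_v k j : e k (vi j) = v k j.
Proof. by rewrite /e /vi odd_double doubleK odd_double doubleK. Qed.
Let e_w k j : e k (wi j) = w k j.
Proof. by rewrite /e /wi odd_double doubleK /= odd_double /= uphalf_double. Qed.
Let e_0 k : e k 0 = k.+1%:R^-1. Proof. by []. Qed.

Let sk (_ : seq R) : R := 0.

Variables (P : nat -> bool) (HP : rcf_order P).
Hypothesis Hcl : cluster (fun k => order_of (interp (e k) sk)) P.

Notation K := (tmodel HP).
Let E (i : nat) : K := cls HP (cvar i).

Let lim phi C : sdef phi -> (forall k, (C <= k)%N -> phi R (e k)) -> phi K E.
Proof. by move=> H; apply: (sdef_limit (C := C) HP Hcl H). Qed.

Notation V i := (qe_rcf.Var rat i).

Let kap (c : nat) : K := E (si c).
Let vK (j : nat) : K := E (vi j).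
Let wK (j : nat) : K := E (wi j).
Let iota : K := E 0.

Lemma limit_nodes i : (i < n.+4)%N ->
  [/\ addnode kap vK i, mulnode kap wK i & Num.sg (vK i) = Num.sg (wK i)].
Proof.
have Es k : (fun c => e k (si c)) = aval by apply/funext => c; apply: e_s.
have Ev k : (fun c => e k (vi c)) = v k by apply/funext => c; apply: e_v.
have Ew k : (fun c => e k (wi c)) = w k by apply/funext => c; apply: e_w.
move=> iN; split.
- apply: (lim (C := 0) (sdef_addnode vi si i)) => k _; rewrite Es Ev.
  by case: (Hsol k) => /(_ i iN) [].
- apply: (lim (C := 0) (sdef_mulnode wi si i)) => k _; rewrite Es Ew.
  by case: (Hsol k) => /(_ i iN) [_ []].
pose m := maxn (vi i) (wi i).
have Fv : sfun m.+1 (fun K E => E (vi i)) by apply: sfun_var; rewrite ltnS leq_maxl.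
have Fw : sfun m.+1 (fun K E => E (wi i)) by apply: sfun_var; rewrite ltnS leq_maxr.
apply: (lim (C := 0) (sdef_sg Fv Fw)) => k _; rewrite e_v e_w.
by case: (Hsol k) => /(_ i iN) [_ []].
Qed.

Lemma limit_ftruth : ~ ftruth (fun a b => vK a = vK b) (fun a b => vK a < vK b) n.
Proof.
apply: (lim (C := 0) (sdef_not (sdef_ftruth vi n))) => k _ H.
case: (Hsol k) => _; apply; move: H; congr ftruth; apply/funext => a; apply/funext => b;
  by rewrite !e_v.
Qed.

Lemma inv_succ_le (d : R) : 0 < d -> exists C, forall k, (C <= k)%N -> k.+1%:R^-1 <= d.
Proof.
move=> d0; exists (Num.bound d^-1) => k Ck; rewrite -[d]invrK lef_pV2 ?posrE ?invr_gt0 ?ltr0n //.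
apply: le_trans (ltW (archi_boundP _)) _; first by rewrite invr_ge0 ltW.
by rewrite ler_nat leqW.
Qed.

(** A fixed scalar comes with a tolerance below which [near] settles the sign; only finitely many
    [k] exceed it, and the limit ignores them. *)
Lemma limit_sign i j c : (i < n.+4)%N -> (j < n.+4)%N ->
  Num.sg (vK i - kap c * vK j) = Num.sg (wK i - kap c * wK j).
Proof.
move=> iN jN; pose m := maxn (si c) (maxn (maxn (vi i) (wi i)) (maxn (vi j) (wi j))).
have F l : (l <= m)%N -> sfun m.+1 (fun K E => E l) by move=> lm; apply: sfun_var.
have S : sdef (fun K E => Num.sg (E (vi i) - E (si c) * E (vi j)) = Num.sg (E (wi i) - E (si c) * E (wi j))).
  by apply: (@sdef_sg m.+1); apply: sfun_sub; (try apply: sfun_mul); apply: F; rewrite !leq_max leqnn ?orbT.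
have [d1 d10 H1] := sgr_near (rho i j) (aval c).
have [d2 d20 H2] := sgr_near_swap (rho j i) (aval c).
have [C1 HC1] := inv_succ_le d10; have [C2 HC2] := inv_succ_le d20.
apply: (lim (C := maxn C1 C2) S) => k; rewrite geq_max => /andP[Ck1 Ck2].
have [Hk _] := Hsol k; rewrite !e_v !e_w e_s.
case: (Hnear k iN jN) => Hn.
  by apply: (H1 _ _ _ _ _ (HC1 k Ck1) Hn); case: (Hk j jN) => _ [].
by apply: (H2 _ _ _ _ _ (HC2 k Ck2) Hn); case: (Hk i iN) => _ [].
Qed.

(** Comparisons with rational numbers survive the limit unchanged, so the scalars stay finite and
    separated although the field has infinitesimals. *)
Lemma kap_ltl c q : (kap c < ratr q) = (aval c < ratr q).
Proof.
have S := sdef_lt (V (si c)) (qe_rcf.Const q); apply/idP/idP => [|H].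
  apply: contraTT => /negP H; apply/negP.
  by apply: (lim (C := 0) (sdef_not S)) => k _; rewrite /= e_s.
by apply: (lim (C := 0) S) => k _; rewrite /= e_s.
Qed.

Lemma kap_ltr c q : (ratr q < kap c) = (ratr q < aval c).
Proof.
have S := sdef_lt (qe_rcf.Const q) (V (si c)); apply/idP/idP => [|H].
  apply: contraTT => /negP H; apply/negP.
  by apply: (lim (C := 0) (sdef_not S)) => k _; rewrite /= e_s.
by apply: (lim (C := 0) S) => k _; rewrite /= e_s.
Qed.

Lemma kap_mul c c' c'' : aval c * aval c' = aval c'' -> kap c * kap c' = kap c''.
Proof.
move=> H; have S := sdef_eq (qe_rcf.Mul (V (si c)) (V (si c'))) (V (si c'')).
by apply: (lim (C := 0) S) => k _; rewrite /= !e_s.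
Qed.

Lemma kap_opp c c' : aval c' = - aval c -> kap c' = - kap c.
Proof.
move=> H; have S := sdef_eq (V (si c')) (qe_rcf.Opp (V (si c))).
by apply: (lim (C := 0) S) => k _; rewrite /= !e_s.
Qed.

Lemma kap_eq c c' : aval c = aval c' -> kap c = kap c'.
Proof.
by move=> H; apply: (lim (C := 0) (sdef_eq (V (si c)) (V (si c')))) => k _; rewrite /= !e_s.
Qed.

Lemma kap_rat c q : aval c = ratr q -> kap c = ratr q.
Proof.
by move=> H; apply: (lim (C := 0) (sdef_eq (V (si c)) (qe_rcf.Const q))) => k _; rewrite /= !e_s.
Qed.

Lemma aval_onto (x : R) : is_real_algebraic x -> exists c, aval c = x.
Proof. by move=> Hx; have [c /(congr1 sval) cE] := dalg_onto (exist _ x Hx); exists c. Qed.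

Let G (g : K) : Prop := 0 < g /\ exists c, g = kap c.

Let kap_gt0 c : (0 < kap c) = (0 < aval c).
Proof. by have := kap_ltr c 0; rewrite !rmorph0. Qed.

Let G_gt0 g : G g -> 0 < g. Proof. by case. Qed.

Let G_mul g h : G g -> G h -> G (g * h).
Proof.
move=> [g0 [c gE]] [h0 [c' hE]]; split; first exact: mulr_gt0.
have [|c'' H] := @aval_onto (aval c * aval c').
  by apply/real_algebraicP; apply: algebraic_mul; apply/real_algebraicP; apply: aval_algebraic.
by exists c''; rewrite gE hE (kap_mul (c'' := c'')).
Qed.

Let G_inv g : G g -> G g^-1.
Proof.
move=> [g0 [c gE]]; split; first by rewrite invr_gt0.
have [|c' H] := @aval_onto (aval c)^-1.
  by apply/real_algebraicP; apply: algebraic_inv; apply/real_algebraicP; apply: aval_algebraic.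
have c0 : aval c != 0 by rewrite lt0r_neq0 // -kap_gt0 -gE.
have [|c1 H1] := @aval_onto 1; first by apply/real_algebraicP; apply: algebraic1.
exists c'; apply: (mulfI (lt0r_neq0 g0)); rewrite divff ?lt0r_neq0 // gE.
rewrite (@kap_mul c c' c1) ?(@kap_rat c1 1) ?rmorph1 //.
by rewrite H H1 divff.
Qed.

Let G_rat (m p : nat) : G (m.+1%:R / p.+1%:R).
Proof.
split; first by rewrite divr_gt0 ?ltr0n.
pose q : rat := m.+1%:R / p.+1%:R.
have qE (F : rcfType) : ratr q = m.+1%:R / p.+1%:R :> F by rewrite fmorph_div !rmorph_nat.
have [|c H] := @aval_onto (ratr q); first by apply/real_algebraicP; apply: algebraic_id.
by exists c; rewrite (kap_rat H) qE.
Qed.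

Let G_fin g : G g -> exists p : nat, g < p%:R.
Proof.
move=> [_ [c ->]]; exists (Num.bound `|aval c|).
rewrite -[X in _ < X](rmorph_nat (@ratr K)) kap_ltl rmorph_nat.
by apply: le_lt_trans (ler_norm _) _; apply: archi_boundP; apply: normr_ge0.
Qed.

Let G_sep g : G g -> 1 < g -> exists p : nat, 1 + p.+1%:R^-1 < g.
Proof.
move=> [_ [c ->]]; rewrite -[X in X < _](rmorph1 (@ratr K)) kap_ltr rmorph1 => c1.
have [|p Hp] := @inv_succ_le ((aval c - 1) / 2); first by rewrite divr_gt0 // subr_gt0.
exists p; pose q : rat := 1 + p.+1%:R^-1.
have qE (F : rcfType) : ratr q = 1 + p.+1%:R^-1 :> F.
  by rewrite rmorphD rmorph1 fmorphV rmorph_nat.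
rewrite -qE kap_ltr qE; move: (p.+1%:R^-1) (Hp p (leqnn _)) (c1) => x Hx H1; lra.
Qed.

Let iota_gt0 : 0 < iota.
Proof.
apply: (lim (C := 0) (sdef_gt0 (V 0))) => k _ /=; by rewrite e_0 invr_gt0 ltr0n.
Qed.

Let iota_lt (p : nat) : iota * p%:R < 1.
Proof.
apply: (lim (C := p) (sdef_lt (qe_rcf.Mul (V 0) (qe_rcf.NatConst _ p)) (qe_rcf.NatConst _ 1))) => k pk /=.
by rewrite e_0 mulrC ltr_pdivrMr ?ltr0n // mul1r ltr_nat.
Qed.

Let l0 : seq (K * K) := [seq (`|vK i|, `|wK i|) | i <- seq.iota 0 n.+4 & vK i != 0].

Let vw0 i : (i < n.+4)%N -> (vK i == 0) = (wK i == 0).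
Proof. by move=> /limit_nodes [_ _ H]; rewrite -!(sgr_eq0 (vK i)) -(sgr_eq0 (wK i)) H. Qed.

Let l0P p : p \in l0 -> exists2 i, (i < n.+4)%N & vK i != 0 /\ p = (`|vK i|, `|wK i|).
Proof.
by move=> /mapP[i]; rewrite mem_filter mem_iota => /andP[vi0 iN] ->; exists i.
Qed.

Let good_l0 : good G l0.
Proof.
split=> [p /l0P[i iN [vi0 ->]]|]; first by rewrite !normr_gt0 vi0 -vw0.
move=> _ _ g /l0P[i iN [vi0 ->]] /l0P[j jN [vj0 ->]] [g0 [c gE]] /=.
have [_ _ si'] := limit_nodes iN; have [_ _ sj'] := limit_nodes jN.
(* The signs of the two nodes are moved into the scalar, which remains algebraic since negation
   preserves algebraicity. *)
have [c' Hc'] : exists c', kap c' = g * (Num.sg (vK i) * Num.sg (vK j)).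
  have [|c' H] := @aval_onto (- aval c).
    by apply/real_algebraicP; apply: algebraic_opp; apply/real_algebraicP; apply: aval_algebraic.
  have Hs x : x != 0 -> Num.sg x = 1 \/ Num.sg x = -1 :> K.
    by case: (ltgtP x 0) => // xc _; [right; rewrite ltr0_sg|left; rewrite gtr0_sg].
  case: (Hs _ vi0) => ->; case: (Hs _ vj0) => ->.
  - by exists c; rewrite !mulr1.
  - by exists c'; rewrite (kap_opp H) gE mul1r mulrN1.
  - by exists c'; rewrite (kap_opp H) gE mulr1 mulrN1.
  - by exists c; rewrite mulrNN !mulr1.
exact: (sgr_norm_sub si' sj' Hc' vi0 (limit_sign c' iN jN)).
Qed.

Let v3 : vK 3 = 1.
Proof.
by have [] := @limit_nodes 3 isT.
Qed.
Let w3 : wK 3 = 1.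
Proof.
by have [] := @limit_nodes 3 isT.
Qed.

Let one_l0 : (1, 1) \in l0.
Proof.
apply/mapP; exists 3%N; last by rewrite v3 w3 normr1.
by rewrite mem_filter v3 oner_neq0 mem_iota.
Qed.

Lemma star_model : exists M (env : nat -> carrier M), model_of_T_A M /\ ~ sat M env (dform n).
Proof.
have enum_onto (x : K) : exists m, cls HP m = x by exists (val x); apply: cls_val.
have [s [t [[st ts] smono sG sN [s1 sl]]]] := good_automorphism G_gt0 G_mul G_inv G_rat
  G_fin G_sep iota_gt0 iota_lt enum_onto good_l0 one_l0.
have s0 : s 0 = 0.
  by have := sN 0; rewrite oppr0 => /eqP; rewrite -addr_eq0 -mulr2n mulrn_eq0 => /eqP.
have svw i : (i < n.+4)%N -> s (vK i) = wK i.
  move=> iN; have [_ _ sg] := limit_nodes iN; have vw := vw0 iN.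
  have [v0|v0] := eqVneq (vK i) 0.
    by rewrite v0 s0; apply/esym/eqP; rewrite -vw v0.
  have /sl /= H : (`|vK i|, `|wK i|) \in l0.
    by apply/mapP; exists i => //; rewrite mem_filter v0 mem_iota.
  have [vp|vn|vz] := ltrgt0P (vK i); last by rewrite vz eqxx in v0.
    move: sg H; rewrite (gtr0_sg vp) (gtr0_norm vp) => /esym/eqP; rewrite sgr_cp0 => wp.
    by rewrite gtr0_norm.
  move: sg H; rewrite (ltr0_sg vn) (ltr0_norm vn) => /esym/eqP; rewrite sgr_cp0 => wn.
  by rewrite ltr0_norm // sN => /oppr_inj.
have skap c x : s (kap c * x) = kap c * s x.
  case: (ltgtP (kap c) 0) => c0; last by rewrite c0 !mul0r.
    have [|c' H] := @aval_onto (- aval c).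
      by apply/real_algebraicP; apply: algebraic_opp; apply/real_algebraicP; apply: aval_algebraic.
    have cE : kap c = - kap c' by rewrite (kap_opp H) opprK.
    by rewrite cE !mulNr sN sG //; split; [rewrite -oppr_lt0 -cE|exists c'].
  by apply: sG; split=> //; exists c.
have [cd Hcd] := choice dalg_onto.
pose ka (a : Alg) := kap (cd a).
(* Addition, order and scalars are those of the field; multiplication and division are pulled back
   along [s]. The identity is then an isomorphism for the additive language, and [s] is one for the
   multiplicative language. *)
pose M : structure := {| carrier := K; s_zero := 0; s_one := 1; s_add := fun x y => x + y;
  s_sub := fun x y => x - y; s_mul := fun x y => t (s x * s y);
  s_div := fun x y => t (s x / s y); s_lt := fun x y => x < y; s_scal := fun a x => ka a * x |}.
have HK p env : sentence p -> true_in Rstd p -> sat (rcfst ka) env p.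
  move=> Hs Hp; have He i : (i < 0)%N -> env i = level_env 0 E i by [].
  apply/(@sat_closed (rcfst ka) 0 p env (level_env 0 E) Hs He).
  apply: (lim (C := 0) (sdef_sat cd Hs)) => k _.
  have sE : (fun a => e k (cd a).*2.+1) = (fun a : Alg => sval a : R).
    by apply/funext => a; rewrite -/(si (cd a)) e_s -[in RHS](Hcd a).
  rewrite /scal_env sE.
  by apply/sat_Rstd; apply: Hp.
have HM : model_of_T_A M.
  move=> p [[Hs [Hf Hp]]|[Hs [Hf Hp]]] env.
    apply/(@sat_iff M (rcfst ka) id term_add p) => //.
    - by move=> y; exists y.
    - by elim=> //= [u IHu u' IHu'|u IHu u' IHu'|a u IHu] env' => [[/(IHu env') -> /(IHu' env') ->]|[/(IHu env') -> /(IHu' env') ->]|/(IHu env') ->].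
    - exact: HK.
  apply/(@sat_iff M (rcfst ka) s term_mult p) => //.
  - by move=> y; exists (t y).
  - elim=> //= [u IHu u' IHu'|u IHu u' IHu'|a u IHu] env'.
    + by case=> /(IHu env') <- /(IHu' env') <-; rewrite ts.
    + by case=> /(IHu env') <- /(IHu' env') <-; rewrite ts.
    + by move/(IHu env') <-; rewrite skap.
  - exact: can_inj st.
  - by move=> x y; rewrite /= smono.
  - exact: HK.
exists M, (fun j => vK (npair 0 j)); split=> //.
have kd c : ka (dalg c) = kap c.
  by apply: kap_eq; have := congr1 sval (Hcd (dalg c)).
(* Additive heads are evaluated by the equations for [vK]; for multiplicative heads [s] carries [vK]
   to [wK], where the equations hold. *)
have tv i : (i < n.+4)%N -> teval M (fun j => vK (npair 0 j)) (dterm i) = vK i.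
  elim/ltn_ind: i => i IH iN; rewrite dtermE /dterm_step.
  have [Ha Hm _] := limit_nodes iN; have sv := svw i iN; move: Ha Hm; rewrite /addnode /mulnode.
  have := ltn_arg1 (t := i); have := ltn_arg2 (t := i); have := npair_unpair i.
  case: (ufst i) => [|j] E2; first by move=> _ _ _ _ /=; rewrite E2.
  move=> /(_ isT) H2 /(_ isT) H1.
  have N1 := ltn_trans H1 iN; have N2 := ltn_trans H2 iN.
  have I1 := IH _ H1 N1; have I2 := IH _ H2 N2.
  have S1 := svw _ N1; have S2 := svw _ N2.
  move: {E2}j; do 7?[case=> [|]] => //=; rewrite ?I1 ?I2 ?S1 ?S2 ?kd //.
  - by move=> _ <-; rewrite -sv st.
  - by move=> _ <-; rewrite -sv st.
move/sat_dform => H; apply: limit_ftruth.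
have n4 a : (a < n)%N -> (a < n.+4)%N by move=> an; apply: leq_trans an _; rewrite -addn4 leq_addr.
move: H; apply (ftruth_ext (leqnn n)) => a b /n4 aN /n4 bN.
  by rewrite (tv a aN) (tv b bN).
by rewrite (tv a aN) (tv b bN).
Qed.

End StarModel.

Lemma Star_model n : Star n ->
  exists M (env : nat -> carrier M), model_of_T_A M /\ ~ sat M env (dform n).
Proof.
move=> [rho H].
have Hk (k : nat) : exists vw : (nat -> R) * (nat -> R), solution aval n vw.1 vw.2 /\
    forall i j, i < n.+4 -> j < n.+4 ->
      near k.+1%:R^-1%R (rho i j) (vw.1 i) (vw.1 j) (vw.2 i) (vw.2 j) \/
      near k.+1%:R^-1%R (rho j i) (vw.1 j) (vw.1 i) (vw.2 j) (vw.2 i).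
  have [|v [w Hvw]] := H k.+1%:R^-1%R; first by rewrite invr_gt0 ltr0n.
  by exists (v, w).
have [vw Hvw] := choice Hk.
pose v k := (vw k).1; pose w k := (vw k).2.
pose e (k i : nat) : R :=
  (if odd i then aval i./2 else
  if i./2 is j.+1 then (if odd j then w k j./2 else v k j./2) else k.+1%:R^-1)%R.
have [P HP] := cluster_point (fun k => order_of (interp (e k) (fun=> 0%R))).
have HPo : rcf_order P by apply: (cluster_rcf_order HP) => k; apply: interp_rcf_order.
apply: (@star_model n rho v w _ _ P HPo HP) => [k|k i j]; first by case: (Hvw k).
by case: (Hvw k) => _; apply.
Qed.

(** * From a model to approximate solutions *)

Definition FConj (l : seq formula) : formula := foldr FAnd (FNot FFalse) l.

Lemma sat_FConj M e l : sat M e (FConj l) <-> forall p, List.In p l -> sat M e p.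
Proof.
elim: l => [|q l IH] /=; first by split=> // _; apply.
by rewrite IH; split=> [[H1 H2] p [<-|/H2]|H] //; split=> [|p pl]; apply: H; [left|right].
Qed.

(** If no real assignment satisfied the finite list, the universal closure of the negated
    conjunction would be an axiom, against its failure in [M]. *)
Lemma realize M (T : formula -> Prop) (L : term -> Prop) N l e :
  model_of_T_A M -> (forall p, sentence p -> form_in L p -> true_in Rstd p -> T_A p) ->
  (forall p, List.In p l -> form_closed N p /\ form_in L p /\ sat M e p) ->
  exists v, forall p, List.In p l -> sat Rstd v p.
Proof.
move=> HM HT Hl; apply: contrapT => Hn.
pose q := iter N FAll (FNot (FConj l)).
have E M' : true_in M' q <-> true_in M' (FNot (FConj l)).
  by rewrite /q; elim: N {Hl q} => //= k IH; rewrite true_in_FAll.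
have : true_in M q.
  apply/HM/HT.
  - apply/form_closed_iter; rewrite addn0 /=.
    elim: l Hl {Hn q E} => //= p l IH Hl; split; first by case: (Hl p (or_introl erefl)).
    by apply: IH => p' Hp'; apply: Hl; right.
  - have : form_in L (FNot (FConj l)).
      elim: l Hl {Hn q E} => //= p l IH Hl; split; first by case: (Hl p (or_introl erefl)) => _ [].
      by apply: IH => p' Hp'; apply: Hl; right.
    by rewrite /q; elim: (N) => //.
  - by apply/E => v /= Hv; apply: Hn; exists v; apply/sat_FConj.
by move/E => /(_ e) /=; apply; apply/sat_FConj => p /Hl [_ []].
Qed.

Section NodeFormulas.
Let var i := TVar i.

Definition addnode_form (i : nat) : formula :=
  match ufst i with
  | 0 | 5 | 6 => FNot FFalse
  | 2 => FEq (var i) TOne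
  | 3 => FEq (var i) (TAdd (var (arg1 i)) (var (arg2 i)))
  | 4 => FEq (var i) (TSub (var (arg1 i)) (var (arg2 i)))
  | 7 => FEq (var i) (TScal (dalg (arg1 i)) (var (arg2 i)))
  | _ => FEq (var i) TZero
  end.

Definition mulnode_form (i : nat) : formula :=
  match ufst i with
  | 0 | 3 | 4 => FNot FFalse
  | 2 => FEq (var i) TOne
  | 5 => FEq (var i) (TMul (var (arg1 i)) (var (arg2 i)))
  | 6 => FEq (var i) (TDiv (var (arg1 i)) (var (arg2 i)))
  | 7 => FEq (var i) (TScal (dalg (arg1 i)) (var (arg2 i)))
  | _ => FEq (var i) TZero
  end.

Lemma sat_addnode v i : sat Rstd v (addnode_form i) <-> addnode aval v i.
Proof.
rewrite /addnode_form /addnode; case: (ufst i) => [|j]; first by split=> // _ [].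
by do 7?[case: j => [|j] //=]; split=> // _ [].
Qed.

Lemma sat_mulnode v i : sat Rstd v (mulnode_form i) <-> mulnode aval v i.
Proof.
rewrite /mulnode_form /mulnode; case: (ufst i) => [|j]; first by split=> // _ [].
do 7?[case: j => [|j] //=]; try by split=> // _ [].
by rewrite Rdiv0E.
Qed.

Lemma node_forms N i : i < N ->
  (form_closed N (addnode_form i) /\ form_in term_add (addnode_form i)) /\
  (form_closed N (mulnode_form i) /\ form_in term_mult (mulnode_form i)).
Proof.
move=> iN; rewrite /addnode_form /mulnode_form.
have := ltn_arg1 (t := i); have := ltn_arg2 (t := i).
case: (ufst i) => [|j]; first by [].
move=> /(_ isT) H2 /(_ isT) H1.
have := ltn_trans H1 iN; have := ltn_trans H2 iN => /ssrnat.ltP N2 /ssrnat.ltP N1.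
move/ssrnat.ltP: iN => iN.
by do 7?[case: j => [|j] //=].
Qed.

Lemma sat_node_model M e i : sat M (fun i => teval M e (dterm i)) (addnode_form i) /\
  sat M (fun i => teval M e (dterm i)) (mulnode_form i).
Proof.
rewrite /addnode_form /mulnode_form; have := dtermE i; rewrite /dterm_step.
case: (ufst i) => [|j] E; first by split; case.
by move: E; do 7?[case: j => [|j] //=] => E; split; rewrite ?E //; case.
Qed.

End NodeFormulas.

Definition lit M (e : nat -> carrier M) (p : formula) : formula := if pselect (sat M e p) then p else FNot p.

Lemma sat_lit M (e : nat -> carrier M) p : sat M e (lit e p).
Proof. by rewrite /lit; case: pselect. Qed.

Lemma lit_iff M (e : nat -> carrier M) M' e' p : sat M' e' (lit e p) <-> (sat M' e' p <-> sat M e p).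
Proof. by rewrite /lit; case: pselect => /= H; tauto. Qed.

(** The additive and the multiplicative equations are realized by two assignments found
    independently; they are linked only through the formulas of [A], which lie in both languages. *)
Lemma realize_nodes n M e (A : seq formula) : model_of_T_A M ->
  (forall p, List.In p A -> form_closed n.+4 p /\ form_in term_add p /\ form_in term_mult p) ->
  let m := fun i => teval M e (dterm i) in
  exists v w : nat -> R, (forall i, i < n.+4 -> addnode aval v i /\ mulnode aval w i) /\
    forall p, List.In p A -> (sat Rstd v p <-> sat M m p) /\ (sat Rstd w p <-> sat M m p).
Proof.
move=> HM HA m.
have HL p : List.In p (map (lit m) A) -> exists2 q, List.In q A & p = lit m q.
  by elim: (A) => //= q A' IH [<-|/IH [q' Hq ->]]; [exists q; [left|]|exists q'; [right|]].
have HLi q : List.In q A -> List.In (lit m q) (map (lit m) A).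
  by elim: (A) => //= q' A' IH [->|/IH]; [left|right].
have Hlit q N L : form_closed N q -> form_in L q -> form_closed N (lit m q) /\ form_in L (lit m q).
  by rewrite /lit; case: pselect.
have Hnodes (f : nat -> formula) p : List.In p (map f (iota 0 n.+4)) ->
    exists2 i, i < n.+4 & p = f i.
  have E i : i \in iota 0 n.+4 -> i < n.+4 by rewrite mem_iota.
  elim: (iota 0 n.+4) E => //= i s IH E [<-|/IH H].
    by exists i => //; apply/E/mem_head.
  by apply: H => j js; apply: E; rewrite in_cons js orbT.
have Hnodesi (f : nat -> formula) i : i < n.+4 -> List.In (f i) (map f (iota 0 n.+4)).
  move=> iN; have : i \in iota 0 n.+4 by rewrite mem_iota.
  by elim: (iota _ _) => //= j s IH; rewrite in_cons => /orP[/eqP->|/IH]; [left|right].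
have [|p|v Hv] := @realize M T_A term_add n.+4 (map addnode_form (iota 0 n.+4) ++ map (lit m) A)%list m HM.
- by move=> p H1 H2 H3; left.
- move/List.in_app_iff => [/Hnodes [i iN ->]|/HL [q qA ->]].
    by have [[? ?] _] := node_forms iN; have [? _] := sat_node_model e i.
  have [H1 [H2 H3]] := HA q qA; have [? ?] := Hlit q n.+4 term_add H1 H2.
  by split=> //; split=> //; apply: sat_lit.
have [|p|w Hw] := @realize M T_A term_mult n.+4 (map mulnode_form (iota 0 n.+4) ++ map (lit m) A)%list m HM.
- by move=> p H1 H2 H3; right.
- move/List.in_app_iff => [/Hnodes [i iN ->]|/HL [q qA ->]].
    by have [_ [? ?]] := node_forms iN; have [_ ?] := sat_node_model e i.
  have [H1 [H2 H3]] := HA q qA; have [? ?] := Hlit q n.+4 term_mult H1 H3.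
  by split=> //; split=> //; apply: sat_lit.
exists v, w; split=> [i iN|p pA].
  split; first by apply/sat_addnode; apply: Hv; apply/List.in_app_iff; left; apply: Hnodesi.
  by apply/sat_mulnode; apply: Hw; apply/List.in_app_iff; left; apply: Hnodesi.
by split; apply/lit_iff; [apply: Hv|apply: Hw]; apply/List.in_app_iff; right; apply: HLi.
Qed.

Definition matches (n : nat) (S : nat -> nat -> nat -> R) (F : seq nat) (v : nat -> R) : Prop :=
  forall i j c, i < n.+4 -> j < n.+4 -> c \in F -> (Num.sg (v i - aval c * v j) = S i c j)%R.

(** The cuts [S] are fixed once by the model, whereas each finite set of scalars is realized by its
    own pair of real assignments. *)
Lemma refuted_matches n M e : model_of_T_A M -> ~ sat M e (dform n) ->
  exists S, forall F, exists v w, [/\ solution aval n v w, matches n S F v & matches n S F w].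
Proof.
move=> HM Hn; pose m i := teval M e (dterm i).
pose fe i c j := FEq (TVar i) (TScal (dalg c) (TVar j)).
pose fl i c j := FLt (TVar i) (TScal (dalg c) (TVar j)).
pose S i c j : R := (if pselect (sat M m (fe i c j)) then 0 else
  if pselect (sat M m (fl i c j)) then -1 else 1)%R.
exists S => F.
have sgS v i c j : (sat Rstd v (fe i c j) <-> sat M m (fe i c j)) ->
    (sat Rstd v (fl i c j) <-> sat M m (fl i c j)) -> Num.sg (v i - aval c * v j)%R = S i c j.
  rewrite /S => He Hl.
  have He' : sat Rstd v (fe i c j) <-> v i = (aval c * v j)%R by [].
  have Hl' : sat Rstd v (fl i c j) <-> (v i < aval c * v j)%R by split=> /RltP.
  case: pselect => He0; first by rewrite (proj1 He' (proj2 He He0)) subrr sgr0.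
  case: pselect => Hl0; first by rewrite ltr0_sg // subr_lt0; apply/Hl'/Hl.
  rewrite gtr0_sg // subr_gt0 lt_neqAle leNgt; apply/andP; split.
    by apply/eqP => H; apply: He0; apply/He; apply/He'.
  by apply/negP => H; apply: Hl0; apply/Hl; apply/Hl'.
(* The scalar 0 is always included, so that [v i] and [w i] have the same sign. *)
have [c0 Hc0] : exists c0, aval c0 = 0%R.
  by apply: aval_onto; apply/real_algebraicP; apply: algebraic0.
pose idx := iota 0 n.+4.
have HIn i : i < n.+4 -> List.In i idx by move=> iN; apply/In_mem; rewrite mem_iota.
have HInE i : List.In i idx -> i < n.+4 by move/In_mem; rewrite mem_iota.
pose A := List.flat_map (fun i => List.flat_map (fun j => [:: FEq (TVar i) (TVar j),
  FLt (TVar i) (TVar j) & List.flat_map (fun c => [:: fe i c j; fl i c j]) (c0 :: F)]) idx) idx.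
have HA1 i j p : i < n.+4 -> j < n.+4 -> (p = FEq (TVar i) (TVar j) \/ p = FLt (TVar i) (TVar j) \/
    exists2 c, c \in c0 :: F & p = fe i c j \/ p = fl i c j) -> List.In p A.
  move=> iN jN Hp; apply/List.in_flat_map; exists i; split; first exact: HIn.
  apply/List.in_flat_map; exists j; split; first exact: HIn.
  case: Hp => [->|[->|[c cF Hp]]]; [by left|by right; left|right; right].
  apply/List.in_flat_map; exists c; split; first exact/In_mem.
  by case: Hp => ->; [left|right; left].
have HA2 p : List.In p A -> form_closed n.+4 p /\ form_in term_add p /\ form_in term_mult p.
  move=> /List.in_flat_map [i [/HInE /ssrnat.ltP iN /List.in_flat_map [j [/HInE /ssrnat.ltP jN]]]].
  case=> [<-|[<-|H]] //.
  have /List.in_flat_map [c [_ [<-|[<-|[]]]]] :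
    List.In p (List.flat_map (fun c => [:: fe i c j; fl i c j]) (c0 :: F)) by []; by [].
have [v [w [Hnode Hvw]]] := realize_nodes e HM HA2.
have Hv i j c : i < n.+4 -> j < n.+4 -> c \in c0 :: F ->
    Num.sg (v i - aval c * v j)%R = S i c j /\ Num.sg (w i - aval c * w j)%R = S i c j.
  move=> iN jN cF.
  have [He1 He2] := Hvw (fe i c j) (HA1 i j _ iN jN (or_intror (or_intror (ex_intro2 _ _ c cF (or_introl erefl))))).
  have [Hl1 Hl2] := Hvw (fl i c j) (HA1 i j _ iN jN (or_intror (or_intror (ex_intro2 _ _ c cF (or_intror erefl))))).
  by split; apply: sgS.
exists v, w; split.
- split=> [i iN|].
    have [? ?] := Hnode i iN; split=> //; split=> //.
    by have [] := Hv i i c0 iN iN (mem_head _ _); rewrite Hc0 !mul0r !subr0 => -> ->.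
  move=> H; apply: Hn; apply/sat_dform; move: H; apply (ftruth_ext (leqnn n)) => a b aN bN.
    have a4 : a < n.+4 by apply: leq_trans aN _; rewrite -addn4 leq_addr.
    have b4 : b < n.+4 by apply: leq_trans bN _; rewrite -addn4 leq_addr.
    by have [H _] := Hvw _ (HA1 a b _ a4 b4 (or_introl erefl)); apply: iff_sym; exact: H.
  have a4 : a < n.+4 by apply: leq_trans aN _; rewrite -addn4 leq_addr.
  have b4 : b < n.+4 by apply: leq_trans bN _; rewrite -addn4 leq_addr.
  have [H _] := Hvw _ (HA1 a b _ a4 b4 (or_intror (or_introl erefl))).
  by split=> [/H/RltP|/RltP/H].
- by move=> i j c iN jN cF; have [] := Hv i j c iN jN (mem_behead (s := c0 :: F) cF).
- by move=> i j c iN jN cF; have [] := Hv i j c iN jN (mem_behead (s := c0 :: F) cF).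
Qed.

Section SdefNear.
Local Open Scope ring_scope.
Notation V i := (qe_rcf.Var rat i).

Lemma sfun_norm m F : sfun m F -> sfun m (fun K E => `|F K E|).
Proof.
move=> H; apply: (sfun_op (op := fun K x y => `|x|) H H) => i j _.
have P := sdef_gt0 (V j).
apply: (sdef_iff _ (sdef_and (sdef_imp P (sdef_eq (V i) (V j)))
  (sdef_imp (sdef_not P) (sdef_eq (V i) (qe_rcf.Opp (V j)))))) => K E /=.
case: (ltrP 0 (E j)) => [j0|j0]; first by rewrite gtr0_norm //; split=> [[H' _]|->]; [apply: H'|split].
by rewrite ler0_norm //; split=> [[_ H']|->]; [apply: H'|split].
Qed.

Lemma sdef_le_fun m F1 F2 : sfun m F1 -> sfun m F2 -> sdef (fun K E => F1 K E <= F2 K E).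
Proof.
move=> H1 H2; apply: (sdef_iff _ (sdef_not (sdef_lt_fun H2 H1))) => K E.
by rewrite leNgt; split=> /negP.
Qed.

Lemma sdef_bounds (B : Prop) e r x y x' y' : sdef (fun K E =>
  `|E x - E r * E y| <= E e * `|E y| /\ `|E x' - E r * E y'| <= E e * `|E y'| /\
  (B -> Num.sg (E x - E r * E y) = Num.sg (E x' - E r * E y'))).
Proof.
pose m := (e + r + x + y + x' + y').+1.
have F l : (l < m)%N -> sfun m (fun K E => E l) by apply: sfun_var.
have [Fe Fr Fx Fy] : [/\ sfun m (fun K E => E e), sfun m (fun K E => E r),
  sfun m (fun K E => E x) & sfun m (fun K E => E y)] by split; apply: F; rewrite /m; lia.
have [Fx' Fy'] : sfun m (fun K E => E x') /\ sfun m (fun K E => E y').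
  by split; apply: F; rewrite /m; lia.
apply: sdef_and; last apply: sdef_and.
- exact: sdef_le_fun (sfun_norm (sfun_sub Fx (sfun_mul Fr Fy))) (sfun_mul Fe (sfun_norm Fy)).
- exact: sdef_le_fun (sfun_norm (sfun_sub Fx' (sfun_mul Fr Fy'))) (sfun_mul Fe (sfun_norm Fy')).
- apply: sdef_imp; first exact: sdef_const.
  exact: sdef_sg (sfun_sub Fx (sfun_mul Fr Fy)) (sfun_sub Fx' (sfun_mul Fr Fy')).
Qed.

Lemma sdef_near e r x y x' y' :
  sdef (fun K E => near (E e) (E r) (E x) (E y) (E x') (E y')).
Proof.
by apply: (sdef_iff _ (sdef_bounds True e r x y x' y')) => K E; rewrite /near; tauto.
Qed.

Lemma sdef_solution n (si vi wi : nat -> nat) : sdef (fun K E =>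
  solution (fun c => E (si c)) n (fun i => E (vi i)) (fun i => E (wi i))).
Proof.
apply: sdef_and; last exact: sdef_not (sdef_ftruth vi n).
apply: sdef_all_lt => i _; apply: sdef_and; first exact: sdef_addnode.
apply: sdef_and; first exact: sdef_mulnode.
by apply: (@sdef_sg (vi i + wi i).+1); apply: sfun_var; lia.
Qed.

End SdefNear.

Lemma aval_rat q : exists c, aval c = ratr q.
Proof. by apply: aval_onto; apply/real_algebraicP; apply: algebraic_id. Qed.

Lemma sub_matches n S F F' v : {subset F <= F'} -> matches n S F' v -> matches n S F v.
Proof. by move=> sF H i j c iN jN /sF; apply: H. Qed.

(** * Ratios determined by cuts *)

Section Cuts.
Local Open Scope ring_scope.
Variables (n : nat) (S : nat -> nat -> nat -> R).
Hypothesis HS : forall F, exists v w,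
  [/\ solution aval n v w, matches n S F v & matches n S F w].
Variables (c0 c1 cm1 : nat).
Hypotheses (a0 : aval c0 = 0) (a1 : aval c1 = 1) (am1 : aval cm1 = -1).

(** For a matching [v] the product has the sign of [v i ^+ 2 - v j ^+ 2]. A pair is thus oriented so
    that its ratio is at most 1 in absolute value. *)
Definition below (i j : nat) : bool := S i c1 j * S i cm1 j <= 0.

Lemma belowE F v i j : (i < n.+4)%N -> (j < n.+4)%N -> c1 \in F -> cm1 \in F ->
  matches n S F v -> below i j = (`|v i| <= `|v j|).
Proof.
move=> iN jN F1 Fm1 Hv; rewrite /below -!Hv // a1 am1 -sgrM sgr_le0 -[RHS]ler_sqr ?nnegrE //.
rewrite !real_normK ?num_real // -[RHS]subr_le0.
by have -> : (v i - 1 * v j) * (v i - -1 * v j) = v i ^+ 2 - v j ^+ 2 by ring.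
Qed.

Lemma below_total i j : (i < n.+4)%N -> (j < n.+4)%N -> below i j \/ below j i.
Proof.
move=> iN jN; have [v [_ [_ Hv _]]] := HS [:: c1; cm1].
have F1 : c1 \in [:: c1; cm1] by rewrite mem_head.
have F2 : cm1 \in [:: c1; cm1] by rewrite !inE eqxx orbT.
by rewrite !(belowE (v := v) _ _ F1 F2) //; apply/orP; apply: le_total.
Qed.

(** The ratio is the supremum of the algebraic numbers below the cut. A member of that set close to
    the supremum and a rational number just above it confine all matching assignments to within
    [eps]. *)
Lemma cut_ratio i j : (i < n.+4)%N -> (j < n.+4)%N -> below i j ->
  exists r, forall eps, 0 < eps -> exists F, forall v, matches n S F v ->
    `|v i - r * v j| <= eps * `|v j|.
Proof.
move=> iN jN Hij.
have sv F v : c0 \in F -> matches n S F v -> Num.sg (v j) = S j c0 j.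
  by move=> F0 Hv; rewrite -Hv // a0 mul0r subr0.
have le_v F v : c1 \in F -> cm1 \in F -> matches n S F v -> `|v i| <= `|v j|.
  by move=> F1 Fm Hv; rewrite -(belowE iN jN F1 Fm Hv).
(* In the first case [v j] vanishes and, by the orientation, so does [v i]; any ratio would do. *)
have [Sj|Sj] := eqVneq (S j c0 j) 0.
  exists 0 => eps _; exists [:: c0; c1; cm1] => v Hv.
  have vj : v j = 0 by apply/eqP; rewrite -sgr_eq0 (sv _ _ _ Hv) ?Sj // mem_head.
  have := le_v _ v _ _ Hv; rewrite !inE !eqxx !orbT => /(_ isT isT).
  by rewrite vj normr0 !mulr0 subr0.
have cutE F v c : c0 \in F -> c \in F -> matches n S F v ->
    (0 <= S j c0 j * S i c j) = (aval c <= v i / v j).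
  move=> F0 Fc Hv; have sj := sv _ _ F0 Hv.
  have vj : v j != 0 by rewrite -sgr_eq0 sj.
  rewrite -sj -Hv // -sgrM sgr_ge0.
  have -> : v j * (v i - aval c * v j) = v j ^+ 2 * (v i / v j - aval c) by field.
  by rewrite pmulr_rge0 ?subr_ge0 // exprn_even_gt0.
have t1 F v : c0 \in F -> c1 \in F -> cm1 \in F -> matches n S F v -> `|v i / v j| <= 1.
  move=> F0 F1 Fm Hv; have := le_v _ _ F1 Fm Hv.
  have vj : v j != 0 by rewrite -sgr_eq0 (sv _ _ F0 Hv).
  by rewrite normrM normfV ler_pdivrMr ?normr_gt0 // mul1r.
pose D : set R := [set x | exists2 c, x = aval c & 0 <= S j c0 j * S i c j]%classic.
have supD : has_sup D.
  split.
    have [v [_ [_ Hv _]]] := HS [:: c0; c1; cm1]; exists (aval cm1), cm1 => //.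
    rewrite (cutE _ v _ _ _ Hv) ?inE ?eqxx ?orbT // am1.
    by have := t1 _ v _ _ _ Hv; rewrite !inE !eqxx !orbT ler_norml => /(_ isT isT isT)/andP[].
  exists 1 => _ [c -> Hc]; have [v [_ [_ Hv _]]] := HS [:: c; c0; c1; cm1].
  move: Hc; rewrite (cutE _ v _ _ _ Hv) ?inE ?eqxx ?orbT // => Hc; apply: le_trans Hc _.
  by have := t1 _ v _ _ _ Hv; rewrite !inE !eqxx !orbT ler_norml => /(_ isT isT isT)/andP[].
exists (sup D) => eps eps0.
have [_ [c -> Hc] cr] := sup_adherent eps0 supD.
have rq : sup D < sup D + eps by rewrite ltrDl.
have [q] := rat_in_itvoo rq; rewrite in_itv /= => /andP[q1 q2].
have [c' cE] := aval_rat q.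
exists [:: c0; c; c'] => v Hv.
have F0 : c0 \in [:: c0; c; c'] by rewrite mem_head.
have vj : v j != 0 by rewrite -sgr_eq0 (sv _ _ F0 Hv).
have l1 : aval c <= v i / v j by rewrite -(cutE _ _ _ F0 _ Hv) // !inE eqxx orbT.
have l2 : v i / v j < ratr q.
  rewrite ltNge -cE -(cutE _ _ _ F0 _ Hv) ?inE ?eqxx ?orbT //; apply/negP => Hc'.
  have : aval c' <= sup D by apply: ub_le_sup; [case: supD|exists c'].
  by rewrite cE leNgt q1.
have -> : v i - sup D * v j = (v i / v j - sup D) * v j by field.
rewrite normrM ler_wpM2r // ler_norml; apply/andP; split; lra.
Qed.

End Cuts.

(** Only the first [m] coordinates are made algebraic; the others form an existential block. *)
Lemma algebraic_point_ex m phi (K : rcfType) : sdef phi -> (exists e, phi K e) ->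
  exists e, phi K e /\ forall i, i < m -> algebraicOver (@ratr K) (e i).
Proof.
move=> Hphi [e0 He0]; have [m' Hm] := sdef_support Hphi.
have [||g [g0 [e [[f Hf] He]]]] := @algebraic_point m _ K (sdef_exblk m m' Hphi).
- move=> F e e' Hee [f Hf]; exists f; move: Hf; apply Hm => i im.
  by rewrite /blk; case: ifP => // H; rewrite Hee //; move: H im; lia.
- by exists e0, (fun i => e0 (m + i)); move: He0; apply Hm => i _; rewrite /blk; case: ifP => // /andP[H _]; rewrite subnKC.
exists (blk m m' f e); split=> // i im; exists (g i) => //.
by rewrite /blk leqNgt im; apply: He.
Qed.

(** A polynomial has finitely many roots, so a small rational interval separates [a] from the others
    and [a] becomes definable over the rationals. *)
Lemma isolate (a : R) : algebraicOver (@ratr R) a -> exists (q : {poly rat}) (l u : rat),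
  forall x, (root (map_poly ratr q) x /\ (ratr l < x)%R /\ (x < ratr u)%R) <-> x = a.
Proof.
case=> q q0 qa.
have [d d0 Hd] : exists2 d, (0 < d)%R & forall x, root (map_poly ratr q) x -> x != a -> (d <= `|x - a|)%R.
  have q0' : map_poly (@ratr R) q != 0%R by rewrite map_poly_eq0.
  suff [d d0 Hd] : exists2 d, (0 < d)%R & forall x, x \in rootsR (map_poly ratr q) -> x != a -> (d <= `|x - a|)%R.
    by exists d => // x; rewrite -root_rootsR //; apply: Hd.
  elim: (rootsR _) => [|y s [d d0 Hd]]; first by exists 1%R; rewrite ?ltr01.
  have [ya|ya] := eqVneq y a.
    by exists d => // x; rewrite inE => /orP[/eqP->|/Hd //]; rewrite ya eqxx.
  exists (Num.min d `|y - a|)%R; first by rewrite lt_min d0 normr_gt0 subr_eq0.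
  move=> x; rewrite inE ge_min => /orP[/eqP->|/Hd H /H ->] //; by rewrite lexx orbT.
have [|l] := @rat_in_itvoo _ (a - d)%R a; first by rewrite ltrBlDr ltrDl.
rewrite in_itv /= => /andP[l1 l2].
have [|u] := @rat_in_itvoo _ a (a + d)%R; first by rewrite ltrDl.
rewrite in_itv /= => /andP[u1 u2].
exists q, l, u => x; split=> [[rx [lx xu]]|->] //.
apply/eqP; apply: contrapT => /negP xa; have := Hd x rx xa.
by rewrite leNgt ltr_norml => /negP; apply; apply/andP; split; lra.
Qed.

Section SolutionExt.
Variables (K : realFieldType) (n : nat).

Lemma addnode_ext (s s' v v' : nat -> K) N i : i < N -> (forall c, c < N -> s c = s' c) ->
  (forall j, j < N -> v j = v' j) -> addnode s v i <-> addnode s' v' i.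
Proof.
move=> iN Hs Hv; rewrite /addnode.
have := ltn_arg1 (t := i); have := ltn_arg2 (t := i); rewrite (Hv _ iN).
case: (ufst i) => [|j] //; move=> /(_ isT) H2 /(_ isT) H1.
have N1 := ltn_trans H1 iN; have N2 := ltn_trans H2 iN.
by rewrite !Hv // !Hs.
Qed.

Lemma mulnode_ext (s s' v v' : nat -> K) N i : i < N -> (forall c, c < N -> s c = s' c) ->
  (forall j, j < N -> v j = v' j) -> mulnode s v i <-> mulnode s' v' i.
Proof.
move=> iN Hs Hv; rewrite /mulnode.
have := ltn_arg1 (t := i); have := ltn_arg2 (t := i); rewrite (Hv _ iN).
case: (ufst i) => [|j] //; move=> /(_ isT) H2 /(_ isT) H1.
have N1 := ltn_trans H1 iN; have N2 := ltn_trans H2 iN.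
by rewrite !Hv // !Hs.
Qed.

Lemma solution_ext (s s' v v' w w' : nat -> K) : (forall c, c < n.+4 -> s c = s' c) ->
  (forall i, i < n.+4 -> v i = v' i) -> (forall i, i < n.+4 -> w i = w' i) ->
  solution s n v w -> solution s' n v' w'.
Proof.
move=> Hs Hv Hw [H1 H2]; split=> [i iN|].
  have [Ha [Hm Hsg]] := H1 i iN; rewrite -Hv // -Hw //; split; last split=> //.
    exact: (proj1 (addnode_ext iN Hs Hv)).
  exact: (proj1 (mulnode_ext iN Hs Hw)).
have n4 a : a < n -> a < n.+4 by move=> an; apply: leq_trans an _; rewrite -addn4 leq_addr.
move=> H; apply: H2; move: H; apply (ftruth_ext (leqnn n)) => a b /n4 aN /n4 bN;
  by rewrite -!Hv.
Qed.

End SolutionExt.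

Lemma blk_in (T : Type) o l (f e : nat -> T) i : i < l -> blk o l f e (o + i) = f i.
Proof. by move=> il; rewrite /blk leq_addr ltn_add2l il addKn. Qed.

Lemma blk_out (T : Type) o l (f e : nat -> T) i : i < o -> blk o l f e i = e i.
Proof. by move=> io; rewrite /blk leqNgt io. Qed.

Lemma finite_pos N (P : nat -> R -> Prop) :
  (forall p, p < N -> exists2 d, (0 < d)%R & forall d', (0 < d' <= d)%R -> P p d') ->
  exists2 d, (0 < d)%R & forall p, p < N -> P p d.
Proof.
move=> H; suff [d d0 Hd] : exists2 d, (0 < d)%R & forall p, p < N -> forall d', (0 < d' <= d)%R -> P p d'.
  by exists d => // p pN; apply: Hd; rewrite // d0 lexx.
elim: N H => [|N IH] H; first by exists 1%R; rewrite ?ltr01.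
have [p pN|d d0 Hd] := IH; first by apply: H; apply: ltnW.
have [d1 d10 Hd1] := H N (ltnSn N); exists (Num.min d d1); first by rewrite lt_min d0.
move=> p; rewrite ltnS leq_eqVlt => /orP[/eqP ->|pN] d'; rewrite le_min => /and3P[? ? ?].
  by apply: Hd1; apply/andP.
by apply: (Hd p pN); apply/andP.
Qed.

Section Pinned.
Local Open Scope ring_scope.

Definition pinned (t : {poly rat} * rat * rat) (K : rcfType) (x : K) : Prop :=
  root (map_poly ratr t.1.1) x /\ ratr t.1.2 < x /\ x < ratr t.2.

Lemma sdef_pinned t i : sdef (fun K E => pinned t (E i)).
Proof.
apply: sdef_and; first exact: sdef_root; apply: sdef_and.
  exact: (sdef_lt (qe_rcf.Const _) (qe_rcf.Var _ i)).
exact: (sdef_lt (qe_rcf.Var _ i) (qe_rcf.Const _)).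
Qed.

Lemma pinned_algebraic (a : R) : algebraicOver (@ratr R) a ->
  exists t, forall x, pinned t x <-> x = a.
Proof. by move=> /isolate [q [l [u H]]]; exists (q, l, u). Qed.

End Pinned.

(** * Moving the transcendental ratios *)

Section Refuted.
Local Open Scope ring_scope.
Variables (n : nat) (S : nat -> nat -> nat -> R).
Hypothesis HS : forall F, exists v w,
  [/\ solution aval n v w, matches n S F v & matches n S F w].
Variables (c0 c1 cm1 : nat).
Hypotheses (a0 : aval c0 = 0) (a1 : aval c1 = 1) (am1 : aval cm1 = -1).

(** The pair [(i, j)] is numbered [i * N + j]; only the pairs oriented by [below] receive a
    ratio. *)
Let N := n.+4.
Let L := (N * N)%N.
Let fst (p : nat) := (p %/ N)%N.
Let snd (p : nat) := (p %% N)%N.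
Let ori (p : nat) := below S c1 cm1 (fst p) (snd p).

Let fstN p : (p < L)%N -> (fst p < N)%N. Proof. by rewrite /fst ltn_divLR. Qed.
Let sndN p : (snd p < N)%N. Proof. exact: ltn_pmod. Qed.

Let cuts : exists rho : nat -> R, forall eps, 0 < eps -> exists F, forall p, (p < L)%N -> ori p ->
  forall v, matches n S F v -> `|v (fst p) - rho p * v (snd p)| <= eps * `|v (snd p)|.
Proof.
have /choice [rho Hrho] : forall p, exists r, (p < L)%N -> ori p -> forall eps, 0 < eps ->
    exists F, forall v, matches n S F v -> `|v (fst p) - r * v (snd p)| <= eps * `|v (snd p)|.
  move=> p; case: (pselect ((p < L)%N /\ ori p)) => [[pL op]|H]; last by exists 0 => ? ?; case: H.
  by have [r Hr] := cut_ratio HS a0 a1 am1 (fstN pL) (sndN p) op; exists r.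
exists rho => eps eps0; elim: (L) Hrho => [|l IH] Hrho; first by exists [::].
have [F HF] := IH (fun p pl => Hrho p (ltnW pl)).
case: (boolP (ori l)) => [ol|ol]; last first.
  exists F => p; rewrite ltnS leq_eqVlt => /orP[/eqP ->|pl]; first by rewrite (negbTE ol).
  exact: HF.
have [F1 HF1] := Hrho l (ltnSn l) ol eps eps0; exists (F ++ F1) => p.
rewrite ltnS leq_eqVlt => /orP[/eqP ->|pl] op v Hv.
  by apply: HF1; apply: sub_matches Hv => x xF; rewrite mem_cat xF orbT.
by apply: HF => //; apply: sub_matches Hv => x xF; rewrite mem_cat xF.
Qed.

(** [B] marks the ratios at which the signs must agree; it will be the set of algebraic ones. *)
Let bounds (B : nat -> Prop) (K : realDomainType) (eps : K) (rho v w : nat -> K) : Prop :=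
  forall p, (p < L)%N -> ori p ->
    `|v (fst p) - rho p * v (snd p)| <= eps * `|v (snd p)| /\
    `|w (fst p) - rho p * w (snd p)| <= eps * `|w (snd p)| /\
    (B p -> Num.sg (v (fst p) - rho p * v (snd p)) = Num.sg (w (fst p) - rho p * w (snd p))).

Let limits B (rho : nat -> R) : Prop :=
  forall eps, 0 < eps -> exists v w, solution aval n v w /\ bounds B eps rho v w.

Lemma limits_Star B rho :
  (forall d, 0 < d -> exists rho', [/\ limits B rho',
    forall p, (p < L)%N -> ori p -> B p -> rho' p = rho p,
    forall p, (p < L)%N -> ori p -> `|rho' p - rho p| <= d &
    forall p, (p < L)%N -> ori p -> ~ B p -> rho' p != rho p]) -> Star n.
Proof.
move=> H; exists (fun i j => rho (i * N + j)%N) => eps eps0.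
have e2 : 0 < eps / 2 by rewrite divr_gt0.
have [rho' [Hl HB Hd Hne]] := H _ e2.
(* The tolerance [d] is at most half of [eps] and smaller than every shift outside [B]. *)
have [d d0 Hdd] : exists2 d, 0 < d & forall p, (p < L)%N -> d <= eps / 2 /\
    (ori p -> ~ B p -> d < `|rho' p - rho p|).
  apply: finite_pos => p pL; case: (pselect (ori p /\ ~ B p)) => [[op Bp]|Hp].
    have r0 : 0 < `|rho' p - rho p| by rewrite normr_gt0 subr_eq0; apply: Hne.
    exists (Num.min (eps / 2) (`|rho' p - rho p| / 2)); first by rewrite lt_min e2 divr_gt0.
    move=> d' /andP[d'0]; rewrite le_min => /andP[-> d'r]; split=> // _ _.
    by apply: le_lt_trans d'r _; lra.
  by exists (eps / 2) => // d' /andP[_ ->]; split=> // op Bp; case: Hp.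
have [v [w [Hsol Hb]]] := Hl d d0.
exists v, w; split=> // i j iN jN.
suff main i' j' : (i' < N)%N -> (j' < N)%N -> below S c1 cm1 i' j' ->
    near eps (rho (i' * N + j')%N) (v i') (v j') (w i') (w j').
  by case: (below_total HS a1 am1 iN jN) => Hij; [left|right]; apply: main.
move=> {}iN {}jN Hij; set p := (i' * N + j')%N.
have pL : (p < L)%N.
  have : (i'.+1 * N <= N * N)%N by rewrite leq_mul2r iN orbT.
  by apply: leq_trans; rewrite /p mulSnr ltn_add2l.
have fp : fst p = i' by rewrite /fst /p divnMDl // divn_small // addn0.
have sp : snd p = j' by rewrite /snd /p modnMDl modn_small.
have op : ori p by rewrite /ori fp sp.
have [b1 [b2 b3]] := Hb p pL op; rewrite fp sp in b1 b2 b3.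
have [de Hdp] := Hdd p pL.
have E (x y : R) : `|x - rho' p * y| <= d * `|y| -> `|x - rho p * y| <= eps * `|y|.
  move=> Hx; have -> : x - rho p * y = (x - rho' p * y) + (rho' p - rho p) * y by ring.
  apply: le_trans (ler_normD _ _) _; rewrite normrM.
  have H1 : `|rho' p - rho p| * `|y| <= eps / 2 * `|y| by apply: ler_wpM2r => //; apply: Hd.
  have H2 : d * `|y| <= eps / 2 * `|y| by apply: ler_wpM2r.
  by move: H1 H2 Hx; move: (`|y|) (`|rho' p - rho p| * `|y|) (d * `|y|); intros; lra.
split; first exact: E; split; first exact: E.
case: (pselect (B p)) => Bp; first by rewrite -(HB p pL op Bp); apply: b3.
have Sg (x y : R) : `|x - rho' p * y| <= d * `|y| -> Num.sg (x - rho p * y) = Num.sg (rho' p - rho p) * Num.sg y.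
  move=> Hx; have -> : x - rho p * y = (x - rho' p * y) + (rho' p - rho p) * y by ring.
  have [y0|y0] := eqVneq y 0.
    by move: Hx; rewrite y0 normr0 !mulr0 normr_le0 => /eqP ->; rewrite add0r sgr0 mulr0.
  rewrite -sgrM; apply: sgr_dominant; rewrite normrM; apply: le_lt_trans Hx _.
  by rewrite ltr_pM2r ?normr_gt0 //; apply: Hdp.
rewrite (Sg _ _ b1) (Sg _ _ b2); congr (_ * _).
by case: Hsol => /(_ j' jN) [_ [_ ->]].
Qed.

(** Layout of the variables: [L] centres, [N] scalars, [L] ratios, the tolerance, and from [o2] on
    the [N] values [v] and the [N] values [w]. *)
Let o2 := (L + N + L).+1.

Let approx B (K : rcfType) (E : nat -> K) : Prop :=
  solution (fun c => E (L + c)%N) n (fun i => E (o2 + i)%N) (fun i => E (o2 + (N + i))%N) /\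
  bounds B (E (L + N + L)%N) (fun p => E (L + N + p)%N)
    (fun i => E (o2 + i)%N) (fun i => E (o2 + (N + i))%N).

Let deflimits B (K : rcfType) (E : nat -> K) : Prop := forall x,
  0 < upd E (L + N + L) x (L + N + L)%N ->
  exists g, approx B (blk o2 (N + N) g (upd E (L + N + L) x)).

Let sdef_deflimits B : sdef (deflimits B).
Proof.
apply: (sdef_forall (L + N + L) (phi := fun K E => 0 < E (L + N + L)%N ->
  exists g, approx B (blk o2 (N + N) g E))).
apply: sdef_imp; first exact: (sdef_gt0 (qe_rcf.Var _ _)).
apply: (sdef_exblk o2 (N + N)); apply: sdef_and; first exact: sdef_solution.
apply: sdef_all_lt => p pL; apply: sdef_imp; first exact: sdef_const.
exact: sdef_bounds.
Qed.

Let deflimitsE B f (E : nat -> R) : (forall c, (c < N)%N -> E (L + c)%N = aval c) ->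
  deflimits B (blk (L + N) L f E) <-> limits B f.
Proof.
move=> Hs; set E' := blk (L + N) L f E.
have E's c : (c < N)%N -> E' (L + c)%N = aval c.
  by move=> cN; rewrite /E' blk_out ?Hs // ltn_add2l.
have Ue x : upd E' (L + N + L) x (L + N + L)%N = x by rewrite /upd eqxx.
have Uo x i : (i < L + N + L)%N -> upd E' (L + N + L) x i = E' i.
  by move=> H; rewrite /upd ltn_eqF.
have Us x c : (c < N)%N -> upd E' (L + N + L) x (L + c)%N = aval c.
  by move=> cN; rewrite Uo ?E's //; lia.
have Ur x p : (p < L)%N -> upd E' (L + N + L) x (L + N + p)%N = f p.
  by move=> pL; rewrite Uo ?ltn_add2l // /E' blk_in.
have Gx x g : [/\ blk o2 (N + N) g (upd E' (L + N + L) x) (L + N + L)%N = x,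
    forall p, (p < L)%N -> blk o2 (N + N) g (upd E' (L + N + L) x) (L + N + p)%N = f p &
    forall c, (c < N)%N -> blk o2 (N + N) g (upd E' (L + N + L) x) (L + c)%N = aval c].
  split=> [|p pL|c cN]; rewrite blk_out ?Ue ?Ur ?Us // /o2; lia.
split=> H eps.
  move=> eps0; have [|g [Hsol Hb]] := H eps; first by rewrite Ue.
  have [GE GR GS] := Gx eps g; set G := blk o2 (N + N) g _ in Hsol Hb GE GR GS.
  exists (fun i => G (o2 + i)%N), (fun i => G (o2 + (N + i))%N); split.
    exact: solution_ext Hsol.
  by move=> p pL op; have := Hb p pL op; rewrite GE GR.
rewrite Ue => /H [v [w [Hsol Hb]]].
pose g i := if (i < N)%N then v i else w (i - N)%N; exists g.
have [GE GR GS] := Gx eps g; set G := blk o2 (N + N) g _ in GE GR GS *.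
have Gv i : (i < N)%N -> G (o2 + i)%N = v i.
  by move=> iN; rewrite /G blk_in /g ?iN // ltn_addr.
have Gw i : (i < N)%N -> G (o2 + (N + i))%N = w i.
  by move=> iN; rewrite /G blk_in /g ?ltn_add2l // ltnNge leq_addr addKn.
split.
  by apply: (solution_ext _ _ _ Hsol) => i iN; rewrite ?(GS _ iN) ?(Gv _ iN) ?(Gw _ iN).
move=> p pL op; rewrite GE (GR p pL) (Gv _ (fstN pL)) (Gv _ (sndN p)) (Gw _ (fstN pL)) (Gw _ (sndN p)).
exact: Hb.
Qed.

(** Suppose that near [rho] every limiting family that agrees with [rho] on [B] shares with it some
    coordinate outside [B]. Once the algebraic coordinates and the scalars are pinned and the
    neighbourhood is a rational box, this property [phi] of the centre is semialgebraic over the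
    rationals, so it also holds at a centre with algebraic coordinates. Applied there to the family
    [rho] itself, it makes a transcendental coordinate of [rho] algebraic. *)
Lemma refuted_limits : Star n.
Proof.
have [rho Hrho] := cuts.
pose B p := algebraicOver (@ratr R) (rho p).
have L0 : limits B rho.
  move=> eps eps0; have [F HF] := Hrho eps eps0.
  (* An algebraic ratio is itself added to the scalars, so [S] prescribes the same sign to both
     assignments there. *)
  have /choice [c Hc] : forall p, exists c, B p -> aval c = rho p.
    move=> p; case: (pselect (B p)) => [Bp|Bp]; last by exists 0%N.
    by have [|c cE] := @aval_onto (rho p); [apply/real_algebraicP|exists c].
  have [v [w [Hsol Hv Hw]]] := HS (F ++ map c (iota 0 L)).
  have sF : {subset F <= F ++ map c (iota 0 L)} by move=> x xF; rewrite mem_cat xF.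
  exists v, w; split=> // p pL op.
  split; first exact: (HF p pL op _ (sub_matches sF Hv)).
  split; first exact: (HF p pL op _ (sub_matches sF Hw)).
  have cF : c p \in F ++ map c (iota 0 L).
    by rewrite mem_cat; apply/orP; right; apply: map_f; rewrite mem_iota.
  by move=> Bp; rewrite -(Hc p Bp) (Hv _ _ _ (fstN pL) (sndN p) cF) (Hw _ _ _ (fstN pL) (sndN p) cF).
apply: (@limits_Star B rho) => d d0; apply: contrapT => Hn.
have key rho' : limits B rho' -> (forall p, (p < L)%N -> ori p -> B p -> rho' p = rho p) ->
    (forall p, (p < L)%N -> ori p -> `|rho' p - rho p| <= d) ->
    exists2 p, (p < L)%N & ori p /\ ~ B p /\ rho' p = rho p.
  move=> H1 H2 H3; apply: contrapT => H4; apply: Hn; exists rho'; split=> // p pL op Bp.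
  by apply/eqP => Hp; apply: H4; exists p.
have /choice [pin Hpin] : forall p, exists t, B p -> forall x : R, pinned t x <-> x = rho p.
  move=> p; case: (pselect (B p)) => [/pinned_algebraic [t Ht]|Bp]; first by exists t.
  by exists (0, 0, 0).
have /choice [spin Hspin] : forall c, exists t, forall x : R, pinned t x <-> x = aval c.
  by move=> c; apply: pinned_algebraic; apply/real_algebraicP; apply: aval_algebraic.
(* Rational corners keep real parameters out of [phi], and the box stays within distance [d] of
   [rho]. *)
have /choice [box Hbox] : forall p, exists lu : rat * rat,
    [/\ rho p - d < ratr lu.1, ratr lu.1 < rho p, rho p < ratr lu.2 & ratr lu.2 < rho p + d].
  move=> p; have [|l] := @rat_in_itvoo _ (rho p - d) (rho p); first by rewrite ltrBlDr ltrDl.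
  rewrite in_itv /= => /andP[l1 l2].
  have [|u] := @rat_in_itvoo _ (rho p) (rho p + d); first by rewrite ltrDl.
  by rewrite in_itv /= => /andP[u1 u2]; exists (l, u).
pose inbox (K : rcfType) (E : nat -> K) := forall p, (p < L)%N -> ori p ->
  (ratr (box p).1 < E (L + N + p)%N /\ E (L + N + p)%N < ratr (box p).2) /\
  (B p -> E (L + N + p)%N = E p).
pose phi (K : rcfType) (E : nat -> K) :=
  (forall p, (p < L)%N -> B p -> pinned (pin p) (E p)) /\
  (forall c, (c < N)%N -> pinned (spin c) (E (L + c)%N)) /\
  forall f, inbox K (blk (L + N) L f E) -> deflimits B (blk (L + N) L f E) ->
    exists2 p, (p < L)%N & (ori p /\ ~ B p) /\ blk (L + N) L f E (L + N + p)%N = blk (L + N) L f E p.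
have phiS : sdef phi.
  apply: sdef_and.
    by apply: sdef_all_lt => p _; apply: sdef_imp; [apply: sdef_const|apply: sdef_pinned].
  apply: sdef_and; first by apply: sdef_all_lt => c _; apply: sdef_pinned.
  apply: (sdef_allblk (L + N) L (phi := fun K E => inbox K E -> deflimits B E ->
    exists2 p, (p < L)%N & (ori p /\ ~ B p) /\ E (L + N + p)%N = E p)).
  apply: sdef_imp.
    apply: sdef_all_lt => p _; apply: sdef_imp; first exact: sdef_const.
    apply: sdef_and.
      apply: sdef_and; first exact: (sdef_lt (qe_rcf.Const _) (qe_rcf.Var _ _)).
      exact: (sdef_lt (qe_rcf.Var _ _) (qe_rcf.Const _)).
    apply: sdef_imp; first exact: sdef_const.
    exact: (sdef_eq (qe_rcf.Var _ _) (qe_rcf.Var _ _)).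
  apply: sdef_imp; first exact: sdef_deflimits.
  apply: sdef_ex_lt => p _; apply: sdef_and; first exact: sdef_const.
  exact: (sdef_eq (qe_rcf.Var _ _) (qe_rcf.Var _ _)).
have outE (T : Type) (f E : nat -> T) p : (p < L)%N -> blk (L + N) L f E p = E p.
  by move=> pL; rewrite blk_out // ltn_addr.
have [|E [[HB [HC HE]] Halg]] := @algebraic_point_ex (L + N) phi R phiS.
- exists (fun i => if (i < L)%N then rho i else aval (i - L)).
  split; first by move=> p pL Bp; rewrite pL; apply/(Hpin p Bp).
  split; first by move=> c cN; rewrite ltnNge leq_addr /= addKn; apply/Hspin.
  move=> f Hin; rewrite deflimitsE => [Hl|c cN]; last by rewrite ltnNge leq_addr /= addKn.
  have [||p pL [op [Bp Hp]]] := key f Hl.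
  + move=> p pL op Bp; have [_ /(_ Bp)] := Hin p pL op.
    by rewrite blk_in // outE // pL.
  + move=> p pL op; have [[b1 b2] _] := Hin p pL op; move: b1 b2; rewrite blk_in // => b1 b2.
    have [? ? ? ?] := Hbox p; rewrite ler_norml; apply/andP; split; lra.
  + by exists p => //; rewrite blk_in // outE // pL.
have EB p : (p < L)%N -> B p -> E p = rho p by move=> pL Bp; apply/(Hpin p Bp); apply: HB.
(* [rho] lies in the box and is a limiting family, so it shares with the algebraic centre a
   coordinate outside [B]. *)
have [||p pL [[op Bp] Hp]] := HE rho.
- move=> p pL op; rewrite blk_in // outE //; have [? ? ? ?] := Hbox p; split=> // Bp.
  by rewrite EB.
- by apply/deflimitsE => // c cN; apply/Hspin; apply: HC.
apply: Bp; rewrite /B; move: Hp; rewrite blk_in // outE // => ->.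
by apply: Halg; rewrite ltn_addr.
Qed.

End Refuted.

Theorem refuted_Star n M e : model_of_T_A M -> ~ sat M e (dform n) -> Star n.
Proof.
move=> HM /(refuted_matches HM) [S HS].
have [c0 a0] := aval_rat 0; have [c1 a1] := aval_rat 1; have [cm1 am1] := aval_rat (-1).
apply: (refuted_limits HS (c0 := c0) (c1 := c1) (cm1 := cm1)).
- by rewrite a0 rmorph0.
- by rewrite a1 rmorph1.
- by rewrite am1 rmorphN rmorph1.
Qed.

(** * The game of a formula *)

(** Expressions contain functions and are not coded themselves; it is enough that their truth under
    a coded assignment and their size are computable. *)
Definition bcomp (E : (nat -> nat) -> bexp) : Prop :=
  (forall B, computable B -> computable (fun e => bev (bit (B e)) (E e))) /\
  computable (fun e => bsize (E e)).

Lemma bcomp_lt A B : computable A -> computable B -> bcomp (fun e => BLt (A e) (B e)).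
Proof. by move=> HA HB; split=> [C HC|]; cbn [bev bsize]; cmp. Qed.

Lemma bcomp_cst (A : (nat -> nat) -> bool) : computable A -> bcomp (fun e => BCst (A e)).
Proof. by move=> HA; split=> [C HC|]; cbn [bev bsize]; cmp. Qed.

Lemma bcomp_and E F : bcomp E -> bcomp F -> bcomp (fun e => BAnd (E e) (F e)).
Proof.
move=> [H1 H2] [H3 H4]; split=> [B HB|]; cbn [bev bsize]; last by cmp.
by apply: comp_and; [apply: H1|apply: H3].
Qed.

Lemma bcomp_or E F : bcomp E -> bcomp F -> bcomp (fun e => BOr (E e) (F e)).
Proof.
move=> [H1 H2] [H3 H4]; split=> [B HB|]; cbn [bev bsize]; last by cmp.
by apply: comp_or; [apply: H1|apply: H3].
Qed.

Lemma bcomp_not E : bcomp E -> bcomp (fun e => BNot (E e)).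
Proof. by move=> [H1 H2]; split=> // B HB; apply: comp_neg; apply: H1. Qed.

Lemma bcomp_imp E F : bcomp E -> bcomp F -> bcomp (fun e => BImp (E e) (F e)).
Proof. by move=> HE HF; apply: bcomp_or => //; apply: bcomp_not. Qed.

Lemma bcomp_iff E F : bcomp E -> bcomp F -> bcomp (fun e => BIff (E e) (F e)).
Proof. by move=> HE HF; apply: bcomp_and; apply: bcomp_imp. Qed.

Lemma bcomp_eq A B : computable A -> computable B -> bcomp (fun e => BEq (A e) (B e)).
Proof. by move=> HA HB; apply: bcomp_and; apply: bcomp_not; apply: bcomp_lt. Qed.

Lemma bcomp_all N E : computable N -> bcomp (fun e => E (fun i => e i.+1) (e 0)) ->
  bcomp (fun e => BAll (N e) (E e)).
Proof.
move=> HN [H1 H2]; split=> [B HB|]; cbn [bev bsize].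
  apply: comp_ball => //; exact: (H1 (fun e => B (fun i => e i.+1)) (comp_shift 1 HB)).
exact: comp_bsum.
Qed.

Lemma bcomp_ex N E : computable N -> bcomp (fun e => E (fun i => e i.+1) (e 0)) ->
  bcomp (fun e => BEx (N e) (E e)).
Proof.
move=> HN [H1 H2]; split=> [B HB|]; cbn [bev bsize].
  apply: comp_bex => //; exact: (H1 (fun e => B (fun i => e i.+1)) (comp_shift 1 HB)).
exact: comp_bsum.
Qed.

(* The value at [t] of the predicate defined by the recursion [stp], by guessing
   the code of its restriction to the numbers less than [N]. *)
Definition BRec (N t : nat) (stp : nat -> nat -> bexp) : bexp :=
  BEx (2 ^ N) (fun b => BAnd (BAll N (fun i => BIff (BCst (bit b i)) (stp b i))) (BCst (bit b t))).

Lemma bcomp_rec N T E : computable N -> computable T ->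
  bcomp (fun e => E (fun i => e i.+2) (e 1) (e 0)) -> bcomp (fun e => BRec (N e) (T e) (E e)).
Proof.
move=> HN HT HE; apply: bcomp_ex; first by cmp.
apply: bcomp_and; last by apply: bcomp_cst; apply: comp_bit; [cmp|exact: (comp_shift 1 HT)].
apply: bcomp_all; first exact: (comp_shift 1 HN).
by apply: bcomp_iff => //; apply: bcomp_cst; cmp.
Qed.

Section BevIff.
Variables (P : nat -> bool) (x y : bexp) (A B : Prop).
Hypotheses (HA : bev P x <-> A) (HB : bev P y <-> B).

Lemma bev_and : bev P (BAnd x y) <-> A /\ B.
Proof. by rewrite -HA -HB; split=> /andP. Qed.

Lemma bev_or : bev P (BOr x y) <-> A \/ B.
Proof. by rewrite -HA -HB; split=> /orP. Qed.

Lemma bev_not : bev P (BNot x) <-> ~ A.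
Proof. by rewrite -HA; split=> /negP. Qed.

Lemma bev_imp : bev P (BImp x y) <-> (A -> B).
Proof. by rewrite -HA -HB /=; case: (bev P x); case: (bev P y); split=> // /(_ isT). Qed.

End BevIff.

Lemma bev_cst P (b : bool) : bev P (BCst b) <-> b. Proof. by []. Qed.

Lemma bev_iff P x y A B : (bev P x <-> A) -> (bev P y <-> B) ->
  bev P (BIff x y) <-> (A <-> B).
Proof. by move=> HA HB; apply: bev_and; apply: bev_imp. Qed.

Lemma bev_all P n f (A : nat -> Prop) : (forall i, i < n -> bev P (f i) <-> A i) ->
  bev P (BAll n f) <-> forall i, i < n -> A i.
Proof. by move=> H; split=> [/ballP Hb i iN|Ha]; [apply/H/Hb|apply/ballP => i iN; apply/H/Ha]. Qed.

Lemma bev_rec P N t stp (step : (nat -> Prop) -> nat -> Prop) :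
  (forall g h n, (forall m, m < n -> g m = h m) -> step g n = step h n) ->
  (forall b i, i < N -> bev P (stp b i) <-> step (fun j => bit b j) i) -> t < N ->
  bev P (BRec N t stp) <-> crec step False t.
Proof.
move=> ext Hs tN; split.
  move=> /bexP [b _ /andP[/ballP Hb bt]].
  suff H i : i < N -> (bit b i : Prop) = crec step False i by rewrite -(H t tN).
  elim/ltn_ind: i => i IH iN; rewrite (crecE _ ext).
  rewrite -(ext (fun j => bit b j : Prop) _ _ (fun m mi => IH m mi (ltn_trans mi iN))).
  by apply: propext; rewrite -Hs //; exact: (proj1 (bev_iff (bev_cst P _) (iff_refl _)) (Hb i iN)).
move=> Ht; have [b bN Hb] := bits_exist (fun i => `[< crec step False i >]) N.
apply/bexP; exists b => //; rewrite /= Hb //; apply/andP; split; last exact/asboolP.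
apply/ballP => i iN; apply: (proj2 (bev_iff (bev_cst P _) (iff_refl _))); rewrite Hs //.
rewrite (ext (fun j => bit b j) (crec step False) i) => [|m mi].
  by rewrite -(crecE _ ext) Hb //; split=> /asboolP.
by apply: propext; rewrite Hb ?(ltn_trans mi) //; split=> /asboolP.
Qed.

Section Atoms.
Local Open Scope ring_scope.
Variables (K : rcfType) (I : nat -> K).

Lemma bev_lt a b : bev (order_of I) (BLt a b) <-> I a < I b.
Proof. by rewrite /= order_ofE. Qed.

Lemma bev_eq a b : bev (order_of I) (BEq a b) <-> I a = I b.
Proof.
rewrite /= !order_ofE -!leNgt; split=> [/andP[H1 H2]|->]; last by rewrite lexx.
by apply/eqP; rewrite eq_le H1 H2.
Qed.

End Atoms.

Definition BLe (a b : nat) : bexp := BNot (BLt b a).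

Lemma bcomp_le A B : computable A -> computable B -> bcomp (fun e => BLe (A e) (B e)).
Proof. by move=> HA HB; apply: bcomp_not; apply: bcomp_lt. Qed.

Lemma bev_le (K : rcfType) (I : nat -> K) a b : bev (order_of I) (BLe a b) <-> (I a <= I b)%R.
Proof. by rewrite (bev_not (bev_lt _ _ _)) leNgt; split=> /negP. Qed.

(** * Polynomial values and tables of roots *)

Definition zcode (n : nat) : nat := if odd n then copp (cnat (n.+1)./2) else cnat n./2.

(* Horner's scheme; the number of coefficients listed by [l] is at most [l]. *)
Definition pcode (l a : nat) : nat :=
  nrec czero (fun i t => cadd (zcode (look l (l - i.+1))) (cmul a t)) l.

Lemma comp_zcode A : computable A -> computable (fun e => zcode (A e)).
Proof. by move=> HA; apply: comp_if; cmp. Qed.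

Lemma comp_pcode A B : computable A -> computable B -> computable (fun e => pcode (A e) (B e)).
Proof.
move=> HA HB; apply: comp_nrec => //; first by cmp.
apply: comp_cadd; last by apply: comp_cmul; [exact: (comp_shift 2 HB)|cmp].
by apply: comp_zcode; apply: comp_look; [|apply: comp_subn]; try exact: (comp_shift 2 HA); cmp.
Qed.

Lemma look0 j : look 0 j = 0.
Proof.
by rewrite /look (_ : nrec 0 _ j = 0) //; elim: j => //= j ->.
Qed.

Lemma look_declist l j : look l j = nth 0 (declist l) j.
Proof.
elim: j l => [|j IH] [|l]; rewrite declistE ?look0 //.
by rewrite lookS IH.
Qed.

Lemma size_declist l : size (declist l) <= l.
Proof.
elim/ltn_ind: l => -[|l] IH; rewrite declistE //= ltnS.
have H := ltn_ltl (ltn0Sn l); by apply: leq_trans (IH _ H) _; rewrite -ltnS.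
Qed.

Section PolyCode.
Local Open Scope ring_scope.

Lemma coef_cpoly (K : nzRingType) l j : (cpoly K l)`_j = zcoef K (look l j).
Proof.
rewrite /cpoly coef_Poly look_declist; have [lt|ge] := ltnP j (size (declist l)).
  exact: (nth_map 0%N).
by rewrite !nth_default ?size_map // /zcoef /= mulr0n.
Qed.

Variables (K : rcfType) (I : nat -> K).
Hypothesis HI : code_hom I.

Lemma hom_zcode n : I (zcode n) = zcoef K n.
Proof. by rewrite /zcode /zcoef; case: ifP => _; rewrite ?(hom_opp HI) (hom_cnat HI). Qed.

Lemma hom_pcode l a : I (pcode l a) = (cpoly K l).[I a].
Proof.
rewrite (@horner_coef_wide _ l); last first.
  by apply: leq_trans (size_Poly _) _; rewrite size_map size_declist.
have E m : (m <= l)%N -> I (nrec czero (fun i t => cadd (zcode (look l (l - i.+1))) (cmul a t)) m) =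
    \sum_(i < m) zcoef K (look l (l - m + i)) * I a ^+ i.
  elim: m => [|m IH] lm; first by rewrite big_ord0 (hom_zero HI).
  rewrite [LHS]/= (hom_add HI) (hom_mul HI) hom_zcode IH ?(ltnW lm) // big_ord_recl addn0 expr0 mulr1.
  congr (_ + _); rewrite mulr_sumr; apply: eq_bigr => i _; rewrite exprS mulrCA.
  by congr (zcoef K (look l _) * _); rewrite /= /bump leq0n; lia.
rewrite [LHS]E // subnn; apply: eq_bigr => i _; by rewrite coef_cpoly.
Qed.

End PolyCode.

Definition nonzero_code (l : nat) : bool := bex l (fun j => look l j != 0).

Lemma nonzero_codeE l : nonzero_code l = (cpoly R l != 0%R).
Proof.
rewrite cpoly_eq0 -has_predC; apply/bexP/(has_nthP 0) => [[j jl]|[j js] /=]; rewrite ?look_declist.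
  move=> lj; exists j; rewrite //= ltnNge; apply: contraNN lj => H.
  by rewrite nth_default.
by exists j; rewrite ?look_declist // (leq_trans js) // size_declist.
Qed.

Section PinAt.
Local Open Scope ring_scope.

(* As [y] varies, this makes [x] list the roots of the polynomial coded by [l]
   in increasing order, the last one repeated, or [0] if there is none. *)
Definition pin_at (K : rcfType) (N l : nat) (x : nat -> K) (y : K) : Prop :=
  let p := cpoly K l in
  (nonzero_code l ->
    (~ root p (x 0) -> x 0%N = 0) /\
    (root p y -> root p (x 0) /\ x 0 <= y) /\
    forall j, (j < N.-1)%N ->
      (x j.+1 = x j /\ (root p y -> y <= x j)) \/
      ((x j < x j.+1 /\ root p (x j.+1)) /\ (root p y -> y <= x j \/ x j.+1 <= y))) /\
  (~~ nonzero_code l -> forall j, (j < N)%N -> x j = 0).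

(** As [y] is universal, each table may be tested against the entries of the other; by induction
    neither can skip a root. *)
Lemma pin_at_unique (K : rcfType) N l (x x' : nat -> K) :
  (forall y, pin_at N l x y) -> (forall y, pin_at N l x' y) ->
  forall j, (j < N)%N -> x j = x' j.
Proof.
move=> H H'; case: (boolP (nonzero_code l)) => nz; last first.
  by move=> j jN; rewrite (proj2 (H 0) nz j jN) (proj2 (H' 0) nz j jN).
have {}H y := proj1 (H y) nz; have {}H' y := proj1 (H' y) nz.
set p := cpoly K l in H H'; elim=> [|j IH] jN.
  case: (boolP (root p (x 0))) => rx.
    have [_ [/(_ rx) [rx' le1] _]] := H' (x 0%N).
    have [_ [/(_ rx') [_ le2] _]] := H (x' 0%N).
    by apply/eqP; rewrite eq_le le1 le2.
  case: (boolP (root p (x' 0))) => rx'; last first.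
    by rewrite (proj1 (H 0) (elimT negP rx)) (proj1 (H' 0) (elimT negP rx')).
  by have [_ [/(_ rx') [rx2]]] := H (x' 0%N); rewrite rx2 in rx.
have jN' : (j < N.-1)%N by lia.
have {}IH : x j = x' j by apply: IH; apply: ltnW.
have A y := proj2 (proj2 (H y)) j jN'; have A' y := proj2 (proj2 (H' y)) j jN'.
case: (A (x' j.+1)) => [[E1 L1]|[[lt1 r1] L1]]; case: (A' (x j.+1)) => [[E2 L2]|[[lt2 r2] L2]].
- by rewrite E1 E2.
- by have := L1 r2; rewrite leNgt IH lt2.
- by have := L2 r1; rewrite leNgt -IH lt1.
apply/eqP; rewrite eq_le.
case: (L1 r2) => [|->]; first by rewrite leNgt IH lt2.
by case: (L2 r1) => [|-> //]; rewrite leNgt -IH lt1.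
Qed.

Lemma aroot_leq l i j : (i <= j)%N -> aroot l i <= aroot l j.
Proof.
rewrite /aroot; set rs := rootsR _ => ij.
have srt : sorted <=%R rs by apply: sub_sorted (sorted_roots _ _ _) => x y; apply: ltW.
have M := sorted_leq_nth (@le_trans _ R) (@lexx _ R) (last 0 rs) srt.
have [js|sj] := ltnP j (size rs); first by apply: M; rewrite ?inE ?(leq_ltn_trans ij).
rewrite [leRHS]nth_default //; have [is_|si] := ltnP i (size rs); last by rewrite nth_default.
have s0 : (0 < size rs)%N by apply: leq_ltn_trans is_.
rewrite -[leRHS](_ : nth (last 0 rs) rs (size rs).-1 = _); last first.
  by rewrite -nth_last; apply: set_nth_default; rewrite prednK.
by apply: M; rewrite ?inE ?prednK // -ltnS prednK.
Qed.

Lemma aroot_ltn l i j : (i < j < size (rootsR (cpoly R l)))%N -> aroot l i < aroot l j.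
Proof.
move=> /andP[ij js]; apply: (sorted_ltn_nth (@lt_trans _ R) _ (sorted_roots _ _ _)); rewrite ?inE //.
exact: ltn_trans js.
Qed.

Lemma aroot_default l i j : (size (rootsR (cpoly R l)) <= i.+1)%N -> (i <= j)%N ->
  aroot l j = aroot l i.
Proof.
move=> si ij; suff E k : (size (rootsR (cpoly R l)) <= k.+1)%N -> aroot l k = last 0 (rootsR (cpoly R l)).
  by rewrite !E // (leq_trans si).
rewrite /aroot leq_eqVlt => /orP[/eqP sk|sk]; last by rewrite nth_default.
rewrite -nth_last sk /=; apply: set_nth_default; by rewrite sk.
Qed.

Lemma aroot_onto l y : cpoly R l != 0 -> root (cpoly R l) y ->
  exists2 k, (k < size (rootsR (cpoly R l)))%N & y = aroot l k.
Proof.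
move=> p0; rewrite -root_rootsR // => yr; exists (index y (rootsR (cpoly R l))).
  by rewrite index_mem.
by rewrite /aroot nth_index.
Qed.

Lemma aroot_root l k : (k < size (rootsR (cpoly R l)))%N -> cpoly R l != 0 ->
  root (cpoly R l) (aroot l k).
Proof. by move=> ks p0; rewrite -root_rootsR //; apply: mem_nth. Qed.

Lemma pin_at_aroot N l y : pin_at N l (aroot l) y.
Proof.
split; rewrite nonzero_codeE => p0; last first.
  by move=> j _; move/negPn/eqP: p0; rewrite /aroot => ->; rewrite rootsR0 nth_nil.
split.
  case: (posnP (size (rootsR (cpoly R l)))) => [/size0nil E _|s0 []].
    by rewrite /aroot E nth_nil.
  exact: aroot_root.
split=> [/(aroot_onto p0) [k ks ->]|j _].
  by split; [apply: aroot_root => //; apply: leq_ltn_trans ks|apply: aroot_leq].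
case: (ltnP j.+1 (size (rootsR (cpoly R l)))) => js.
  right; split; first by rewrite aroot_ltn ?ltnSn //; split=> //; apply: aroot_root.
  move=> /(aroot_onto p0) [k ks ->]; case: (leqP k j) => kj.
    by left; apply: aroot_leq.
  by right; apply: aroot_leq.
left; split; first exact: aroot_default.
move=> /(aroot_onto p0) [k ks ->]; apply: aroot_leq; lia.
Qed.

(** The table repeats the last root past the end, so an index is genuine when its entry is a root
    and exceeds the preceding entry. *)
Definition valid_at (K : rcfType) (x : nat -> nat -> K) (c : nat) : Prop :=
  nonzero_code (ufst c) /\ root (cpoly K (ufst c)) (x (ufst c) (usnd c)) /\
  (usnd c = 0%N \/ x (ufst c) (usnd c).-1 < x (ufst c) (usnd c)).

Lemma valid_at_aroot c : valid_at aroot c <-> avalid c.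
Proof.
rewrite /valid_at /avalid nonzero_codeE; split=> [[p0 [rt H]]|[p0 ks]].
  split=> //; rewrite ltnNge; apply/negP => sk; case: H => [k0|].
    move: rt; rewrite /aroot nth_default // -root_rootsR //.
    by move: sk; rewrite k0 leqn0 size_eq0 => /eqP ->.
  case: (usnd c) sk => [|k] sk; first by rewrite ltxx.
  by rewrite (@aroot_default _ k k.+1) ?ltxx.
split=> //; split; first exact: aroot_root.
by case: (usnd c) ks => [|k] ks; [left|right; rewrite aroot_ltn //= ltnSn].
Qed.

End PinAt.

(** * The matrix of the game *)

Section MatrixParts.
Variables (S V W : nat -> nat).

Definition BRoot (l a : nat) : bexp := BEq (pcode l a) czero.

Definition BPin (N l : nat) (X : nat -> nat) (y : nat) : bexp :=
  BAnd
    (BImp (BCst (nonzero_code l))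
      (BAnd (BImp (BNot (BRoot l (X 0))) (BEq (X 0) czero))
      (BAnd (BImp (BRoot l y) (BAnd (BRoot l (X 0)) (BLe (X 0) y)))
        (BAll N.-1 (fun j => BOr
          (BAnd (BEq (X j.+1) (X j)) (BImp (BRoot l y) (BLe y (X j))))
          (BAnd (BAnd (BLt (X j) (X j.+1)) (BRoot l (X j.+1)))
            (BImp (BRoot l y) (BOr (BLe y (X j)) (BLe (X j.+1) y)))))))))
    (BImp (BCst (~~ nonzero_code l)) (BAll N (fun j => BEq (X j) czero))).

Definition BValid (X : nat -> nat -> nat) (c : nat) : bexp :=
  BAnd (BCst (nonzero_code (ufst c))) (BAnd (BRoot (ufst c) (X (ufst c) (usnd c)))
    (BOr (BCst (usnd c == 0)) (BLt (X (ufst c) (usnd c).-1) (X (ufst c) (usnd c))))).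

Definition BAddnode (i : nat) : bexp :=
  BAnd (BImp (BCst ((ufst i == 1) || (7 < ufst i))) (BEq (V i) czero))
  (BAnd (BImp (BCst (ufst i == 2)) (BEq (V i) cone))
  (BAnd (BImp (BCst (ufst i == 3)) (BEq (V i) (cadd (V (arg1 i)) (V (arg2 i)))))
  (BAnd (BImp (BCst (ufst i == 4)) (BEq (V i) (cadd (V (arg1 i)) (copp (V (arg2 i))))))
    (BImp (BCst (ufst i == 7)) (BEq (V i) (cmul (S (arg1 i)) (V (arg2 i)))))))).

Definition BMulnode (i : nat) : bexp :=
  BAnd (BImp (BCst ((ufst i == 1) || (7 < ufst i))) (BEq (V i) czero))
  (BAnd (BImp (BCst (ufst i == 2)) (BEq (V i) cone))
  (BAnd (BImp (BCst (ufst i == 5)) (BEq (V i) (cmul (V (arg1 i)) (V (arg2 i)))))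
  (BAnd (BImp (BCst (ufst i == 6)) (BEq (V i) (cmul (V (arg1 i)) (cinv (V (arg2 i))))))
    (BImp (BCst (ufst i == 7)) (BEq (V i) (cmul (S (arg1 i)) (V (arg2 i)))))))).

Definition BSgn (a b : nat) : bexp :=
  BAnd (BIff (BLt czero a) (BLt czero b)) (BIff (BLt a czero) (BLt b czero)).

(* |a| <= e |y| *)
Definition BBound (a e y : nat) : bexp :=
  BAnd (BImp (BLe czero y) (BAnd (BLe (copp (cmul e y)) a) (BLe a (cmul e y))))
    (BImp (BLt y czero) (BAnd (BLe (cmul e y) a) (BLe a (copp (cmul e y))))).

Definition BNear (e r x y x' y' : nat) : bexp :=
  BAnd (BBound (cadd x (copp (cmul r y))) e y)
    (BAnd (BBound (cadd x' (copp (cmul r y'))) e y')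
      (BSgn (cadd x (copp (cmul r y))) (cadd x' (copp (cmul r y'))))).

Definition BTruth (q : nat) : bexp := BRec q.+1 q (fun b t =>
  BOr (BAnd (BCst (ufst t == 1)) (BEq (V (arg1 t)) (V (arg2 t))))
  (BOr (BAnd (BCst (ufst t == 2)) (BLt (V (arg1 t)) (V (arg2 t))))
  (BCst ((ufst t == 3) && ~~ bit b (usnd t) ||
    ((ufst t == 4) && (bit b (arg1 t) && bit b (arg2 t)) ||
    ((ufst t == 5) && (bit b (arg1 t) || bit b (arg2 t)) ||
    ((ufst t == 6) && (~~ bit b (arg1 t) || bit b (arg2 t))))))))).

Definition BWft (va : nat -> bexp) (k N t : nat) : bexp := BRec N t (fun b t =>
  BOr (BCst ((ufst t == 0) && (usnd t < k) ||
    (((ufst t == 1) || (ufst t == 2)) && (usnd t == 0) ||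
    ((2 < ufst t) && (ufst t < 7) && (bit b (arg1 t) && bit b (arg2 t))))))
  (BAnd (BCst ((ufst t == 7) && bit b (arg2 t))) (va (arg1 t)))).

Definition BWff (va : nat -> bexp) (k N t : nat) : bexp := BRec N t (fun b t =>
  BOr (BCst ((ufst t == 0) && (usnd t == 0) ||
    ((ufst t == 3) && bit b (usnd t) ||
    ((3 < ufst t) && (ufst t < 7) && (bit b (arg1 t) && bit b (arg2 t))))))
  (BAnd (BCst ((ufst t == 1) || (ufst t == 2)))
    (BAnd (BWft va k N (arg1 t)) (BWft va k N (arg2 t))))).

End MatrixParts.

Definition BSolution (S V W : nat -> nat) (q : nat) : bexp :=
  BAnd (BAll q.+4 (fun i => BAnd (BAddnode S V i) (BAnd (BMulnode S W i) (BSgn (V i) (W i)))))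
    (BNot (BTruth V q)).

Lemma falseA (P : Prop) : (false /\ P) <-> False. Proof. by split=> // -[]. Qed.
Lemma trueA (P : Prop) : (true /\ P) <-> P. Proof. by split=> // -[]. Qed.
Lemma falseO (P : Prop) : (False \/ P) <-> P. Proof. by split=> [[]|] //; right. Qed.
Lemma OFalse (P : Prop) : (P \/ False) <-> P. Proof. by split=> [[]|] //; left. Qed.
Lemma bfalseO (P : Prop) : (false \/ P) <-> P. Proof. by split=> [[]|] //; right. Qed.
Lemma Ofalse (P : Prop) : (P \/ false) <-> P. Proof. by split=> [[]|] //; left. Qed.

Section MatrixMeaning.
Local Open Scope ring_scope.
Variables (K : rcfType) (I : nat -> K).
Hypothesis HI : code_hom I.
Notation ev x := (bev (order_of I) x).

Let hE := (hom_zero HI, hom_one HI, hom_add HI, hom_opp HI, hom_mul HI, hom_inv HI).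

Lemma bev_root l a : ev (BRoot l a) <-> root (cpoly K l) (I a).
Proof.
rewrite /BRoot bev_eq (hom_pcode HI) (hom_zero HI) /root.
by split=> /eqP.
Qed.

Lemma bev_lt0 a : ev (BLt a czero) <-> I a < 0. Proof. by rewrite bev_lt hE. Qed.
Lemma bev_gt0 a : ev (BLt czero a) <-> 0 < I a. Proof. by rewrite bev_lt hE. Qed.
Lemma bev_eq0 a : ev (BEq a czero) <-> I a = 0. Proof. by rewrite bev_eq hE. Qed.

Ltac bev_split := lazymatch goal with
  | |- is_true (bev _ (BRoot _ _)) <-> _ => exact: bev_root
  | |- is_true (bev _ (BEq _ czero)) <-> _ => exact: bev_eq0
  | |- is_true (bev _ (BEq _ _)) <-> _ => exact: bev_eq
  | |- is_true (bev _ (BLt _ czero)) <-> _ => exact: bev_lt0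
  | |- is_true (bev _ (BLt czero _)) <-> _ => exact: bev_gt0
  | |- is_true (bev _ (BLt _ _)) <-> _ => exact: bev_lt
  | |- is_true (bev _ (BLe _ _)) <-> _ => exact: bev_le
  | |- is_true (bev _ (BIff _ _)) <-> _ => apply: bev_iff; bev_split
  | |- is_true (bev _ (BImp _ _)) <-> _ => apply: bev_imp; bev_split
  | |- is_true (bev _ (BAnd _ _)) <-> _ => apply: bev_and; bev_split
  | |- is_true (bev _ (BOr _ _)) <-> _ => apply: bev_or; bev_split
  | |- is_true (bev _ (BNot _)) <-> _ => apply: bev_not; bev_split
  | |- is_true (bev _ (BAll _ _)) <-> _ => apply: bev_all => ? ?; bev_split
  | |- is_true (bev _ (BCst _)) <-> _ => try exact: bev_cst
  | _ => idtac
  end.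

Lemma bev_pin N l X y : ev (BPin N l X y) <-> pin_at N l (I \o X) (I y).
Proof. by rewrite /BPin /pin_at; bev_split. Qed.

Lemma bev_valid X c : ev (BValid X c) <-> valid_at (fun l j => I (X l j)) c.
Proof.
rewrite /BValid /valid_at; bev_split.
by rewrite bev_cst; split=> /eqP.
Qed.

Lemma bev_addnode S V i : ev (BAddnode S V i) <-> addnode (I \o S) (I \o V) i.
Proof.
have -> : ev (BAddnode S V i) <-> ((ufst i == 1%N) || (7 < ufst i)%N -> I (V i) = 0) /\
    (ufst i == 2%N -> I (V i) = I cone) /\
    (ufst i == 3%N -> I (V i) = I (cadd (V (arg1 i)) (V (arg2 i)))) /\
    (ufst i == 4%N -> I (V i) = I (cadd (V (arg1 i)) (copp (V (arg2 i))))) /\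
    (ufst i == 7%N -> I (V i) = I (cmul (S (arg1 i)) (V (arg2 i)))).
  by rewrite /BAddnode; bev_split.
rewrite !hE /addnode; case: (ufst i) => [|[|[|[|[|[|[|[|j]]]]]]]] /=;
  split=> [[H1 [H2 [H3 [H4 H5]]]]|H]; by [|apply: H1|apply: H2|apply: H3|apply: H4|apply: H5].
Qed.

Lemma bev_mulnode S V i : ev (BMulnode S V i) <-> mulnode (I \o S) (I \o V) i.
Proof.
have -> : ev (BMulnode S V i) <-> ((ufst i == 1%N) || (7 < ufst i)%N -> I (V i) = 0) /\
    (ufst i == 2%N -> I (V i) = I cone) /\
    (ufst i == 5%N -> I (V i) = I (cmul (V (arg1 i)) (V (arg2 i)))) /\
    (ufst i == 6%N -> I (V i) = I (cmul (V (arg1 i)) (cinv (V (arg2 i))))) /\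
    (ufst i == 7%N -> I (V i) = I (cmul (S (arg1 i)) (V (arg2 i)))).
  by rewrite /BMulnode; bev_split.
rewrite !hE /mulnode; case: (ufst i) => [|[|[|[|[|[|[|[|j]]]]]]]] /=;
  split=> [[H1 [H2 [H3 [H4 H5]]]]|H]; by [|apply: H1|apply: H2|apply: H3|apply: H4|apply: H5].
Qed.

Lemma bev_sgn a b : ev (BSgn a b) <-> Num.sg (I a) = Num.sg (I b).
Proof.
have -> : ev (BSgn a b) <-> (0 < I a <-> 0 < I b) /\ (I a < 0 <-> I b < 0).
  by rewrite /BSgn; bev_split.
split=> [[[H1 H2] [H3 H4]]|E]; last first.
  rewrite -(sgr_gt0 (I a)) -(sgr_gt0 (I b)) -(sgr_lt0 (I a)) -(sgr_lt0 (I b)).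
  by rewrite E.
case: (ltgtP (I a) 0) H1 H2 H3 H4 => [a0|a0|->] H1 H2 H3 H4.
- by rewrite !ltr0_sg //; apply: H3.
- by rewrite !gtr0_sg //; apply: H1.
case: (ltgtP (I b) 0) H2 H4 => [b0|b0|->] H2 H4 //; first by have := H4 isT.
by have := H2 isT.
Qed.

Lemma bev_bound a e y : ev (BBound a e y) <-> `|I a| <= I e * `|I y|.
Proof.
have -> : ev (BBound a e y) <-> (I czero <= I y -> I (copp (cmul e y)) <= I a /\ I a <= I (cmul e y)) /\
    (I y < 0 -> I (cmul e y) <= I a /\ I a <= I (copp (cmul e y))).
  by rewrite /BBound; bev_split.
rewrite !hE; case: (ltrP (I y) 0) => y0.
  rewrite (ltr0_norm y0) ler_norml mulrN opprK.
  by split=> [[_ /(_ isT) [-> ->]]|/andP[? ?]].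
rewrite (ger0_norm y0) ler_norml.
by split=> [[/(_ isT) [-> ->]]|/andP[? ?]].
Qed.

Lemma bev_near e r x y x' y' : ev (BNear e r x y x' y') <->
  near (I e) (I r) (I x) (I y) (I x') (I y').
Proof.
rewrite /BNear /near -!hE; apply: bev_and; first exact: bev_bound.
by apply: bev_and; [apply: bev_bound|apply: bev_sgn].
Qed.

Lemma bev_truth V q : ev (BTruth V q) <->
  ftruth (fun a b => I (V a) = I (V b)) (fun a b => I (V a) < I (V b)) q.
Proof.
apply: bev_rec => //; first exact: ftruth_step_ext.
move=> b t _; set A := bit b; rewrite /ftruth_step.
have -> : ev (BOr (BAnd (BCst (ufst t == 1)) (BEq (V (arg1 t)) (V (arg2 t))))
  (BOr (BAnd (BCst (ufst t == 2)) (BLt (V (arg1 t)) (V (arg2 t))))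
  (BCst ((ufst t == 3) && ~~ bit b (usnd t) ||
    ((ufst t == 4) && (bit b (arg1 t) && bit b (arg2 t)) ||
    ((ufst t == 5) && (bit b (arg1 t) || bit b (arg2 t)) ||
    ((ufst t == 6) && (~~ bit b (arg1 t) || bit b (arg2 t))))))))) <->
  (ufst t == 1%N /\ I (V (arg1 t)) = I (V (arg2 t))) \/ (ufst t == 2%N /\ I (V (arg1 t)) < I (V (arg2 t)))
  \/ ((ufst t == 3) && ~~ A (usnd t) ||
    ((ufst t == 4) && (A (arg1 t) && A (arg2 t)) ||
    ((ufst t == 5) && (A (arg1 t) || A (arg2 t)) ||
    ((ufst t == 6) && (~~ A (arg1 t) || A (arg2 t)))))).
  by bev_split.
case: (ufst t) => [|[|[|[|[|[|[|j]]]]]]]; rewrite /=;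
  rewrite ?falseA ?trueA ?falseO ?Ofalse ?orbF.
- by [].
- by [].
- by [].
- by split=> /negP.
- by split=> /andP.
- by split=> /orP.
- by case: (A _); case: (A _); split=> // /(_ isT).
- by [].
Qed.

Lemma bev_wft va (vaP : nat -> Prop) k N t : (forall c, (c < N)%N -> ev (va c) <-> vaP c) ->
  (t < N)%N -> ev (BWft va k N t) <-> wft vaP k t.
Proof.
move=> Hva tN; apply: bev_rec => //; first exact: wft_step_ext.
move=> b i iN; set A := bit b; rewrite /wft_step.
have := ltn_arg1 (t := i).
set B := BCst _; set C := BCst _.
have -> : ev (BOr B (BAnd C (va (arg1 i)))) <-> bev (order_of I) B \/ (bev (order_of I) C /\ ev (va (arg1 i))).
  by apply: bev_or => //; apply: bev_and.
rewrite /B /C -/A; case: (ufst i) => [|[|[|[|[|[|[|[|j]]]]]]]] a1; rewrite /= ?andbF;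
  rewrite ?falseA ?trueA ?falseO ?bfalseO ?Ofalse ?OFalse ?orbF; try by [|split=> /andP|split=> /eqP].
by rewrite Hva ?(ltn_trans (a1 isT)) // and_comm.
Qed.

Lemma bev_wff va (vaP : nat -> Prop) k N t : (forall c, (c < N)%N -> ev (va c) <-> vaP c) ->
  (t < N)%N -> ev (BWff va k N t) <-> wff vaP k t.
Proof.
move=> Hva tN; apply: bev_rec => //; first exact: wff_step_ext.
move=> b i iN; set A := bit b; rewrite /wff_step.
have := ltn_arg1 (t := i); have := ltn_arg2 (t := i).
set B := BCst _; set C := BCst _; set W1 := BWft _ _ _ _; set W2 := BWft _ _ _ _.
have -> : ev (BOr B (BAnd C (BAnd W1 W2))) <-> ev B \/ (ev C /\ (ev W1 /\ ev W2)).
  by apply: bev_or => //; apply: bev_and => //; apply: bev_and.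
rewrite /B /C -/A; case: (ufst i) => [|[|[|[|[|[|[|j]]]]]]] a2 a1; rewrite /= ?andbF;
  rewrite ?falseA ?trueA ?falseO ?bfalseO ?Ofalse ?OFalse ?orbF; try by [|split=> /andP|split=> /eqP].
- by rewrite /W1 /W2 !(bev_wft _ Hva) ?(ltn_trans (a1 isT)) ?(ltn_trans (a2 isT)).
- by rewrite /W1 /W2 !(bev_wft _ Hva) ?(ltn_trans (a1 isT)) ?(ltn_trans (a2 isT)).
Qed.

Lemma bev_solution S V W q : ev (BSolution S V W q) <->
  solution (I \o S) q (I \o V) (I \o W).
Proof.
apply: bev_and; last by apply: bev_not; apply: bev_truth.
apply: bev_all => i _; apply: bev_and; first exact: bev_addnode.
by apply: bev_and; [apply: bev_mulnode|apply: bev_sgn].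
Qed.

End MatrixMeaning.

(** * Blocks of equal quantifiers *)

Lemma blkS (T : Type) o l (f e : nat -> T) :
  blk o l.+1 f e = blk o.+1 l (fun j => f j.+1) (upd e o (f 0)).
Proof.
apply/funext => i; rewrite /blk /upd; case: (ltngtP o i) => [oi|io|<-] /=.
- by rewrite addSnnS; case: ifP => // _; rewrite -(subnSK oi).
- by [].
- by rewrite -addSnnS leq_addr subnn.
Qed.

Lemma blk0 (T : Type) o (f e : nat -> T) : blk o 0 f e = e.
Proof. by apply/funext => i; rewrite /blk addn0; case: leqP => //= h; rewrite ltnNge h. Qed.

Section Blocks.
Variables (kind : nat -> bool) (Th : forall K : rcfType, (nat -> K) -> Prop) (K : rcfType).

Lemma ptrue_all_block l m i (e : nat -> K) : (forall j, j < l -> kind (i + j)) ->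
  ptrue kind Th (l + m) i e <-> forall f, ptrue kind Th m (i + l) (blk i l f e).
Proof.
elim: l i e => [|l IH] i e Hk.
  by rewrite addn0; split=> [H f|/(_ e)]; rewrite blk0.
rewrite addSn /= -[in kind i](addn0 i) Hk //; split=> [H f|H x].
  by rewrite blkS -addSnnS; move: (fun j => f j.+1); apply/IH => // j jl; rewrite addSnnS Hk.
apply/IH => [j jl|f]; first by rewrite addSnnS Hk.
by have := H (fun j => if j is j'.+1 then f j' else x); rewrite blkS -addSnnS.
Qed.

Lemma ptrue_ex_block l m i (e : nat -> K) : (forall j, j < l -> ~~ kind (i + j)) ->
  ptrue kind Th (l + m) i e <-> exists f, ptrue kind Th m (i + l) (blk i l f e).
Proof.
elim: l i e => [|l IH] i e Hk.
  by rewrite addn0; split=> [H|[f]]; [exists e|]; rewrite blk0.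
rewrite addSn /= -[in kind i](addn0 i) (negbTE (Hk _ _)) //.
have Hk' j : j < l -> ~~ kind (i.+1 + j) by move=> jl; rewrite addSnnS Hk.
split=> [[x /(IH _ _ Hk') [f Hf]]|[f Hf]].
  by exists (fun j => if j is j'.+1 then f j' else x); rewrite blkS -addSnnS.
by exists (f 0); apply/IH => //; exists (fun j => f j.+1); rewrite addSnnS -blkS.
Qed.

End Blocks.

Lemma wft_ext va va' k N t : t < N -> (forall c, c < N -> va c <-> va' c) ->
  wft va k t <-> wft va' k t.
Proof.
move=> tN Hva; elim/ltn_ind: t tN => t IH tN; rewrite !wftE /wft_step.
have := ltn_arg1 (t := t); have := ltn_arg2 (t := t).
case: (ufst t) => [|j] //; move=> /(_ isT) H2 /(_ isT) H1.
have N1 := ltn_trans H1 tN; have I2 := IH _ H2 (ltn_trans H2 tN); have I1 := IH _ H1 N1.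
have I3 := Hva _ N1; do 7?[case: j => [|j] //]; tauto.
Qed.

Lemma wff_ext va va' k N t : t < N -> (forall c, c < N -> va c <-> va' c) ->
  wff va k t <-> wff va' k t.
Proof.
move=> tN Hva; elim/ltn_ind: t tN => t IH tN; rewrite !wffE /wff_step.
have := ltn_arg1 (t := t); have := ltn_arg2 (t := t); have := ltn_usnd (n := t).
case: (ufst t) => [|j] //; move=> /(_ isT) H0 /(_ isT) H2 /(_ isT) H1.
have I2 := IH _ H2 (ltn_trans H2 tN); have I1 := IH _ H1 (ltn_trans H1 tN).
have I0 := IH _ H0 (ltn_trans H0 tN).
have J1 := wft_ext k (ltn_trans H1 tN) Hva; have J2 := wft_ext k (ltn_trans H2 tN) Hva.
do 6?[case: j => [|j] //]; tauto.
Qed.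

Lemma pin_at_ext (K : rcfType) N l (x x' : nat -> K) y : 0 < N ->
  (forall j, j < N -> x j = x' j) -> pin_at N l x y -> pin_at N l x' y.
Proof.
move=> N0 E; rewrite /pin_at -!E // => -[H1 H2]; split=> [/H1 [? [? H]]|/H2 H].
  split=> //; split=> // j jN; have [jN1 jN2] : j < N /\ j.+1 < N by split; lia.
  by rewrite -!E //; apply: H.
by move=> j jN; rewrite -E // H.
Qed.

(** * The prenex statement *)

Section GameMatrix.
Local Open Scope ring_scope.
Variable n : nat.
Let N := (core n).+4.

(** Read with [x] existential, [y] and [r] universal, [eps] existential and [h] universal, it says
    that the code is well formed and that [Star] fails. Scalars enter through the table [x] of roots
    of the polynomials with code below [N], which the tests by [y] force to be correct; all
    constants are thus rational. *)
Definition game_matrix (K : rcfType) (x : nat -> K) (y : K) (r : nat -> K) (eps : K)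
    (h : nat -> K) : Prop :=
  (forall l, (l < N)%N -> pin_at N l (fun j => x (l * N + j)%N) y) /\
  wff (valid_at (fun l j => x (l * N + j)%N)) (alls n) (core n) /\
  0 < eps /\
  ~ (solution (fun c => x (ufst c * N + usnd c)%N) (core n) h (fun i => h (N + i)%N) /\
     forall i, (i < N)%N -> forall j, (j < N)%N ->
       near eps (r (i * N + j)%N) (h i) (h j) (h (N + i)%N) (h (N + j)%N) \/
       near eps (r (j * N + i)%N) (h j) (h i) (h (N + j)%N) (h (N + i)%N)).

Lemma idx_lt i j : (i < N)%N -> (j < N)%N -> (i * N + j < N * N)%N.
Proof.
move=> iN jN; have H : (i.+1 * N <= N * N)%N by rewrite leq_mul2r iN orbT.
by apply: leq_trans H; rewrite mulSnr ltn_add2l.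
Qed.

Lemma core_lt : (core n < N)%N. Proof. by rewrite /N; lia. Qed.

Lemma ltn_codes c : (c < N)%N -> (ufst c < N)%N /\ (usnd c < N)%N.
Proof. by move=> cN; split; apply: leq_ltn_trans cN; [apply: leq_ufst|apply: leq_usnd]. Qed.

Lemma valid_at_ext (K : rcfType) (x x' : nat -> nat -> K) c : (c < N)%N ->
  (forall l j, (l < N)%N -> (j < N)%N -> x l j = x' l j) -> valid_at x c <-> valid_at x' c.
Proof.
move=> /ltn_codes [c1 c2] E; have c3 := leq_ltn_trans (leq_pred _) c2.
by rewrite /valid_at !E.
Qed.

Lemma game_matrix_ext (K : rcfType) (x x' : nat -> K) y (r r' : nat -> K) eps h h' :
  (forall p, (p < N * N)%N -> x p = x' p) -> (forall p, (p < N * N)%N -> r p = r' p) ->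
  (forall i, (i < N + N)%N -> h i = h' i) ->
  game_matrix x y r eps h -> game_matrix x' y r' eps h'.
Proof.
move=> Ex Er Eh [H1 [H2 [H3 H4]]]; split.
  move=> l lN; apply: pin_at_ext (H1 l lN) => // j jN; exact: Ex (idx_lt lN jN).
split.
  apply: (proj1 (wff_ext _ core_lt _)) H2 => c cN.
  by apply: valid_at_ext => // l j lN jN; apply: Ex (idx_lt lN jN).
split=> // -[Hs Hn]; apply: H4.
have h1 i : (i < N)%N -> h' i = h i by move=> iN; rewrite Eh // ltn_addr.
have h2 i : (i < N)%N -> h' (N + i)%N = h (N + i)%N by move=> iN; rewrite Eh // ltn_add2l.
split.
  by apply: solution_ext Hs => // c /ltn_codes [c1 c2]; rewrite Ex // idx_lt.
by move=> i iN j jN; have := Hn i iN j jN; rewrite !(h2 _ iN) !(h2 _ jN) !(h1 _ iN) !(h1 _ jN) !Er ?idx_lt.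
Qed.

Lemma sdef_pin_at l (xi : nat -> nat) yi :
  sdef (fun K E => pin_at N l (fun j => E (xi j)) (E yi)).
Proof.
have R i : sdef (fun K E => root (cpoly K l) (E i)).
  by apply: (sdef_iff _ (sdef_root (cpoly rat l) i)) => K E; rewrite map_cpoly.
have Q i j : sdef (fun K E => E i = E j) := sdef_eq (qe_rcf.Var _ i) (qe_rcf.Var _ j).
have Z i : sdef (fun K E => E i = 0) := sdef_eq0 (qe_rcf.Var _ i).
have T i j : sdef (fun K E => E i < E j) := sdef_lt (qe_rcf.Var _ i) (qe_rcf.Var _ j).
have U i j : sdef (fun K E => E i <= E j).
  by apply: (sdef_iff _ (sdef_not (T j i))) => K E; rewrite leNgt; split=> /negP.
have C (b : bool) : sdef (fun K E => b) := sdef_const b.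
apply: sdef_and; apply: sdef_imp => //; last by apply: sdef_all_lt.
apply: sdef_and; first by apply: sdef_imp; [apply: sdef_not|].
apply: sdef_and; first by apply: sdef_imp; [|apply: sdef_and].
apply: sdef_all_lt => j _; apply: sdef_or; first by apply: sdef_and; [|apply: sdef_imp].
by apply: sdef_and; [apply: sdef_and|apply: sdef_imp; [|apply: sdef_or]].
Qed.

Lemma sdef_wff (va : forall K : rcfType, (nat -> K) -> nat -> Prop) k t :
  (forall c, sdef (fun K E => va K E c)) -> sdef (fun K E => wff (va K E) k t).
Proof.
move=> Hva; have Hw s : sdef (fun K E => wft (va K E) k s).
  elim/ltn_ind: s => s IH.
  apply: (sdef_iff (phi := fun K E => wft_step (va K E) k (wft (va K E) k) s)).
    by move=> K E; rewrite -wftE.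
  have := ltn_arg1 (t := s); have := ltn_arg2 (t := s); rewrite /wft_step.
  case: (ufst s) => [|j]; first by move=> _ _; apply: sdef_const.
  move=> /(_ isT)/IH H2 /(_ isT)/IH H1.
  do 6?[case: j => [|j]]; try exact: sdef_const; try exact: sdef_and.
  by case: j => [|j]; [exact: sdef_and (Hva _) H2|exact: sdef_const].
elim/ltn_ind: t => t IH.
apply: (sdef_iff (phi := fun K E => wff_step (va K E) k (wff (va K E) k) t)).
  by move=> K E; rewrite -wffE.
have := ltn_arg1 (t := t); have := ltn_arg2 (t := t); have := ltn_usnd (n := t); rewrite /wff_step.
case: (ufst t) => [|j]; first by move=> _ _ _; apply: sdef_const.
move=> /(_ isT)/IH H0 /(_ isT)/IH H2 /(_ isT)/IH H1.
by do 6?[case: j => [|j]]; first [exact: sdef_const | exact: H0 | exact: sdef_and].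
Qed.

Lemma sdef_valid_at (xi : nat -> nat -> nat) c :
  sdef (fun K E => valid_at (fun l j => E (xi l j)) c).
Proof.
apply: sdef_and; first exact: sdef_const.
apply: sdef_and.
  by apply: (sdef_iff _ (sdef_root (cpoly rat (ufst c)) (xi (ufst c) (usnd c)))) => K E; rewrite map_cpoly.
apply: sdef_or; first exact: sdef_const.
exact: (sdef_lt (qe_rcf.Var _ _) (qe_rcf.Var _ _)).
Qed.

(** Layout of the variables: the table of roots, then [y] and the ratios, then [eps], then [v] and
    [w]. *)
Definition roots_end := (N * N)%N.
Definition ratios_end := (roots_end + roots_end.+1)%N.

Definition game_theory (K : rcfType) (e : nat -> K) : Prop :=
  game_matrix e (e roots_end) (fun p => e (roots_end + p.+1)%N) (e ratios_end)
    (fun i => e (ratios_end + 1 + i)%N).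

Lemma sdef_game_theory : sdef game_theory.
Proof.
apply: sdef_and; first by apply: sdef_all_lt => l _; apply: sdef_pin_at.
apply: sdef_and; first by apply: sdef_wff => c; apply: sdef_valid_at.
apply: sdef_and; first exact: (sdef_gt0 (qe_rcf.Var _ _)).
apply: sdef_not; apply: sdef_and; first exact: sdef_solution.
apply: sdef_all_lt => i _; apply: sdef_all_lt => j _.
by apply: sdef_or; apply: sdef_near.
Qed.

Definition game_kind (i : nat) : bool := (roots_end <= i)%N && (i != ratios_end).
Definition game_len := (roots_end + (roots_end.+1 + (1 + (N + N))))%N.

Lemma game_ptrue (K : rcfType) : ptrue game_kind game_theory game_len 0 (fun=> 0 : K) <->
  exists x, forall f, exists eps, forall h : nat -> K,
    game_matrix x (f 0%N) (fun p => f p.+1) eps h.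
Proof.
have E x f g h : let e := blk (ratios_end + 1) (N + N) h (blk ratios_end 1 g
    (blk roots_end roots_end.+1 f (blk 0 roots_end x (fun=> 0 : K)))) in
    game_theory e <-> game_matrix x (f 0%N) (fun p => f p.+1) (g 0%N) h.
  move=> e.
  have e1 p : (p < N * N)%N -> e p = x p.
    move=> pN; have lt1 : (p < ratios_end + 1)%N by rewrite /ratios_end /roots_end; lia.
    have lt2 : (p < ratios_end)%N by rewrite /ratios_end /roots_end; lia.
    by rewrite /e (blk_out _ _ _ lt1) (blk_out _ _ _ lt2) (blk_out _ _ _ pN) -[p in LHS]add0n blk_in.
  have e2 p : (p < roots_end.+1)%N -> e (roots_end + p)%N = f p.
    move=> pN; have lt2 : (roots_end + p < ratios_end)%N by rewrite ltn_add2l.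
    have lt1 : (roots_end + p < ratios_end + 1)%N by rewrite addn1 ltnW.
    by rewrite /e (blk_out _ _ _ lt1) (blk_out _ _ _ lt2) blk_in.
  have e3 : e ratios_end = g 0%N.
    by rewrite /e blk_out ?addn1 // -[X in blk _ _ _ _ X = _]addn0 blk_in.
  have e4 i : (i < N + N)%N -> e (ratios_end + 1 + i)%N = h i by move=> iN; rewrite /e blk_in.
  have e20 : e roots_end = f 0%N by rewrite -(e2 0%N) // addn0.
  rewrite /game_theory e3 e20; split; apply: game_matrix_ext => p pN; do ?[exact: e1 | exact: e2 | exact: e4
    | exact: esym (e1 p pN) | exact: esym (e2 p.+1 pN) | exact: esym (e4 p pN)].
have k1 j : (j < roots_end)%N -> ~~ game_kind (0 + j) by rewrite /game_kind; lia.
have k2 j : (j < roots_end.+1)%N -> game_kind (roots_end + j) by rewrite /game_kind /ratios_end; lia.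
have k3 j : (j < 1)%N -> ~~ game_kind (ratios_end + j) by rewrite /game_kind /ratios_end; lia.
have k4 j : (j < N + N)%N -> game_kind (ratios_end + 1 + j) by rewrite /game_kind /ratios_end; lia.
rewrite /game_len (ptrue_ex_block _ _ _ k1).
split=> [[x Hx]|[x Hx]]; exists x; move: Hx; rewrite (ptrue_all_block _ _ _ k2) => Hx f;
  have := Hx f; rewrite (ptrue_ex_block _ _ _ k3).
  by case=> g; rewrite -[(N + N)%N]addn0 (ptrue_all_block _ _ _ k4) => Hg; exists (g 0%N) => h;
    apply/E; apply: Hg.
case=> eps He; exists (fun=> eps); rewrite -[(N + N)%N]addn0 (ptrue_all_block _ _ _ k4) => h.
by apply/E; apply: He.
Qed.

End GameMatrix.

Lemma universal_fragment_game n : universal_fragment_T_A n <->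
  ptrue (game_kind n) (game_theory n) (game_len n) 0 (fun=> 0%R : R).
Proof.
rewrite game_ptrue universal_fragmentE; set N := (core n).+4.
have N0 : 0 < N by [].
have aN l j : j < N -> aroot ((l * N + j) %/ N) ((l * N + j) %% N) = aroot l j.
  by move=> jN; rewrite divnMDl // divn_small // addn0 modnMDl modn_small.
split=> [[Hw Hm]|[x Hx]].
  have HS : ~ Star (core n).
    by move=> /Star_model [M [env [HM Hn]]]; apply: Hn; apply: Hm.
  exists (fun p => aroot (p %/ N) (p %% N)) => f; apply: contrapT => Hn; apply: HS.
  exists (fun i j => f (i * N + j).+1) => eps eps0; apply: contrapT => Hvw; apply: Hn.
  exists eps => h; split.
    by move=> l lN; apply: (pin_at_ext N0 _ (pin_at_aroot N l (f 0))) => j jN; rewrite aN.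
  split.
    apply: (proj2 (wff_ext _ (core_lt n) _)) Hw => c cN; rewrite -valid_at_aroot.
    by apply: (valid_at_ext cN) => l j lN jN; rewrite aN.
  split=> // -[Hsol Hnear]; apply: Hvw; exists h, (fun i => h (N + i)); split.
    apply: solution_ext Hsol => // c /ltn_codes [c1 c2]; rewrite aN //.
  by move=> i j iN jN; apply: Hnear.
(* Uniqueness identifies the guessed table with the true one, since the matrix holds for every
   [y]. *)
have xE l j : l < N -> j < N -> x (l * N + j) = aroot l j.
  move=> lN jN; apply: (@pin_at_unique _ N l (fun j => x (l * N + j)) (aroot l)) => // y.
    by have [eps /(_ (fun=> 0%R)) [/(_ l lN)]] := Hx (fun=> y).
  exact: pin_at_aroot.
split.
  have [eps /(_ (fun=> 0%R)) [_ [Hw _]]] := Hx (fun=> 0%R).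
  apply: (proj1 (wff_ext _ (core_lt n) _)) Hw => c cN; rewrite -valid_at_aroot.
  by apply: (valid_at_ext cN) => l j lN jN; rewrite xE.
move=> M HM e; apply: contrapT => /(refuted_Star HM) [rho Hrho].
(* The ratios of [Star] are played as the universal moves, and its approximations at the answered
   [eps] are the last block of moves. *)
have [eps Heps] := Hx (fun p => if p is p'.+1 then rho (p' %/ N) (p' %% N) else 0%R).
have [_ [_ [eps0 _]]] := Heps (fun=> 0%R).
have [v [w [Hsol Hnear]]] := Hrho eps eps0.
have [_ [_ [_]]] := Heps (fun i => if i < N then v i else w (i - N)); apply.
have hw i : (if N + i < N then v (N + i) else w (N + i - N)) = w i.
  by rewrite ltnNge leq_addr /= addKn.
split.
  apply: solution_ext Hsol => [c /ltn_codes [c1 c2]|i iN|i iN]; rewrite ?xE ?hw //.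
  by rewrite iN.
move=> i iN j jN; rewrite !hw iN jN divnMDl // divn_small // addn0 modnMDl modn_small //.
rewrite divnMDl // divn_small // addn0 modnMDl modn_small //.
exact: Hnear.
Qed.

Definition BGame (n : nat) (X : nat -> nat) : bexp :=
  let N := (core n).+4 in let o := ratios_end n + 1 in
  let S c := X (ufst c * N + usnd c) in
  let V i := X (o + i) in let W i := X (o + (N + i)) in
  let r i j := X (roots_end n + (i * N + j).+1) in
  BAnd (BAll N (fun l => BPin N l (fun j => X (l * N + j)) (X (roots_end n))))
  (BAnd (BWff (BValid (fun l j => X (l * N + j))) (alls n) N (core n))
  (BAnd (BLt czero (X (ratios_end n)))
    (BNot (BAnd (BSolution S V W (core n)) (BAll N (fun i => BAll N (fun j => BOr
      (BNear (X (ratios_end n)) (r i j) (V i) (V j) (W i) (W j))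
      (BNear (X (ratios_end n)) (r j i) (V j) (V i) (W j) (W i))))))))).

Lemma bev_game n (K : rcfType) (I : nat -> K) X : code_hom I ->
  bev (order_of I) (BGame n X) <-> game_theory n (I \o X).
Proof.
move=> HI; apply: bev_and; first by apply: bev_all => l _; apply: bev_pin.
apply: bev_and; first by apply: bev_wff (core_lt n) => // c _; apply: bev_valid.
apply: bev_and; first exact: bev_gt0.
apply: bev_not; apply: bev_and; first exact: bev_solution.
apply: bev_all => i _; apply: bev_all => j _.
by apply: bev_or; apply: bev_near.
Qed.

(* Computability of the matrix *)
#[local] Hint Resolve comp_pcode : comp.

Lemma comp_nonzero_code A : computable A -> computable (fun e => nonzero_code (A e)).
Proof. by move=> HA; apply: comp_bex => //; apply: comp_neg; apply: comp_eq; [apply: comp_look; [exact: (comp_shift 1 HA)|]|]; cmp. Qed.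
#[local] Hint Resolve comp_nonzero_code : comp.

Lemma comp_alls A : computable A -> computable (fun e => alls (A e)).
Proof.
have Hs (B C : (nat -> nat) -> nat) : computable B -> computable C -> computable (fun e => strip (B e) (C e)).
  by move=> HB HC; apply: comp_nrec; cmp.
move=> HA; apply: comp_nrec => //; first by cmp.
apply: comp_if; [apply: comp_eq; [apply: comp_ufst; apply: Hs; [exact: (comp_shift 2 HA)|]|]|..]; cmp.
Qed.

Lemma comp_core A : computable A -> computable (fun e => core (A e)).
Proof. by move=> HA; apply: comp_nrec; [|cmp|apply: comp_alls]. Qed.
#[local] Hint Resolve comp_alls comp_core : comp.

Ltac bc := lazymatch goal with
  | |- bcomp (fun e => BEq (@?a e) (@?b e)) => apply: bcomp_eq; cmp
  | |- bcomp (fun e => BLt (@?a e) (@?b e)) => apply: bcomp_lt; cmp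
  | |- bcomp (fun e => BLe (@?a e) (@?b e)) => apply: bcomp_le; cmp
  | |- bcomp (fun e => BCst (@?a e)) => apply: bcomp_cst; cmp
  | |- bcomp (fun e => BNot (@?a e)) => apply: bcomp_not; bc
  | |- bcomp (fun e => BIff (@?a e) (@?b e)) => apply: bcomp_iff; bc
  | |- bcomp (fun e => BImp (@?a e) (@?b e)) => apply: bcomp_imp; bc
  | |- bcomp (fun e => BAnd (@?a e) (@?b e)) => apply: bcomp_and; bc
  | |- bcomp (fun e => BOr (@?a e) (@?b e)) => apply: bcomp_or; bc
  | |- bcomp (fun e => BAll (@?a e) (@?b e)) => apply: bcomp_all; [cmp|cbn beta; bc]
  | _ => idtac
  end.

(** Such a family stays computable in every computable environment, so it may be used under bounded
    quantifiers and recursion. *)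
Definition cfam (nu : (nat -> nat) -> nat -> nat) : Prop := forall G C,
  (forall i, computable (fun e => G e i)) -> computable C -> computable (fun e => nu (G e) (C e)).

Section Components.
Variables S V : (nat -> nat) -> nat -> nat.
Hypotheses (HS : cfam S) (HV : cfam V).
Variables A B C : (nat -> nat) -> nat.
Hypotheses (HA : computable A) (HB : computable B) (HC : computable C).

Lemma bcomp_addnode : bcomp (fun e => BAddnode (S e) (V e) (A e)).
Proof. by unfold cfam in HS, HV; rewrite /BAddnode; bc. Qed.

Lemma bcomp_mulnode : bcomp (fun e => BMulnode (S e) (V e) (A e)).
Proof. by unfold cfam in HS, HV; rewrite /BMulnode; bc. Qed.

Lemma bcomp_sgn : bcomp (fun e => BSgn (A e) (B e)).
Proof. by rewrite /BSgn; bc. Qed.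

Lemma bcomp_bound : bcomp (fun e => BBound (A e) (B e) (C e)).
Proof. by rewrite /BBound; bc. Qed.

End Components.

Lemma bcomp_near A B C D E F : computable A -> computable B -> computable C -> computable D ->
  computable E -> computable F ->
  bcomp (fun e => BNear (A e) (B e) (C e) (D e) (E e) (F e)).
Proof.
by move=> *; apply: bcomp_and; [|apply: bcomp_and];
  [apply: bcomp_bound|apply: bcomp_bound|apply: bcomp_sgn]; cmp.
Qed.

Lemma cfam_shift V : cfam V -> cfam (fun e => V (fun i => e i.+1)).
Proof. by move=> HV G C HG HC; apply: (HV (fun e i => G e i.+1)). Qed.

Lemma bcomp_truth V A : cfam V -> computable A -> bcomp (fun e => BTruth (V e) (A e)).
Proof.
move=> HV HA; apply: bcomp_rec; [by cmp|by cmp|].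
have := cfam_shift (cfam_shift HV); cbn beta => {}HV; unfold cfam in HV.
bc.
Qed.

Lemma bcomp_valid (X : (nat -> nat) -> nat -> nat -> nat) A :
  (forall B C, computable B -> computable C -> computable (fun e => X e (B e) (C e))) ->
  computable A -> bcomp (fun e => BValid (X e) (A e)).
Proof. by move=> HX HA; rewrite /BValid /BRoot; bc. Qed.

Lemma bcomp_wft (va : (nat -> nat) -> nat -> bexp) A B C : computable A -> computable B ->
  computable C -> (forall G D, (forall i, computable (fun e => G e i)) -> computable D ->
    bcomp (fun e => va (G e) (D e))) ->
  bcomp (fun e => BWft (va e) (A e) (B e) (C e)).
Proof.
move=> HA HB HC Hva; apply: bcomp_rec => //.
have HA2 : computable (fun e => A (fun i => e i.+2)) := comp_shift 2 HA.
apply: bcomp_or; first by bc.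
apply: bcomp_and; first by bc.
by apply: (Hva (fun e i => e i.+2)); cmp.
Qed.

Lemma bcomp_wff (va : (nat -> nat) -> nat -> bexp) A B C : computable A -> computable B ->
  computable C -> (forall G D, (forall i, computable (fun e => G e i)) -> computable D ->
    bcomp (fun e => va (G e) (D e))) ->
  bcomp (fun e => BWff (va e) (A e) (B e) (C e)).
Proof.
move=> HA HB HC Hva; apply: bcomp_rec => //.
have Hva2 G D : (forall i, computable (fun e => G e i)) -> computable D ->
    bcomp (fun e => va (fun i => G e i.+2) (D e)).
  by move=> HG HD; apply: (Hva (fun e i => G e i.+2)).
apply: bcomp_or; first by bc.
apply: bcomp_and; first by bc.
by apply: bcomp_and; apply: bcomp_wft => //; try exact: (comp_shift 2 HA); try exact: (comp_shift 2 HB); cmp.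
Qed.

Lemma bcomp_pin (X : (nat -> nat) -> nat -> nat) A B C : cfam X -> computable A ->
  computable B -> computable C -> bcomp (fun e => BPin (A e) (B e) (X e) (C e)).
Proof.
move=> HX HA HB HC; have HX1 := cfam_shift HX; unfold cfam in HX, HX1; cbn beta in HX1.
have HB1 : computable (fun e => B (fun i => e i.+1)) := comp_shift 1 HB.
have HC1 : computable (fun e => C (fun i => e i.+1)) := comp_shift 1 HC.
by rewrite /BPin /BRoot; bc.
Qed.

Lemma bcomp_solution S V W A : cfam S -> cfam V -> cfam W -> computable A ->
  bcomp (fun e => BSolution (S e) (V e) (W e) (A e)).
Proof.
move=> HS HV HW HA; apply: bcomp_and; last by apply: bcomp_not; apply: bcomp_truth.
apply: bcomp_all; first by cmp.
apply: bcomp_and; first by apply: bcomp_addnode; [exact: cfam_shift|exact: cfam_shift|cmp].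
apply: bcomp_and; first by apply: bcomp_mulnode; [exact: cfam_shift|exact: cfam_shift|cmp].
by apply: bcomp_sgn; [apply: (HV (fun e i => e i.+1))|apply: (HW (fun e i => e i.+1))]; cmp.
Qed.

Lemma bcomp_game X A : cfam X -> computable A -> bcomp (fun e => BGame (A e) (X e)).
Proof.
move=> HX HA; rewrite /BGame /ratios_end /roots_end.
have HA1 G : (forall i, computable (fun e => G e i)) -> computable (fun e => A (G e)).
  exact: comp_sub.
have HN G : (forall i, computable (fun e => G e i)) -> computable (fun e => (core (A (G e))).+4).
  by move=> /HA1 H; cmp.
unfold cfam in HX; cbn zeta.
apply: bcomp_and.
  apply: bcomp_all; first by cmp.
  apply: bcomp_pin; [by unfold cfam; cmp| | |]; by cmp.
apply: bcomp_and.
  apply: bcomp_wff; [by cmp|by cmp|by cmp|] => G D HG HD.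
  by apply: bcomp_valid => // B C HB HC; cmp.
apply: bcomp_and; first by apply: bcomp_lt; cmp.
apply: bcomp_not; apply: bcomp_and.
  by apply: bcomp_solution; unfold cfam; cmp.
apply: bcomp_all; first by cmp.
apply: bcomp_all; first by cmp.
by apply: bcomp_or; apply: bcomp_near; cmp.
Qed.

Theorem theorem7p2 : decidable_set universal_fragment_T_A.
Proof.
apply: (@decidable_game R game_kind game_len BGame game_theory).
- by rewrite /game_kind /ratios_end /roots_end; cmp.
- by rewrite /game_len /roots_end; cmp.
- move=> X HX; have [H _] : bcomp (fun e => BGame (e 1) (X (e 1) (e 2))).
    by apply: bcomp_game; [move=> G C HG HC; apply: (comp3 HX)|]; cmp.
  by apply: H; cmp.
- move=> X HX; have [_ H] : bcomp (fun e => BGame (e 0) (X (e 0) (e 1))).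
    by apply: bcomp_game; [move=> G C HG HC; apply: (comp3 HX)|]; cmp.
  exact: H.
- by move=> n K I HI X; apply: bev_game.
- exact: sdef_game_theory.
- exact: universal_fragment_game.
Qed.
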